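(* Let $F\in L^\infty\setminus\{0\}$, let $\psi$ be a nonconstant inner function and let $u\in H^2\setminus\{0\}$ be such that $\ker T_F\neq\{0\}$ and $u\,C_\psi(\ker T_F)\subseteq H^2$. Let $u_o$ be the outer factor of $u$. Then there exists a minimal Toeplitz kernel containing $u\,C_\psi(\ker T_F)$, and it is $\ker T_G$ with $$G=\psi\,(F\circ\psi)\,\frac{\overline{u}}{z\,u_o}.$$ Moreover, if $\phi_m$ is a maximal vector for $\ker T_F$, then $u(\phi_m\circ\psi)$ is a maximal vector for $\ker T_G$.
   Context: $\mathbb{D}$ is the open unit disc, $\mathbb{T}$ the unit circle with normalized Lebesgue measure, $L^\infty=L^\infty(\mathbb{T})$, and $H^2$ is the Hardy space of $\mathbb{D}$, regarded as a closed subspace of $L^2(\mathbb{T})$ via boundary values; $P_{H^2}:L^2(\mathbb{T})\to H^2$ is the orthogonal projection. For $g\in L^\infty$ the Toeplitz operator is $T_g:H^2\to H^2$, $T_gf=P_{H^2}(gf)$; a Toeplitz kernel is a space of the form $\ker T_g$ with $g\in L^\infty$. For an inner function $\psi$ (bounded analytic on $\mathbb{D}$ with $|\psi|=1$ a.e. on $\mathbb{T}$), $C_\psi f=f\circ\psi$; for $F\in L^\infty$, $F\circ\psi$ is the composition of $F$ with the boundary function of $\psi$, and $z$ in symbols denotes the identity function on $\mathbb{T}$. The minimal Toeplitz kernel containing a set $E\subseteq H^2$ is a Toeplitz kernel $\ker T_g\supseteq E$ such that $\ker T_g\subseteq\ker T_h$ for every $h\in L^\infty$ with $E\subseteq\ker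 T_h$. A function $k\in H^2\setminus\{0\}$ is a maximal vector for $\ker T_g$ if $\ker T_g$ is the minimal Toeplitz kernel containing $\{k\}$. *)

(* Defs.v *)
From HB Require Import structures.
From mathcomp Require Import all_boot all_order all_algebra.
From mathcomp Require Import complex.
From mathcomp Require Import all_classical all_reals all_analysis.
Import Order.TTheory GRing.Theory Num.Theory.
Import numFieldNormedType.Exports.

Set Implicit Arguments.
Unset Strict Implicit.
Unset Printing Implicit Defensive.

Local Open Scope classical_set_scope.
Local Open Scope ring_scope.

(* Functions on the disc and functions on the circle are both represented by
   total functions R[i] -> R[i].  Every notion below depends only on the values
   on the open disc (for the former), resp. on the unit circle (for the
   latter); two elements of H^2 are the same when they agree on the disc. *)

(* The topology of R[i] induced by its norm. *)
HB.instance Definition _ (R : realType) :=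
  PseudoMetricNormedZmod.copy R[i] ((R[i] : numFieldType)^o).

Section Hardy.
Variable R : realType.
Local Notation C := R[i].

Definition disc : set C := [set z | `|z| < 1].

Definition eit (t : R) : C := Complex (cos t) (sin t).

Definition cexp (z : C) : C :=
  real_complex R (expR (complex.Re z)) * eit (complex.Im z).

(* Parametrisation of the unit circle by arc length; the normalisation by
   2 * pi is in [circle_int]. *)
Definition angles : set R := `[0, 2 * pi]%classic.

Definition ae_circle (P : C -> Prop) : Prop :=
  {ae @lebesgue_measure R, forall t, angles t -> P (eit t)}.

Definition circle_int (f : C -> C) : C :=
  Complex
    ((2 * pi)^-1 *
       (\int[@lebesgue_measure R]_(t in angles) complex.Re (f (eit t))))
    ((2 * pi)^-1 *
       (\int[@lebesgue_measure R]_(t in angles) complex.Im (f (eit t)))).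

(* [lebesgue_measure] lives on the Borel sigma-algebra, so Lebesgue
   measurability is expressed as almost everywhere equality with a Borel
   function. *)
Definition circle_measurable (f : C -> C) : Prop :=
  exists g : R -> C,
    [/\ measurable_fun angles (fun t => complex.Re (g t)),
        measurable_fun angles (fun t => complex.Im (g t)) &
        {ae @lebesgue_measure R, forall t, angles t -> f (eit t) = g t}].

Definition Linfty (f : C -> C) : Prop :=
  circle_measurable f /\
  exists M : R, ae_circle (fun w => `|f w| <= real_complex R M).

Definition inner_L2 (f g : C -> C) : C :=
  circle_int (fun w => f w * conjc (g w)).

Definition analytic_disc (f : C -> C) : Prop :=
  exists a : nat -> C, forall z, disc z ->
    series (fun n => a n * z ^+ n) @ \oo --> f z.

Definition hardy2 : set (C -> C) :=
  [set f | analytic_disc f /\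
    exists M : R, forall r : R, 0 <= r < 1 ->
      (\int[@lebesgue_measure R]_(t in angles)
         (complex.Re `|f (real_complex R r * eit t)| ^+ 2)%:E <= M%:E)%E].

(* Boundary function: radial limit (with a junk value where there is none). *)
Definition bv (f : C -> C) (w : C) : C :=
  lim (f (real_complex R r * w) @[r --> (1 : R)^'-]).

Definition nonzero_disc (f : C -> C) : Prop := exists2 z, disc z & f z != 0.

Definition inner_function (psi : C -> C) : Prop :=
  [/\ analytic_disc psi,
      exists M : R, forall z, disc z -> `|psi z| <= real_complex R M &
      ae_circle (fun w => `|bv psi w| = 1)].

Definition nonconstant_disc (f : C -> C) : Prop :=
  exists z w, [/\ disc z, disc w & f z != f w].

(* f = c exp ( \int (w + z) / (w - z) k(w) dm(w) ), with |c| = 1 and k real and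
   integrable; then k = log |f| a.e. on the circle. *)
Definition outer_function (f : C -> C) : Prop :=
  exists (c : C) (k : C -> R),
    [/\ `|c| = 1,
        (@lebesgue_measure R).-integrable angles (fun t => (k (eit t))%:E) &
        forall z, disc z ->
          f z = c * cexp (circle_int
                  (fun w => (w + z) / (w - z) * real_complex R (k w)))].

(* Outer factors are determined up to a unimodular constant. *)
Definition outer_factor (u uo : C -> C) : Prop :=
  [/\ hardy2 uo, outer_function uo &
      exists2 theta, inner_function theta &
        forall z, disc z -> u z = theta z * uo z].

(* h = P_{H^2} f, for f a square integrable function on the circle. *)
Definition is_proj_hardy2 (f h : C -> C) : Prop :=
  hardy2 h /\
  forall k, hardy2 k -> inner_L2 (fun w => f w - bv h w) (bv k) = 0.

(* T_g f = h *)
Definition is_toeplitz (g f h : C -> C) : Prop :=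
  is_proj_hardy2 (fun w => g w * bv f w) h.

Definition kerT (g : C -> C) : set (C -> C) :=
  [set f | hardy2 f /\ is_toeplitz g f (fun=> 0)].

Definition toeplitz_kernel (K : set (C -> C)) : Prop :=
  exists2 g, Linfty g & K = kerT g.

Definition minimal_toeplitz_kernel (E K : set (C -> C)) : Prop :=
  [/\ toeplitz_kernel K, E `<=` K &
      forall h, Linfty h -> E `<=` kerT h -> K `<=` kerT h].

Definition maximal_vector (k : C -> C) (K : set (C -> C)) : Prop :=
  [/\ hardy2 k, nonzero_disc k & minimal_toeplitz_kernel [set k] K].

(* f |-> u (f o psi) *)
Definition weighted_comp (u psi f : C -> C) : C -> C :=
  fun z => u z * f (psi z).

Definition symbol_G (F psi u uo : C -> C) : C -> C :=
  fun w => bv psi w * F (bv psi w) * (conjc (bv u w) / (w * bv uo w)).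

End Hardy.

(* Main.v *)
Require Import Defs.
From HB Require Import structures.
From mathcomp Require Import all_boot all_order all_algebra.
From mathcomp Require Import complex.
From mathcomp Require Import all_classical all_reals all_analysis.
From mathcomp Require Import measurable_realfun.
From mathcomp Require Import ring lra.
Import Order.TTheory GRing.Theory Num.Theory.
Import numFieldNormedType.Exports.
Set Implicit Arguments.
Unset Strict Implicit.
Unset Printing Implicit Defensive.
Local Open Scope classical_set_scope.
Local Open Scope ring_scope.

(** On the circle, f lies in ker T_h exactly when h f = conj(z g) for some g in H^2, called here the
    cofactor of f: orthogonality of h f to H^2 says that conj(h f) has only positive frequencies
    ([kerTP]).

    Let F f = conj(z g) and k = u (f o psi). Composing with psi and using |psi| = 1 and |u| = |uo|
    on the circle gives G k = conj(z (g o psi) uo) ([symbol_G_image]). As G is bounded, the product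
    (g o psi) uo is square integrable, hence in H^2, and k lies in ker T_G ([image_sub_kerT]).

    Minimality comes from those f whose cofactor g is outer ([kerT_G_sub]). Suppose h k = conj(z q),
    and let x be in ker T_G, say G x = conj(z r). Put X = conj(z h x). The identity (h x)(G k) = (h
    k)(G x) becomes X (g o psi) uo = q r. Here q r is in H^1, the factor (g o psi) uo is outer and X
    is square integrable, so X is in H^2; and h x = conj(z X) puts x in ker T_h. Thus the single
    function k already has ker T_G as its minimal kernel.

    Such an f exists: multiply a nonzero element of ker T_F by the inner factor of its cofactor
    ([exists_quasi_invertible]). A maximal vector f has an outer cofactor by itself
    ([maximal_quasi_invertible]): if the cofactor is I Q with I inner and Q outer, then f lies in
    ker T_(I F), so minimality gives ker T_F inside ker T_(I F); applied to I f this shows that I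
    divides Q, so I is constant.

    Outerness is used in the form [quasi_invertible]: there are bounded analytic e_n with |e_n f| <=
    1 and e_n f -> 1 on the disc. This passes to products and to composition with psi, and it gives
    the division step ([quasi_invertible_moment]). The remaining work is H^2 theory: radial limits
    ([fatou_radial], [hardy2_boundary]), factorization ([log_integrable], [inner_outer]), and the
    facts that the boundary function of psi pulls null sets back to null sets and that boundary
    values commute with composition ([null_comp], [boundary_comp]). *)

Local Notation Re := complex.Re.
Local Notation Im := complex.Im.
Local Notation "x %:C" := (real_complex _ x) (format "x %:C").

                                                                                
                                                      
                                                                              
                                                                               
                                                                        
                                                                       
                                                                              
                                                                     

                                                                         
                                                                              
                                                                            
                                                                             
                      

                                    

(** * Normalised integrals and almost-everywhere statements on the circle *)

Section CircleIntegral.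
Variable R : realType.
Local Notation mu := (@lebesgue_measure R).
Local Notation D := (@angles R).

Definition mean (g : R -> R) : R := (2 * pi)^-1 * \int[mu]_(t in D) g t.
Definition L1 (g : R -> R) : Prop := mu.-integrable D (EFin \o g).
Definition meas (g : R -> R) : Prop := measurable_fun D g.

Lemma measurable_angles : measurable D.
Proof. exact: measurable_itv. Qed.
Local Hint Resolve measurable_angles : core.

Lemma twopi_gt0 : 0 < 2 * pi :> R.
Proof. by rewrite mulr_gt0// pi_gt0. Qed.

Lemma measure_angles : mu D = (2 * pi)%:E.
Proof. by rewrite lebesgue_measure_itv/= lte_fin twopi_gt0 oppr0 adde0. Qed.

Lemma L1_meas g : L1 g -> meas g.
Proof. by move=> /measurable_int /measurable_EFinP. Qed.

Lemma L1_eq f g : (forall t, D t -> f t = g t) -> L1 f -> L1 g.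
Proof.
move=> fg; apply: eq_integrable => // t; rewrite inE => Dt /=.
by rewrite fg.
Qed.

Lemma L1_le f g : meas f -> (forall t, D t -> `|f t| <= g t) -> L1 g -> L1 f.
Proof.
move=> mf fg; apply: le_integrable => //; first exact/measurable_EFinP.
by move=> t Dt /=; rewrite lee_fin (le_trans (fg _ Dt))// ler_norm.
Qed.

Lemma L1_cst c : L1 (cst c).
Proof.
apply/integrableP; split; first by apply/measurable_EFinP; exact: measurable_cst.
by rewrite /= integral_cst//= [X in (_ * X)%E]measure_angles -EFinM ltry.
Qed.

Lemma L1_bounded f M : meas f -> (forall t, D t -> `|f t| <= M) -> L1 f.
Proof. by move=> mf fM; apply: L1_le mf fM (L1_cst M). Qed.

Lemma L1D f g : L1 f -> L1 g -> L1 (fun t => f t + g t).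
Proof. by move=> lf lg; apply: eq_integrable (integrableD _ lf lg). Qed.

Lemma L1Z c f : L1 f -> L1 (fun t => c * f t).
Proof. by move=> lf; apply: eq_integrable (integrableZl _ c lf). Qed.

Lemma L1N f : L1 f -> L1 (fun t => - f t).
Proof. by move=> /(@L1Z (-1)); apply: L1_eq => t _; rewrite mulN1r. Qed.

Lemma L1B f g : L1 f -> L1 g -> L1 (fun t => f t - g t).
Proof. by move=> lf /L1N; exact: L1D. Qed.

Lemma L1_norm f : L1 f -> L1 (fun t => `|f t|).
Proof. by move=> /integrable_norm. Qed.

Lemma eq_mean f g : (forall t, D t -> f t = g t) -> mean f = mean g.
Proof.
by move=> fg; congr (_ * _); apply: eq_Rintegral => t; rewrite inE => /fg.
Qed.

Lemma meanD f g : L1 f -> L1 g -> mean (fun t => f t + g t) = mean f + mean g.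
Proof. by move=> lf lg; rewrite /mean RintegralD// mulrDr. Qed.

Lemma meanZ c f : L1 f -> mean (fun t => c * f t) = c * mean f.
Proof. by move=> lf; rewrite /mean RintegralZl// mulrCA. Qed.

Lemma meanN f : L1 f -> mean (fun t => - f t) = - mean f.
Proof.
move=> lf; rewrite -mulN1r -meanZ//; apply: eq_mean => t _.
by rewrite mulN1r.
Qed.

Lemma meanB f g : L1 f -> L1 g -> mean (fun t => f t - g t) = mean f - mean g.
Proof. by move=> lf lg; rewrite meanD ?meanN//; exact: L1N. Qed.

Lemma mean_cst c : mean (fun=> c) = c.
Proof.
rewrite /mean Rintegral_cst// (_ : fine _ = 2 * pi); last by rewrite [X in fine X]measure_angles.
by rewrite mulrCA mulVf ?mulr1// gt_eqF// twopi_gt0.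
Qed.

Lemma le_mean f g : L1 f -> L1 g -> (forall t, D t -> f t <= g t) ->
  mean f <= mean g.
Proof.
move=> lf lg fg; rewrite ler_wpM2l ?invr_ge0 ?(ltW twopi_gt0)//.
exact: le_Rintegral.
Qed.

Lemma mean_ge0 f : (forall t, D t -> 0 <= f t) -> 0 <= mean f.
Proof.
move=> f0; rewrite mulr_ge0 ?invr_ge0 ?(ltW twopi_gt0)//.
exact: Rintegral_ge0.
Qed.

Lemma ler_norm_mean f : L1 f -> `|mean f| <= mean (fun t => `|f t|).
Proof.
move=> lf; rewrite normrM gtr0_norm ?invr_gt0 ?twopi_gt0// ler_wpM2l//.
  by rewrite invr_ge0 ltW ?twopi_gt0.
exact: le_normr_Rintegral.
Qed.

Definition aeD (P : R -> Prop) := {ae mu, forall t, D t -> P t}.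

Lemma aeDW (P : R -> Prop) : (forall t, D t -> P t) -> aeD P.
Proof.
by move=> h; apply: negligibleS (negligible_set0 mu) => t /(_ (h t)).
Qed.

Lemma aeDS (P Q : R -> Prop) : (forall t, D t -> P t -> Q t) -> aeD P -> aeD Q.
Proof.
move=> PQ; apply: negligibleS => t /= nQ h; apply: nQ => Dt.
exact: PQ (h Dt).
Qed.

Lemma aeD_forall (P : nat -> R -> Prop) : (forall n, aeD (P n)) ->
  aeD (fun t => forall n, P n t).
Proof.
move=> h; apply: negligibleS (negligible_bigcup h) => t /= nP.
by apply: contrapT => nb; apply: nP => Dt n; apply: contrapT => nPn; apply: nb; exists n => // /(_ Dt).
Qed.

Lemma aeD_and (P Q : R -> Prop) : aeD P -> aeD Q -> aeD (fun t => P t /\ Q t).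
Proof.
move=> hP hQ; have := @aeD_forall (fun n => if n is 0%N then P else Q).
have h n : aeD (if n is 0%N then P else Q) by case: n.
by move=> /(_ h); apply: aeDS => t _ H; split; [exact: H 0%N|exact: H 1%N].
Qed.

Lemma aeDS2 (P Q S : R -> Prop) : (forall t, D t -> P t -> Q t -> S t) ->
  aeD P -> aeD Q -> aeD S.
Proof. by move=> PQ hP hQ; apply: aeDS (aeD_and hP hQ) => t Dt []; exact: PQ. Qed.

Lemma aeD_ex (P : R -> Prop) : aeD P -> exists2 t, D t & P t.
Proof.
move=> hP; apply: contrapT => nP.
have : mu.-negligible D.
  apply: negligibleS hP => t Dt /=; apply/not_implyP; split => // Pt.
  by apply: nP; exists t.
move/negligibleP => /(_ measurable_angles) /eqP.
by rewrite [X in X == _]measure_angles eqe gt_eqF// twopi_gt0.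
Qed.

End CircleIntegral.

(** * Integrals of functions that are not known to be measurable *)

Section NonmeasurableIntegral.
Context d (T : measurableType d) (R : realType).
Variables (mu : {measure set T -> \bar R}) (D : set T).
Local Open Scope ereal_scope.

Import HBNNSimple.

(** These suprema over simple functions make sense without measurability of [f] and [g], and cutting
    a simple function to 0 on a null set does not change its integral. *)
Lemma nnintegral_le_offnull (N : set T) (f g : T -> \bar R) :
  measurable N -> mu N = 0 -> (forall t, 0 <= g t) ->
  (forall t, ~ N t -> f t <= g t) ->
  ereal_sup [set sintegral mu h | h in [set h : {nnsfun T >-> R} |
    forall x, (h x)%:E <= f x]] <=
  ereal_sup [set sintegral mu h | h in [set h : {nnsfun T >-> R} |
    forall x, (h x)%:E <= g x]].
Proof.
move=> mN N0 g0 fg; apply: ub_ereal_sup => _ [h hf <-].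
have mNC : measurable (~` N) by exact: measurableC.
rewrite (_ : sintegral mu h = sintegral mu (proj_nnsfun h mNC)).
  apply: ereal_sup_ubound; exists (proj_nnsfun h mNC) => // t /=.
  rewrite mindicE; case: (boolP (t \in ~` N)) => [|_]; last by rewrite mulr0.
  rewrite inE mulr1 => /fg; apply: le_trans; exact: hf.
rewrite -!integralT_nnsfun; apply: ge0_ae_eq_integral => //=.
- exact/measurable_EFinP.
- by apply/measurable_EFinP; exact: measurable_funM.
- by move=> t _; rewrite lee_fin.
- by move=> t _; rewrite lee_fin mulr_ge0.
- exists N; split => // t; apply: contra_notP => Nt _ /=.
  by rewrite mindicE mem_set//= mulr1.
Qed.

(** [circle_int] is applied to radial limits and symbols that agree with Borel functions only almost
    everywhere, so a representative must be substituted without knowing that the integrand itself is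
    measurable. *)
Lemma integral_ae_nonmeasurable (f g : T -> \bar R) :
  {ae mu, forall t, D t -> f t = g t} ->
  \int[mu]_(t in D) f t = \int[mu]_(t in D) g t.
Proof.
move=> [N [mN N0 fgN]].
have fg t : ~ N t -> (f \_ D) t = (g \_ D) t.
  move=> Nt; rewrite /patch; case: ifPn => //; rewrite inE => Dt.
  by apply: contrapT => nfg; apply: Nt; apply: fgN => /= /(_ Dt).
rewrite /integral; congr (_ - _); apply/eqP; rewrite eq_le; apply/andP; split;
  apply: (nnintegral_le_offnull mN N0) => //= t Nt;
  by rewrite unlock fg.
Qed.

End NonmeasurableIntegral.

(** * Dominated convergence and measurability on the circle *)

Section CircleIntegralLimits.
Variable R : realType.
Local Notation mu := (@lebesgue_measure R).
Local Notation D := (@angles R).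
Local Hint Resolve measurable_angles : core.

Lemma mean_ae (f g : R -> R) : aeD (fun t => f t = g t) -> mean f = mean g.
Proof.
move=> fg; congr (_ * fine _); apply: integral_ae_nonmeasurable.
by apply: aeDS fg => t _ /= ->.
Qed.

Lemma mean_dct (f_ : nat -> R -> R) (f g : R -> R) :
  (forall n, meas (f_ n)) -> meas f ->
  aeD (fun t => f_ ^~ t @ \oo --> f t) -> L1 g ->
  aeD (fun t => forall n, `|f_ n t| <= g t) ->
  L1 f /\ (fun n => mean (f_ n)) @ \oo --> mean f.
Proof.
move=> mf_ mf ff lg fg.
have [] := @dominated_convergence _ _ _ mu D (@measurable_angles R)
  (fun n => EFin \o f_ n) (EFin \o f) (EFin \o g).
- by move=> n; apply/measurable_EFinP; exact: mf_.
- by apply/measurable_EFinP; exact: mf.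
- by apply: aeDS ff => t _ h; apply: cvg_EFin => //; exact: nearW.
- exact: lg.
- by apply: negligibleS fg => t /= nh h; apply: nh => n Dt; rewrite lee_fin h.
move=> lf _ cv; split => //.
apply: cvgMr => //; rewrite /Rintegral.
apply: fine_cvg; rewrite fineK//.
exact: (@integrable_fin_num _ _ _ mu D (@measurable_angles R) _ lf).
Qed.

Lemma meas_cst (c : R) : @meas R (fun=> c).
Proof. exact: measurable_cst. Qed.
Lemma measD (f g : R -> R) : meas f -> meas g -> meas (fun t => f t + g t).
Proof. exact: measurable_funD. Qed.
Lemma measM (f g : R -> R) : meas f -> meas g -> meas (fun t => f t * g t).
Proof. exact: measurable_funM. Qed.
Lemma measN (f : R -> R) : meas f -> meas (fun t => - f t).
Proof. exact: measurable_funN. Qed.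
Lemma measB (f g : R -> R) : meas f -> meas g -> meas (fun t => f t - g t).
Proof. exact: measurable_funB. Qed.
Lemma meas_comp (h : R -> R) (f : R -> R) : measurable_fun setT h -> meas f -> meas (fun t => h (f t)).
Proof. by move=> mh mf; exact: (measurableT_comp mh mf). Qed.
Lemma meas_continuous (f : R -> R) : continuous f -> meas f.
Proof. by move=> cf; apply: measurable_funS (continuous_measurable_fun cf). Qed.
Lemma meas_cvg (f_ : nat -> R -> R) f : (forall n, meas (f_ n)) ->
  (forall t, D t -> f_ ^~ t @ \oo --> f t) -> meas f.
Proof. exact: measurable_fun_cvg. Qed.
Lemma meas_eq (f g : R -> R) : (forall t, D t -> f t = g t) -> meas f -> meas g.
Proof. by move=> fg; apply: eq_measurable_fun => t; rewrite inE => /fg. Qed.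

End CircleIntegralLimits.

(** * Real-valued modulus and complex limits *)

Section ComplexFacts.
Variable R : realType.
Local Notation C := R[i].
Implicit Types z w : C.

                                                                                
(** The norm of [R[i]] takes its values in [R[i]]; this is the same number in [R], where it can be
    integrated and compared. *)
Definition nc z : R := ComplexField.Normc.normc z.

Lemma normcE z : `|z| = (nc z)%:C. Proof. by []. Qed.

Lemma nc_sq z : nc z ^+ 2 = Re z ^+ 2 + Im z ^+ 2.
Proof. by case: z => a b; rewrite /nc /= sqr_sqrtr// addr_ge0// sqr_ge0. Qed.

Lemma nc_ge0 z : 0 <= nc z.
Proof. by case: z => a b; exact: sqrtr_ge0. Qed.

Lemma ncM z w : nc (z * w) = nc z * nc w.
Proof. exact: ComplexField.Normc.normcM. Qed.

Lemma nc0 : nc 0 = 0. Proof. exact: ComplexField.Normc.normc0. Qed.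
Lemma nc1 : nc 1 = 1. Proof. exact: ComplexField.Normc.normc1. Qed.

Lemma ncV z : nc z^-1 = (nc z)^-1.
Proof. exact: ComplexField.Normc.normcV. Qed.

Lemma ncX z n : nc (z ^+ n) = nc z ^+ n.
Proof. by elim: n => [|n ih]; rewrite ?expr0 ?nc1// !exprS ncM ih. Qed.

Lemma ncD z w : nc (z + w) <= nc z + nc w.
Proof. exact: (@le_normcD R z w). Qed.

Lemma ncN z : nc (- z) = nc z.
Proof. exact: normcN. Qed.

Lemma ncC z w : nc (z - w) = nc (w - z).
Proof. by rewrite -ncN opprB. Qed.

Lemma ncB z w : nc (z - w) <= nc z + nc w.
Proof. by rewrite -(ncN w) ncD. Qed.

Lemma ncBD z w : nc z <= nc (z - w) + nc w.
Proof. by rewrite -{1}(subrK w z) ncD. Qed.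

Lemma nc_dist z w : `|nc z - nc w| <= nc (z - w).
Proof.
rewrite ler_norml; have := ncBD z w; have := ncBD w z; rewrite (ncC w z) => h1 h2.
by apply/andP; split; lra.
Qed.

Lemma nc_conj z : nc (conjc z) = nc z.
Proof. by case: z => a b; rewrite /nc /= sqrrN. Qed.

Lemma nc_real (x : R) : nc x%:C = `|x|.
Proof. by rewrite /nc /= expr0n addr0 sqrtr_sqr. Qed.

Lemma nc_eq0 z : (nc z == 0) = (z == 0).
Proof.
apply/eqP/eqP => [|->]; last exact: nc0.
exact: ComplexField.Normc.eq0_normc.
Qed.

Lemma nc_gt0 z : (0 < nc z) = (z != 0).
Proof. by rewrite lt_def nc_ge0 andbT nc_eq0. Qed.

Lemma Re_le_nc z : `|Re z| <= nc z.
Proof.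
by rewrite -(ler_pXn2r (n := 2)) ?nnegrE ?nc_ge0// -normrX ger0_norm ?sqr_ge0// nc_sq lerDl sqr_ge0.
Qed.

Lemma Im_le_nc z : `|Im z| <= nc z.
Proof.
by rewrite -(ler_pXn2r (n := 2)) ?nnegrE ?nc_ge0// -normrX ger0_norm ?sqr_ge0// nc_sq lerDr sqr_ge0.
Qed.

Lemma nc_le z : nc z <= `|Re z| + `|Im z|.
Proof.
rewrite -(ler_pXn2r (n := 2)) ?nnegrE ?nc_ge0 ?addr_ge0// nc_sq sqrrD.
by rewrite !real_normK ?num_real// lerD2r lerDl mulrn_wge0// mulr_ge0.
Qed.

Lemma nc_sum (I : Type) (r : seq I) (P : pred I) (F : I -> C) :
  nc (\sum_(i <- r | P i) F i) <= \sum_(i <- r | P i) nc (F i).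
Proof.
apply: (big_ind2 (fun z x => nc z <= x)) => [|z x w y h1 h2|//].
  by rewrite nc0.
by rewrite (le_trans (ncD _ _))// lerD.
Qed.

Lemma ReD z w : Re (z + w) = Re z + Re w. Proof. by case: z; case: w. Qed.
Lemma ImD z w : Im (z + w) = Im z + Im w. Proof. by case: z; case: w. Qed.
Lemma ReN z : Re (- z) = - Re z. Proof. by case: z. Qed.
Lemma ImN z : Im (- z) = - Im z. Proof. by case: z. Qed.
Lemma ReB z w : Re (z - w) = Re z - Re w. Proof. by case: z; case: w. Qed.
Lemma ImB z w : Im (z - w) = Im z - Im w. Proof. by case: z; case: w. Qed.
Lemma ReM z w : Re (z * w) = Re z * Re w - Im z * Im w. Proof. by case: z; case: w. Qed.
Lemma ImM z w : Im (z * w) = Re z * Im w + Im z * Re w.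
Proof. by case: z; case: w. Qed.
Lemma ReJ z : Re (conjc z) = Re z. Proof. by case: z. Qed.
Lemma ImJ z : Im (conjc z) = - Im z. Proof. by case: z. Qed.
Lemma complex_eq z w : Re z = Re w -> Im z = Im w -> z = w.
Proof. by case: z => a b; case: w => c d /= -> ->. Qed.
Lemma conjcM z w : conjc (z * w) = conjc z * conjc w.
Proof. exact: rmorphM. Qed.
Lemma conjcX z n : conjc (z ^+ n) = conjc z ^+ n.
Proof. exact: rmorphXn. Qed.
Lemma mulcJ z : z * conjc z = (nc z ^+ 2)%:C.
Proof.
by rewrite nc_sq; case: z => a b; apply: complex_eq; rewrite /= ?expr2; ring.
Qed.

Lemma eitD (s t : R) : eit (s + t) = eit s * eit t.
Proof. by rewrite /eit; apply: complex_eq => /=; rewrite ?cosD ?sinD; ring. Qed.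

Lemma eit0 : eit (0 : R) = 1.
Proof. by rewrite /eit cos0 sin0. Qed.

Lemma nc_eit (t : R) : nc (eit t) = 1.
Proof. by rewrite /nc /= cos2Dsin2 sqrtr1. Qed.

Lemma eitJ (t : R) : eit t * conjc (eit t) = 1.
Proof. by rewrite mulcJ nc_eit expr1n. Qed.

Lemma eit_neq0 (t : R) : eit t != 0.
Proof. by rewrite -nc_gt0 nc_eit. Qed.

Lemma eitX (t : R) n : eit t ^+ n = eit (n%:R * t).
Proof.
elim: n => [|n ih]; first by rewrite mul0r eit0.
by rewrite exprS ih -eitD -{1}(mul1r t) -mulrDl nat1r.
Qed.

Lemma disc_nc z : disc z <-> nc z < 1.
Proof. by rewrite /disc /= normcE -(ltcR (nc z) 1). Qed.

Section Limits.
Context {T : Type} {F : set_system T} {FF : Filter F}.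
Implicit Types f g : T -> C.

Lemma cvgC_nc f z : f @ F --> z <-> (fun t => nc (f t - z)) @ F --> (0 : R).
Proof.
split => h.
  apply/cvgrPdist_le => /= e e0.
  have e0' : 0 < e%:C by rewrite (ltcR 0 e).
  move: (h) => /cvgrPdist_le/(_ _ e0').
  apply: (@filterS _ F FF) => t; rewrite normcE lecR => /=.
  by rewrite sub0r normrN ger0_norm ?nc_ge0// ncC.
apply/cvgrPdist_le => /= e; rewrite ltcE /= => /andP[/eqP e2 e1].
have -> : e = (Re e)%:C by apply: complex_eq.
move: (h) => /cvgrPdist_le/(_ _ e1).
apply: (@filterS _ F FF) => t /=; rewrite sub0r normrN ger0_norm ?nc_ge0// ncC => hh.
by rewrite normcE lecR.
Qed.

Lemma cvgC_Re f z : f @ F --> z -> (fun t => Re (f t)) @ F --> Re z.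
Proof.
move=> /cvgC_nc h; apply/cvgrPdist_le => /= e e0.
move: (h) => /cvgrPdist_le/(_ _ e0).
apply: (@filterS _ F FF) => t /=; rewrite sub0r normrN ger0_norm ?nc_ge0//; apply: le_trans.
by rewrite ncC -ReB Re_le_nc.
Qed.

Lemma cvgC_Im f z : f @ F --> z -> (fun t => Im (f t)) @ F --> Im z.
Proof.
move=> /cvgC_nc h; apply/cvgrPdist_le => /= e e0.
move: (h) => /cvgrPdist_le/(_ _ e0).
apply: (@filterS _ F FF) => t /=; rewrite sub0r normrN ger0_norm ?nc_ge0//; apply: le_trans.
by rewrite ncC -ImB Im_le_nc.
Qed.

Lemma cvgC_ReIm f z : (fun t => Re (f t)) @ F --> Re z ->
  (fun t => Im (f t)) @ F --> Im z -> f @ F --> z.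
Proof.
move=> h1 h2; apply/cvgC_nc/cvgrPdist_le => /= e e0.
have e2 : 0 < e / 2 by rewrite divr_gt0.
move: h1 h2 => /cvgrPdist_le/(_ _ e2) + /cvgrPdist_le/(_ _ e2).
apply: (@filterS2 _ F FF) => t /= a b; rewrite sub0r normrN ger0_norm ?nc_ge0//.
by rewrite (le_trans (nc_le _))// ReB ImB [X in X + _]distrC [X in _ + X]distrC (splitr e) lerD.
Qed.

Lemma cvg_nc f z : f @ F --> z -> (fun t => nc (f t)) @ F --> nc z.
Proof.
move=> /cvgC_nc h; apply/cvgrPdist_le => /= e e0.
move: (h) => /cvgrPdist_le/(_ _ e0).
apply: (@filterS _ F FF) => t /=; rewrite sub0r normrN ger0_norm ?nc_ge0//; apply: le_trans.
by rewrite distrC nc_dist.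
Qed.

End Limits.
End ComplexFacts.

(** * Measurability and means of complex-valued functions *)

Section ComplexMean.
Variable R : realType.
Local Notation C := R[i].
Local Notation D := (@angles R).
Local Hint Resolve measurable_angles : core.
Implicit Types (f g : R -> R) (p q : R -> C).

Definition cmeas p : Prop := meas (fun t => Re (p t)) /\ meas (fun t => Im (p t)).
Definition CL1 p : Prop := L1 (fun t => Re (p t)) /\ L1 (fun t => Im (p t)).
Definition cmean p : C := Complex (mean (fun t => Re (p t))) (mean (fun t => Im (p t))).

Lemma cmeas_eq p q : (forall t, D t -> p t = q t) -> cmeas p -> cmeas q.
Proof. by move=> pq [m1 m2]; split; [apply: meas_eq m1|apply: meas_eq m2] => t /pq ->. Qed.

Lemma cmeas_cst (c : C) : cmeas (fun=> c).
Proof. by split; exact: meas_cst. Qed.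

Lemma cmeasD p q : cmeas p -> cmeas q -> cmeas (fun t => p t + q t).
Proof.
move=> [m1 m2] [m3 m4]; split; [move: (measD m1 m3)|move: (measD m2 m4)];
by apply: meas_eq => t _; rewrite ?ReD ?ImD.
Qed.

Lemma cmeasN p : cmeas p -> cmeas (fun t => - p t).
Proof.
move=> [m1 m2]; split; [move: (measN m1)|move: (measN m2)];
by apply: meas_eq => t _; rewrite ?ReN ?ImN.
Qed.

Lemma cmeasB p q : cmeas p -> cmeas q -> cmeas (fun t => p t - q t).
Proof. by move=> mp /cmeasN; exact: cmeasD. Qed.

Lemma cmeasM p q : cmeas p -> cmeas q -> cmeas (fun t => p t * q t).
Proof.
move=> [m1 m2] [m3 m4]; split.
  by move: (measB (measM m1 m3) (measM m2 m4)); apply: meas_eq => t _; rewrite ReM.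
by move: (measD (measM m1 m4) (measM m2 m3)); apply: meas_eq => t _; rewrite ImM.
Qed.

Lemma cmeasJ p : cmeas p -> cmeas (fun t => conjc (p t)).
Proof.
move=> [m1 m2]; split; first by apply: meas_eq m1 => t _; rewrite ReJ.
by move: (measN m2); apply: meas_eq => t _; rewrite ImJ.
Qed.

Lemma cmeas_real f : meas f -> cmeas (fun t => (f t)%:C).
Proof. by move=> mf; split => //; exact: meas_cst. Qed.

Lemma cmeasX p n : cmeas p -> cmeas (fun t => p t ^+ n).
Proof.
move=> mp; elim: n => [|n ih]; first exact: cmeas_cst.
by apply: cmeas_eq (cmeasM mp ih) => t _; rewrite exprS.
Qed.

Lemma cmeas_sum (I : Type) (r : seq I) (F : I -> R -> C) :
  (forall i, cmeas (F i)) -> cmeas (fun t => \sum_(i <- r) F i t).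
Proof.
move=> mF; elim: r => [|i r ih].
  by apply: cmeas_eq (cmeas_cst 0) => t _; rewrite big_nil.
by apply: cmeas_eq (cmeasD (mF i) ih) => t _; rewrite big_cons.
Qed.

Lemma cmeas_eit : cmeas (@eit R).
Proof. by split; apply: meas_continuous => x; [exact: continuous_cos|exact: continuous_sin]. Qed.

Lemma meas_sq f : meas f -> meas (fun t => f t ^+ 2).
Proof. by move=> mf; apply: meas_eq (measM mf mf) => t _; rewrite expr2. Qed.

Lemma meas_nc_sq p : cmeas p -> meas (fun t => nc (p t) ^+ 2).
Proof.
move=> [m1 m2]; apply: meas_eq (measD (meas_sq m1) (meas_sq m2)) => t _.
by rewrite nc_sq.
Qed.

Lemma meas_nc p : cmeas p -> meas (fun t => nc (p t)).
Proof.
move=> /meas_nc_sq mp; apply: meas_eq (meas_comp (h := @Num.sqrt R) _ mp) => [t _|].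
  by rewrite sqrtr_sqr ger0_norm ?nc_ge0.
by apply: continuous_measurable_fun => x; exact: sqrt_continuous.
Qed.

                                                      
(** Inversion is not continuous at 0, but it is the pointwise limit of the continuous functions x /
    (x^2 + 1/(n+1)), at 0 as well, where the inverse is 0 by convention. *)
Lemma meas_inv f : meas f -> meas (fun t => (f t)^-1).
Proof.
move=> mf; apply: (meas_cvg (f_ := fun n t => f t * (f t ^+ 2 + n.+1%:R^-1)^-1)) => [n|t _].
  apply: (@meas_comp _ (fun x => x * (x ^+ 2 + n.+1%:R^-1)^-1)) => //.
  apply: continuous_measurable_fun => x; apply: cvgM; first exact: cvg_id.
  apply: cvgV; first by rewrite gt_eqF// ltr_wpDl ?sqr_ge0// invr_gt0.
  apply: cvgD; last exact: cvg_cst.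
  exact: exprn_continuous.
have [->|f0] := eqVneq (f t) 0.
  by rewrite invr0; under eq_fun do rewrite mul0r; exact: cvg_cst.
have -> : (f t)^-1 = f t * (f t ^+ 2 + 0)^-1 by rewrite addr0; field.
apply: cvgMr; apply: cvgV; first by rewrite addr0 expf_eq0.
by apply: cvgD; [exact: cvg_cst|exact: cvg_harmonic].
Qed.

Lemma cmeasV p : cmeas p -> cmeas (fun t => (p t)^-1).
Proof.
move=> mp; apply: cmeas_eq (cmeasM (cmeasJ mp) (cmeas_real (meas_inv (meas_nc_sq mp)))) => t _.
have [->|p0] := eqVneq (p t) 0; first by rewrite conjc0 mul0r invr0.
apply: (mulfI p0); rewrite mulrA mulcJ mulfV// -rmorphM mulfV ?rmorph1//.
by rewrite expf_eq0/= nc_eq0.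
Qed.

Lemma cmeas_cvg (p_ : nat -> R -> C) p : (forall n, cmeas (p_ n)) ->
  (forall t, D t -> p_ ^~ t @ \oo --> p t) -> cmeas p.
Proof.
move=> mp cv; split.
  by apply: (meas_cvg (f_ := fun n t => Re (p_ n t))) => [n|t Dt]; [exact: (mp n).1|exact: cvgC_Re (cv t Dt)].
by apply: (meas_cvg (f_ := fun n t => Im (p_ n t))) => [n|t Dt]; [exact: (mp n).2|exact: cvgC_Im (cv t Dt)].
Qed.

Lemma CL1_meas p : CL1 p -> cmeas p.
Proof. by move=> [/L1_meas ? /L1_meas]. Qed.

Lemma CL1_le p g : cmeas p -> (forall t, D t -> nc (p t) <= g t) -> L1 g -> CL1 p.
Proof.
move=> [m1 m2] pg lg; split; apply: L1_le lg => // t Dt; apply: le_trans (pg t Dt).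
  exact: Re_le_nc.
exact: Im_le_nc.
Qed.

Lemma CL1_bounded p M : cmeas p -> (forall t, D t -> nc (p t) <= M) -> CL1 p.
Proof. by move=> mp pM; apply: CL1_le mp pM (L1_cst M). Qed.

Lemma L1_nc p : CL1 p -> L1 (fun t => nc (p t)).
Proof.
move=> lp; have [l1 l2] := lp; apply: L1_le (L1D (L1_norm l1) (L1_norm l2)).
  by apply: meas_nc; exact: CL1_meas.
by move=> t _; rewrite ger0_norm ?nc_ge0 ?nc_le.
Qed.

Lemma CL1_eq p q : (forall t, D t -> p t = q t) -> CL1 p -> CL1 q.
Proof. by move=> pq [m1 m2]; split; [apply: L1_eq m1|apply: L1_eq m2] => t /pq ->. Qed.

Lemma CL1_cst (c : C) : CL1 (fun=> c).
Proof. by split; exact: L1_cst. Qed.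

Lemma CL1D p q : CL1 p -> CL1 q -> CL1 (fun t => p t + q t).
Proof.
move=> [m1 m2] [m3 m4]; split; [move: (L1D m1 m3)|move: (L1D m2 m4)];
by apply: L1_eq => t _; rewrite ?ReD ?ImD.
Qed.

Lemma CL1M (M : R) p q : cmeas q -> (forall t, D t -> nc (q t) <= M) -> CL1 p ->
  CL1 (fun t => q t * p t).
Proof.
move=> mq qM lp; apply: CL1_le (L1Z M (L1_nc lp)); first by apply: cmeasM => //; exact: CL1_meas.
by move=> t Dt; rewrite ncM ler_wpM2r ?nc_ge0 ?qM.
Qed.

Lemma CL1Z (c : C) p : CL1 p -> CL1 (fun t => c * p t).
Proof. by apply: (@CL1M (nc c)) => //; exact: cmeas_cst. Qed.

Lemma CL1N p : CL1 p -> CL1 (fun t => - p t).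
Proof. by move=> /(CL1Z (-1)); apply: CL1_eq => t _; rewrite mulN1r. Qed.

Lemma CL1J p : CL1 p -> CL1 (fun t => conjc (p t)).
Proof.
move=> lp; apply: CL1_le (L1_nc lp); first by apply: cmeasJ; exact: CL1_meas.
by move=> t _; rewrite nc_conj.
Qed.

Lemma CL1_real f : L1 f -> CL1 (fun t => (f t)%:C).
Proof. by move=> mf; split => //; exact: L1_cst. Qed.

Lemma CL1_sum (I : Type) (r : seq I) (F : I -> R -> C) :
  (forall i, CL1 (F i)) -> CL1 (fun t => \sum_(i <- r) F i t).
Proof.
move=> mF; elim: r => [|i r ih].
  by apply: CL1_eq (CL1_cst 0) => t _; rewrite big_nil.
by apply: CL1_eq (CL1D (mF i) ih) => t _; rewrite big_cons.
Qed.

Lemma eq_cmean p q : (forall t, D t -> p t = q t) -> cmean p = cmean q.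
Proof. by move=> pq; congr Complex; apply: eq_mean => t /pq ->. Qed.

Lemma cmeanD p q : CL1 p -> CL1 q -> cmean (fun t => p t + q t) = cmean p + cmean q.
Proof.
move=> [m1 m2] [m3 m4]; apply: complex_eq; rewrite ?ReD ?ImD /= -meanD//;
by apply: eq_mean => t _; rewrite ?ReD ?ImD.
Qed.

Lemma cmeanZ (c : C) p : CL1 p -> cmean (fun t => c * p t) = c * cmean p.
Proof.
move=> [m1 m2]; apply: complex_eq.
  rewrite ReM /= -!meanZ// -meanB; [|exact: L1Z..].
  by apply: eq_mean => t _; rewrite ReM.
rewrite ImM /= -!meanZ// -meanD; [|exact: L1Z..].
by apply: eq_mean => t _; rewrite ImM.
Qed.

Lemma cmeanN p : CL1 p -> cmean (fun t => - p t) = - cmean p.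
Proof.
by move=> lp; rewrite -mulN1r -cmeanZ//; apply: eq_cmean => t _; rewrite mulN1r.
Qed.

Lemma cmeanB p q : CL1 p -> CL1 q -> cmean (fun t => p t - q t) = cmean p - cmean q.
Proof. by move=> lp lq; rewrite cmeanD ?cmeanN//; exact: CL1N. Qed.

Lemma cmean_cst (c : C) : cmean (fun=> c) = c.
Proof. by apply: complex_eq => /=; rewrite mean_cst. Qed.

Lemma cmean_real f : cmean (fun t => (f t)%:C) = (mean f)%:C.
Proof. by apply: complex_eq => //=; rewrite mean_cst. Qed.

Lemma cmeanJ p : CL1 p -> cmean (fun t => conjc (p t)) = conjc (cmean p).
Proof.
move=> [m1 m2]; apply: complex_eq; rewrite ?ReJ ?ImJ /=.
  by apply: eq_mean => t _; rewrite ReJ.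
by rewrite -meanN//; apply: eq_mean => t _; rewrite ImJ.
Qed.

Lemma cmean_sum (I : Type) (r : seq I) (F : I -> R -> C) :
  (forall i, CL1 (F i)) -> cmean (fun t => \sum_(i <- r) F i t) = \sum_(i <- r) cmean (F i).
Proof.
move=> mF; elim: r => [|i r ih].
  by rewrite big_nil (@eq_cmean _ (fun=> 0)) ?cmean_cst// => t _; rewrite big_nil.
rewrite big_cons -ih -cmeanD//; last exact: CL1_sum.
by apply: eq_cmean => t _; rewrite big_cons.
Qed.

Lemma nc_cmean p : CL1 p -> nc (cmean p) <= mean (fun t => nc (p t)).
Proof.
move=> lp; set z := cmean p.
have [->|z0] := eqVneq z 0; first by rewrite nc0; apply: mean_ge0 => t _; exact: nc_ge0.
(* The unimodular factor that turns [z] into its modulus, so that only a real part has to be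
   estimated. *)
pose c := conjc z * ((nc z)^-1)%:C.
have nz0 : nc z != 0 by rewrite nc_eq0.
have c1 : nc c = 1.
  by rewrite ncM nc_conj nc_real normfV ger0_norm ?nc_ge0// mulfV.
have zc : c * z = (nc z)%:C.
  rewrite /c mulrAC [conjc z * z]mulrC mulcJ -rmorphM; congr (_%:C).
  by rewrite expr2 mulfK.
have -> : nc z = Re (c * z) by rewrite zc.
rewrite -cmeanZ// /=; apply: le_mean; [exact: (CL1Z c lp).1|exact: L1_nc|].
move=> t _; rewrite (le_trans (ler_norm _))// (le_trans (Re_le_nc _))//.
by rewrite ncM c1 mul1r.
Qed.

Lemma cmean_ae p q : aeD (fun t => p t = q t) -> cmean p = cmean q.
Proof. by move=> pq; congr Complex; apply: mean_ae; apply: aeDS pq => t _ ->. Qed.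

Lemma cmean_dct (p_ : nat -> R -> C) p g :
  (forall n, cmeas (p_ n)) -> cmeas p ->
  aeD (fun t => p_ ^~ t @ \oo --> p t) -> L1 g ->
  aeD (fun t => forall n, nc (p_ n t) <= g t) ->
  CL1 p /\ (fun n => cmean (p_ n)) @ \oo --> cmean p.
Proof.
move=> mp_ mp pp lg pg.
have [l1 c1] : L1 (fun t => Re (p t)) /\ (fun n => mean (fun t => Re (p_ n t))) @ \oo --> mean (fun t => Re (p t)).
  apply: (mean_dct (g := g)) => //; [by move=> n; exact: (mp_ n).1|exact: mp.1| |].
    by apply: aeDS pp => t _ /cvgC_Re.
  by apply: aeDS pg => t _ h n; rewrite (le_trans (Re_le_nc _)).
have [l2 c2] : L1 (fun t => Im (p t)) /\ (fun n => mean (fun t => Im (p_ n t))) @ \oo --> mean (fun t => Im (p t)).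
  apply: (mean_dct (g := g)) => //; [by move=> n; exact: (mp_ n).2|exact: mp.2| |].
    by apply: aeDS pp => t _ /cvgC_Im.
  by apply: aeDS pg => t _ h n; rewrite (le_trans (Im_le_nc _)).
by split; [split|exact: cvgC_ReIm].
Qed.

End ComplexMean.

Lemma eitE (R : realType) (t : R) : eit t = Complex (cos t) (sin t).
Proof. by []. Qed.

Opaque eit.

                                                             

(** * Fourier coefficients, Cauchy-Schwarz and Bessel *)

Section Fourier.
Variable R : realType.
Local Notation C := R[i].
Local Notation mu := (@lebesgue_measure R).
Local Notation D := (@angles R).
Local Hint Resolve measurable_angles : core.
Implicit Types (f g : R -> R) (p q : R -> C).

Lemma eit_2pi : eit (2 * pi : R) = 1.
Proof.
have -> : 2 * pi = pi + pi :> R by ring.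
by rewrite eitD eitE cospi sinpi; apply: complex_eq => /=; ring.
Qed.

Lemma mean_derivative (F f : R -> R) : continuous f ->
  (forall x : R, is_derive x 1 F (f x)) -> F 0 = F (2 * pi) -> mean f = 0.
Proof.
move=> cf dF F0; rewrite /mean /Rintegral.
rewrite (_ : (\int[mu]_(x in D) (f x)%:E)%E = 0%E) ?mulr0//.
rewrite /angles (@continuous_FTC2 _ f F) ?F0 ?subee ?twopi_gt0//.
- exact: continuous_subspaceT.
- have cF : continuous F.
    by move=> x; apply: differentiable_continuous; apply/derivable1_diffP; case: (dF x).
  split.
  + by move=> x _; case: (dF x).
  + by apply: cvg_at_right_filter; exact: cF.
  + by apply: cvg_at_left_filter; exact: cF.
- by move=> x _; rewrite derive1E; apply: derive_val.
Qed.

Lemma cmean_eitX n : cmean (fun t => eit t ^+ n.+1) = 0 :> C.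
Proof.
have n0 : n.+1%:R != 0 :> R by rewrite pnatr_eq0.
have cl : continuous (fun t : R => n.+1%:R * t).
  by move=> x; apply: cvgM; [exact: cvg_cst|exact: cvg_id].
have e2 : eit (n.+1%:R * (2 * pi)) = 1 :> C by rewrite -eitX eit_2pi expr1n.
have [c2 s2] : cos (n.+1%:R * (2 * pi)) = 1 :> R /\ sin (n.+1%:R * (2 * pi)) = 0 :> R.
  by move: e2; rewrite eitE => -[].
have dl (t : R) : is_derive t 1 (fun t : R => n.+1%:R * t) (n.+1%:R).
  by apply: is_derive_eq; rewrite /GRing.scale/= mulr1 ?mulr0 ?addr0 ?add0r.
have L1c : L1 (fun t : R => cos (n.+1%:R * t)).
  apply: (@L1_bounded _ _ 1); last by move=> t _; rewrite ler_norml cos_geN1 cos_le1.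
  by apply: meas_continuous => x; apply: continuous_comp; [exact: cl|exact: continuous_cos].
have L1s : L1 (fun t : R => sin (n.+1%:R * t)).
  apply: (@L1_bounded _ _ 1); last by move=> t _; rewrite ler_norml sin_geN1 sin_le1.
  by apply: meas_continuous => x; apply: continuous_comp; [exact: cl|exact: continuous_sin].
apply: complex_eq => /=.
  apply: (mulfI n0); rewrite mulr0 -meanZ; last by apply: L1_eq L1c => t _; rewrite eitX eitE.
  rewrite (@eq_mean _ _ (fun t => n.+1%:R * cos (n.+1%:R * t))); last by move=> t _; rewrite eitX eitE.
  apply: (@mean_derivative (fun t => sin (n.+1%:R * t))).
  - by move=> x; apply: cvgM; [exact: cvg_cst|apply: continuous_comp; [exact: cl|exact: continuous_cos]].
  - move=> x; rewrite mulrC; exact: (is_derive1_comp (is_derive_sin _) (dl x)).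
  - by rewrite mulr0 sin0 s2.
apply: (mulfI n0); rewrite mulr0 -meanZ; last by apply: L1_eq L1s => t _; rewrite eitX eitE.
rewrite (@eq_mean _ _ (fun t => - (- sin (n.+1%:R * t) * n.+1%:R))); last by move=> t _; rewrite eitX eitE /=; ring.
rewrite meanN; last by apply: L1_eq (L1Z (- n.+1%:R) L1s) => t _; ring.
rewrite (@mean_derivative (fun t => cos (n.+1%:R * t))) ?oppr0//.
- move=> x; apply: cvgM; last exact: cvg_cst.
  by apply: cvgN; apply: continuous_comp; [exact: cl|exact: continuous_sin].
- by rewrite mulr0 cos0 c2.
Qed.

Lemma eitXJ (t : R) m n : eit t ^+ (m + n) * conjc (eit t) ^+ n = eit t ^+ m.
Proof. by rewrite exprD -mulrA -exprMn eitJ expr1n mulr1. Qed.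

Lemma cmeas_eitX n : cmeas (fun t : R => eit t ^+ n).
Proof. by apply: cmeasX; exact: cmeas_eit. Qed.

Lemma cmeas_eitJX n : cmeas (fun t : R => conjc (eit t) ^+ n).
Proof. by apply: cmeasX; apply: cmeasJ; exact: cmeas_eit. Qed.

Lemma nc_eitX n (t : R) : nc (eit t ^+ n) = 1.
Proof. by rewrite ncX nc_eit expr1n. Qed.

Lemma nc_eitJX n (t : R) : nc (conjc (eit t) ^+ n) = 1.
Proof. by rewrite ncX nc_conj nc_eit expr1n. Qed.

Lemma CL1_eitX n : CL1 (fun t : R => eit t ^+ n).
Proof. by apply: (@CL1_bounded _ _ 1) => [|t _]; rewrite ?nc_eitX//; exact: cmeas_eitX. Qed.

Lemma cmean_eitXJ m n :
  cmean (fun t => eit t ^+ m * conjc (eit t) ^+ n) = (m == n)%:R :> C.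
Proof.
have [->|mn] := eqVneq m n.
  rewrite (@eq_cmean _ _ (fun=> 1)) ?cmean_cst// => t _.
  by rewrite -(add0n n) eitXJ.
have [lt|] := ltnP n m.
  rewrite (@eq_cmean _ _ (fun t => eit t ^+ (m - n).-1.+1)) ?cmean_eitX// => t _.
  by rewrite prednK ?subn_gt0// -{1}(subnK (ltnW lt)) eitXJ.
rewrite leq_eqVlt (negbTE mn)/= => lt.
rewrite (@eq_cmean _ _ (fun t => conjc (eit t ^+ (n - m).-1.+1))) => [|t _].
  by rewrite cmeanJ ?cmean_eitX ?conjc0//; exact: CL1_eitX.
rewrite prednK ?subn_gt0//; apply: (can_inj (@conjcK R)).
by rewrite conjcK conjcM !conjcX conjcK mulrC -{1}(subnK (ltnW lt)) eitXJ.
Qed.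

Definition L2 p := cmeas p /\ L1 (fun t => nc (p t) ^+ 2).
Definition n2 p : R := mean (fun t => nc (p t) ^+ 2).

Lemma n2_ge0 p : 0 <= n2 p.
Proof. by apply: mean_ge0 => t _; exact: sqr_ge0. Qed.

Lemma L2_le p g : cmeas p -> (forall t, D t -> nc (p t) ^+ 2 <= g t) -> L1 g -> L2 p.
Proof.
move=> mp pg lg; split=> //; apply: L1_le lg; first exact: meas_nc_sq.
by move=> t Dt; rewrite ger0_norm ?sqr_ge0 ?pg.
Qed.

Lemma L2_bounded p M : cmeas p -> (forall t, D t -> nc (p t) <= M) -> L2 p.
Proof.
move=> mp pM; apply: L2_le mp _ (L1_cst (M ^+ 2)) => t Dt.
have h := pM t Dt; rewrite ler_pXn2r ?nnegrE ?nc_ge0//.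
exact: le_trans (nc_ge0 _) h.
Qed.

Lemma nc_sqD z w : nc (z + w : C) ^+ 2 <= 2 * nc z ^+ 2 + 2 * nc w ^+ 2.
Proof.
apply: (@le_trans _ _ ((nc z + nc w) ^+ 2)).
  by rewrite ler_pXn2r ?nnegrE ?addr_ge0 ?nc_ge0 ?ncD.
have := sqr_ge0 (nc z - nc w); rewrite sqrrB sqrrD; lra.
Qed.

Lemma L2D p q : L2 p -> L2 q -> L2 (fun t => p t + q t).
Proof.
move=> [mp lp] [mq lq]; apply: L2_le (L1D (L1Z 2 lp) (L1Z 2 lq)); first exact: cmeasD.
by move=> t _; exact: nc_sqD.
Qed.

Lemma L2M M p q : cmeas q -> (forall t, D t -> nc (q t) <= M) -> L2 p -> L2 (fun t => q t * p t).
Proof.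
move=> mq qM [mp lp]; apply: L2_le (L1Z (M ^+ 2) lp); first exact: cmeasM.
move=> t Dt; rewrite ncM exprMn ler_wpM2r ?sqr_ge0//.
have h := qM t Dt; rewrite ler_pXn2r ?nnegrE ?nc_ge0//.
exact: le_trans (nc_ge0 _) h.
Qed.

Lemma L2Z c p : L2 p -> L2 (fun t => c * p t).
Proof. by apply: (@L2M (nc c)) => //; exact: cmeas_cst. Qed.

Lemma L2_eq p q : (forall t, D t -> p t = q t) -> L2 p -> L2 q.
Proof.
move=> pq [mp lp]; split; first exact: cmeas_eq mp.
by apply: L1_eq lp => t /pq ->.
Qed.

Lemma L2B p q : L2 p -> L2 q -> L2 (fun t => p t - q t).
Proof. by move=> lp /(L2Z (-1)) /(L2D lp); apply: L2_eq => t _; rewrite mulN1r. Qed.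

Lemma L2J p : L2 p -> L2 (fun t => conjc (p t)).
Proof.
move=> [mp lp]; split; first exact: cmeasJ.
by apply: L1_eq lp => t _; rewrite nc_conj.
Qed.

Lemma L2_cst c : L2 (fun=> c).
Proof. by apply: (@L2_bounded _ (nc c)) => //; exact: cmeas_cst. Qed.

Lemma L2_sum (I : Type) (r : seq I) (F : I -> R -> C) :
  (forall i, L2 (F i)) -> L2 (fun t => \sum_(i <- r) F i t).
Proof.
move=> mF; elim: r => [|i r ih].
  by apply: L2_eq (L2_cst 0) => t _; rewrite big_nil.
by apply: L2_eq (L2D (mF i) ih) => t _; rewrite big_cons.
Qed.

Lemma L2_eitX n : L2 (fun t => eit t ^+ n).
Proof. by apply: (@L2_bounded _ 1) => [|t _]; rewrite ?nc_eitX//; exact: cmeas_eitX. Qed.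

Lemma L2_eitJX n : L2 (fun t => conjc (eit t) ^+ n).
Proof. by apply: (@L2_bounded _ 1) => [|t _]; rewrite ?nc_eitJX//; exact: cmeas_eitJX. Qed.

Lemma L1_ncM p q : L2 p -> L2 q -> L1 (fun t => nc (p t) * nc (q t)).
Proof.
move=> [mp lp] [mq lq]; apply: L1_le (L1D lp lq).
  by apply: measM; exact: meas_nc.
move=> t _; rewrite ger0_norm ?mulr_ge0 ?nc_ge0//.
have := sqr_ge0 (nc (p t) - nc (q t)); rewrite sqrrB.
have := sqr_ge0 (nc (p t) + nc (q t)); rewrite sqrrD; lra.
Qed.

Lemma CL1_mul p q : L2 p -> L2 q -> CL1 (fun t => p t * q t).
Proof.
move=> lp lq; apply: CL1_le (L1_ncM lp lq); first by apply: cmeasM; [exact: lp.1|exact: lq.1].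
by move=> t _; rewrite ncM.
Qed.

Lemma L2_CL1 p : L2 p -> CL1 p.
Proof. by move=> lp; apply: CL1_eq (CL1_mul (L2_cst 1) lp) => t _; rewrite mul1r. Qed.

(** The mean of (s|p| + |q|)^2 is a nonnegative quadratic polynomial in [s], so its discriminant is
    not positive. *)
Lemma mean_cauchy_schwarz p q : L2 p -> L2 q ->
  mean (fun t => nc (p t) * nc (q t)) ^+ 2 <= n2 p * n2 q.
Proof.
move=> lp lq; set A := mean _; set a := n2 p; set b := n2 q.
have h s : 0 <= s ^+ 2 * a + 2 * s * A + b.
  rewrite -!meanZ; [|exact: L1_ncM|exact: lp.2].
  have l1 := L1Z (s ^+ 2) lp.2; have l2 := L1Z (2 * s) (L1_ncM lp lq).
  rewrite -!meanD//; [|exact: L1D|exact: lq.2].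
  apply: mean_ge0 => t _.
  by rewrite (_ : _ + _ = (s * nc (p t) + nc (q t)) ^+ 2) ?sqr_ge0//; ring.
have [a0|a0] := eqVneq a 0.
  rewrite a0 mul0r; have [->|A0] := eqVneq A 0; first by rewrite expr0n.
  (* When [a = 0] the polynomial is affine in [s], and this [s] would give it the value -1. *)
  have := h (- (b + 1) / (2 * A)); rewrite a0 mulr0 add0r.
  have -> : 2 * (- (b + 1) / (2 * A)) * A = - (b + 1) by field.
  lra.
have ap : 0 < a by rewrite lt_def a0 n2_ge0.
have := h (- A / a).
have -> : (- A / a) ^+ 2 * a + 2 * (- A / a) * A + b = (a * b - A ^+ 2) / a by field.
by rewrite pmulr_lge0 ?invr_gt0// subr_ge0.
Qed.

Lemma cauchy_schwarz p q : L2 p -> L2 q ->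
  nc (cmean (fun t => p t * q t)) ^+ 2 <= n2 p * n2 q.
Proof.
move=> lp lq; apply: le_trans (mean_cauchy_schwarz lp lq).
rewrite ler_pXn2r ?nnegrE ?nc_ge0//; last first.
  by apply: mean_ge0 => t _; rewrite mulr_ge0 ?nc_ge0.
apply: le_trans (nc_cmean (CL1_mul lp lq)) _.
by apply: le_mean; [exact/L1_nc/CL1_mul|exact: L1_ncM|move=> t _; rewrite ncM].
Qed.

Lemma mean_eq0_ae f : L1 f -> (forall t, D t -> 0 <= f t) -> mean f = 0 -> aeD (fun t => f t = 0).
Proof.
move=> lf f0 /eqP; rewrite mulf_eq0 invr_eq0 (gt_eqF (@twopi_gt0 R))/= => /eqP m0.
have mf : measurable_fun D (EFin \o f) by apply/measurable_EFinP; exact: L1_meas.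
have := (@ae_eq_integral_abs _ _ _ mu D (@measurable_angles R) (EFin \o f) mf).1.
move=> H; have : ae_eq mu D (EFin \o f) (cst 0%E).
  apply: H; rewrite (_ : 0%E = (\int[mu]_(t in D) f t)%:E); last by rewrite m0.
  rewrite /Rintegral fineK; last exact: (@integrable_fin_num _ _ _ mu D (@measurable_angles R) _ lf).
  by apply: eq_integral => t; rewrite inE => Dt /=; rewrite ger0_norm ?f0.
by apply: aeDS => t _ [].
Qed.

Lemma n2_ae p q : aeD (fun t => p t = q t) -> n2 p = n2 q.
Proof. by move=> pq; apply: mean_ae; apply: aeDS pq => t _ ->. Qed.

Lemma eq_n2 p q : (forall t, D t -> p t = q t) -> n2 p = n2 q.
Proof. by move=> pq; apply: eq_mean => t /pq ->. Qed.

Definition coef p n : C := cmean (fun t => p t * conjc (eit t) ^+ n).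

Definition tpoly (a : nat -> C) (N : nat) (t : R) : C := \sum_(n < N) a n * eit t ^+ n.

Lemma L2_tpoly a N : L2 (tpoly a N).
Proof. by apply: L2_sum => i; apply: L2Z; exact: L2_eitX. Qed.

(** Pythagoras: [a] is the coefficient of the orthogonal projection of [p] on [q], which has norm
    1. *)
Lemma n2B_unit p q (a : C) : L2 p -> L2 q -> (forall t, D t -> nc (q t) = 1) ->
  a = cmean (fun t => p t * conjc (q t)) ->
  n2 (fun t => p t - a * q t) = n2 p - nc a ^+ 2.
Proof.
move=> lp lq q1 aE.
have lpq : CL1 (fun t => p t * conjc (q t)) by apply: CL1_mul => //; exact: L2J.
have -> : n2 (fun t => p t - a * q t) =
    mean (fun t => nc (p t) ^+ 2 + (- 2 * Re (conjc a * (p t * conjc (q t))) + nc a ^+ 2)).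
  apply: eq_mean => t Dt; rewrite !nc_sq -[X in _ + (_ + X)](mulr1).
  have := nc_sq (q t); rewrite q1// expr1n => {2}->.
  by case: (p t) => ? ?; case: (q t) => ? ?; case: (a) => ? ? /=; ring.
have l1 : L1 (fun t => Re (conjc a * (p t * conjc (q t)))) by exact: (CL1Z _ lpq).1.
rewrite meanD; [|exact: lp.2|by apply: L1D; [exact: L1Z|exact: L1_cst]].
rewrite meanD ?mean_cst; [|exact: L1Z|exact: L1_cst].
rewrite meanZ//.
have -> : mean (fun t => Re (conjc a * (p t * conjc (q t)))) = nc a ^+ 2.
  have := cmeanZ (conjc a) lpq; rewrite -aE mulrC mulcJ.
  by move=> /(congr1 (@complex.Re R)).
rewrite /n2; ring.
Qed.

Lemma tpolyS a N t : tpoly a N.+1 t = tpoly a N t + a N * eit t ^+ N.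
Proof. by rewrite /tpoly big_ord_recr. Qed.

Lemma CL1_mul_eitX p n : CL1 p -> CL1 (fun t => p t * eit t ^+ n).
Proof.
move=> lp; apply: CL1_eq (CL1M (M := 1) (cmeas_eitX n) _ lp) => t _; first by rewrite mulrC.
by rewrite nc_eitX.
Qed.

Lemma CL1_mul_eitJX p n : CL1 p -> CL1 (fun t => p t * conjc (eit t) ^+ n).
Proof.
move=> lp; apply: CL1_eq (CL1M (M := 1) (cmeas_eitJX n) _ lp) => t _; first by rewrite mulrC.
by rewrite nc_eitJX.
Qed.

Lemma coefD p q n : CL1 p -> CL1 q -> coef (fun t => p t + q t) n = coef p n + coef q n.
Proof.
move=> lp lq; rewrite /coef -cmeanD.
- by apply: eq_cmean => t _; rewrite mulrDl.
- exact: CL1_mul_eitJX.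
- exact: CL1_mul_eitJX.
Qed.

Lemma coefZ p c n : CL1 p -> coef (fun t => c * p t) n = c * coef p n.
Proof.
move=> lp; rewrite /coef -cmeanZ.
- by apply: eq_cmean => t _; rewrite mulrA.
- exact: CL1_mul_eitJX.
Qed.

Lemma coefB p q n : CL1 p -> CL1 q -> coef (fun t => p t - q t) n = coef p n - coef q n.
Proof.
move=> lp lq; rewrite coefD//; last exact: CL1N.
congr (_ + _); rewrite -mulN1r -coefZ//; apply: eq_cmean => t _.
by rewrite !mulNr mul1r.
Qed.

Lemma coef_eitX m n : coef (fun t => eit t ^+ m) n = (m == n)%:R.
Proof. exact: cmean_eitXJ. Qed.

Lemma coef_tpoly a N n : coef (tpoly a N) n = if (n < N)%N then a n else 0.
Proof.
elim: N => [|N ih].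
  rewrite ltn0 /coef (@eq_cmean _ _ (fun=> 0)) ?cmean_cst// => t _.
  by rewrite /tpoly big_ord0 mul0r.
have -> : coef (tpoly a N.+1) n = coef (fun t => tpoly a N t + a N * eit t ^+ N) n.
  by apply: eq_cmean => t _; rewrite tpolyS.
rewrite coefD; [|exact/L2_CL1/L2_tpoly|exact/CL1Z/CL1_eitX].
rewrite coefZ ?coef_eitX ?ih; last exact: CL1_eitX.
rewrite ltnS [in RHS]leq_eqVlt eq_sym; have [->|nN] := eqVneq n N.
  by rewrite ltnn add0r mulr1.
by rewrite /= mulr0 addr0.
Qed.

Lemma bessel_eq p N : L2 p ->
  n2 (fun t => p t - tpoly (coef p) N t) = n2 p - \sum_(n < N) nc (coef p n) ^+ 2.
Proof.
move=> lp; elim: N => [|N ih].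
  rewrite big_ord0 subr0; apply: eq_n2 => t _; by rewrite /tpoly big_ord0 subr0.
have -> : n2 (fun t => p t - tpoly (coef p) N.+1 t) =
    n2 (fun t => (p t - tpoly (coef p) N t) - coef p N * eit t ^+ N).
  by apply: eq_n2 => t _; rewrite tpolyS opprD addrA.
rewrite n2B_unit ?ih ?big_ord_recr/= ?opprD ?addrA//.
- by apply: L2B => //; exact: L2_tpoly.
- exact: L2_eitX.
- by move=> t _; exact: nc_eitX.
transitivity (coef (fun t => p t - tpoly (coef p) N t) N).
  by rewrite coefB ?coef_tpoly ?ltnn ?subr0//; [exact: L2_CL1|exact/L2_CL1/L2_tpoly].
by apply: eq_cmean => t _; rewrite conjcX.
Qed.

Lemma bessel p N : L2 p -> \sum_(n < N) nc (coef p n) ^+ 2 <= n2 p.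
Proof. by move=> lp; rewrite -subr_ge0 -bessel_eq// n2_ge0. Qed.

Lemma n2_tpoly a N : n2 (tpoly a N) = \sum_(n < N) nc (a n) ^+ 2.
Proof.
have := bessel_eq N (L2_tpoly a N).
rewrite (_ : n2 (fun t => _) = 0).
  move=> /eqP; rewrite eq_sym subr_eq0 => /eqP ->.
  by apply: eq_bigr => i _; rewrite coef_tpoly ltn_ord.
rewrite /n2 (@eq_mean _ _ (fun=> 0)) ?mean_cst// => t _.
rewrite (_ : tpoly (coef _) N t = tpoly a N t) ?subrr ?nc0 ?expr0n//.
by apply: eq_bigr => i _; rewrite coef_tpoly ltn_ord.
Qed.

End Fourier.

                                       

(** * Power series and Cauchy integrals *)

Section Analytic.
Variable R : realType.
Local Notation C := R[i].
Implicit Types (p q : R -> C) (a b : nat -> C) (f g : C -> C) (z w : C) (r : R).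

Lemma cvg_eq1 (T : Type) (U : nbhsType) (F : set_system T) (f g : T -> U) (x : U) :
  f =1 g -> g @ F --> x -> f @ F --> x.
Proof. by move=> /funext ->. Qed.

Lemma cvgC_uniq (T : Type) (F : set_system T) (FF : ProperFilter F) (f : T -> C) (x y : C) :
  f @ F --> x -> f @ F --> y -> x = y.
Proof.
move=> fx fy; apply: complex_eq.
  exact: (cvg_unique _ (cvgC_Re fx) (cvgC_Re fy)).
exact: (cvg_unique _ (cvgC_Im fx) (cvgC_Im fy)).
Qed.

Lemma nc_sqr_cvg0 (u : nat -> R) (x : C) : (forall n, nc x ^+ 2 <= u n) -> u @ \oo --> (0 : R) -> x = 0.
Proof.
move=> xu c; apply/eqP; rewrite -nc_eq0 -sqrf_eq0 eq_le sqr_ge0 andbT -(cvg_lim _ c)//.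
by apply: limr_ge; [apply/cvg_ex; eexists; exact: c|exact: nearW].
Qed.

Lemma nc_cvg_le (T : Type) (F : set_system T) (FF : ProperFilter F) (f : T -> C) x B :
  f @ F --> x -> (\forall t \near F, nc (f t) <= B) -> nc x <= B.
Proof.
move=> fx fB; have c : (fun t => nc (f t)) @ F --> nc x by exact: cvg_nc.
rewrite -(cvg_lim _ c)//; apply: limr_le => //.
by apply/cvg_ex; eexists; exact: c.
Qed.

Definition psum a N z : C := \sum_(n < N) a n * z ^+ n.

Definition pseries a f := forall z, disc z -> (fun N => psum a N z) @ \oo --> f z.

Lemma analyticP f : analytic_disc f <-> exists a, pseries a f.
Proof.
split=> -[a h]; exists a => z /h.
  by rewrite /series/=; under eq_fun do rewrite big_mkord.
by rewrite /series/=; under [in X in _ -> X]eq_fun do rewrite big_mkord.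
Qed.

Lemma nc_subC_ge z : 1 - nc z <= nc (1 - z).
Proof. by have := ncBD 1 z; rewrite nc1; lra. Qed.

Lemma geometric_sum z N : z != 1 -> \sum_(n < N) z ^+ n = (1 - z ^+ N) / (1 - z).
Proof.
move=> z1; have h : 1 - z != 0 by rewrite subr_eq0 eq_sym.
apply: (mulIf h); rewrite mulfVK//; set S := \sum_(_ < _) _.
have -> : S * (1 - z) = - ((z - 1) * S) by ring.
by rewrite -subrX1 opprB.
Qed.

Lemma geometric_le r N : 0 <= r < 1 -> \sum_(n < N) r ^+ n <= (1 - r)^-1.
Proof.
move=> /andP[r0 r1]; rewrite -(ler_pM2r (x := 1 - r)) ?subr_gt0// mulVf ?subr_eq0 1?eq_sym ?lt_eqF//.
elim: N => [|N _]; first by rewrite big_ord0 mul0r.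
set S := \sum_(_ < _) _; have -> : S * (1 - r) = - ((r - 1) * S) by ring.
by rewrite -subrX1 opprB lerBlDr lerDl exprn_ge0.
Qed.

Lemma cvg_exprC z : nc z < 1 -> (fun N => z ^+ N) @ \oo --> (0 : C).
Proof.
move=> z1; apply/cvgC_nc; under eq_fun do rewrite subr0 ncX.
by apply: cvg_expr; rewrite ger0_norm ?nc_ge0.
Qed.

Lemma geometric_cvg z : nc z < 1 -> (fun N => \sum_(n < N) z ^+ n) @ \oo --> (1 - z)^-1.
Proof.
move=> z1; have zn1 : z != 1 by apply: contraTneq z1 => ->; rewrite nc1 ltxx.
apply: cvg_eq1 (fun N => geometric_sum N zn1) _.
rewrite -[X in _ --> X]mul1r; apply: cvgMl.
by rewrite -[X in _ --> X]subr0; apply: cvgB; [exact: cvg_cst|exact: cvg_exprC].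
Qed.

(** On the circle 1 / (1 - z conj w) = w / (w - z), so this is the Cauchy integral written with
    respect to arc length. *)
Definition cauchy p z : C := cmean (fun t => p t / (1 - z * conjc (eit t))).

Lemma nc_mul_eitJ z (t : R) : nc (z * conjc (eit t)) = nc z.
Proof. by rewrite ncM nc_conj nc_eit mulr1. Qed.

Lemma nc_denom_ge z (t : R) : 1 - nc z <= nc (1 - z * conjc (eit t)).
Proof. by rewrite -(nc_mul_eitJ z t) nc_subC_ge. Qed.

Lemma nc_denomV_le z (t : R) : nc z < 1 -> nc (1 - z * conjc (eit t))^-1 <= (1 - nc z)^-1.
Proof.
move=> z1; rewrite ncV lef_pV2 ?posrE ?nc_denom_ge ?subr_gt0//.
by rewrite (lt_le_trans _ (nc_denom_ge z t))// subr_gt0.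
Qed.

Lemma cmeas_denomV z : cmeas (fun t => (1 - z * conjc (eit t))^-1).
Proof.
apply: cmeasV; apply: cmeasB; first exact: cmeas_cst.
by apply: cmeasM; [exact: cmeas_cst|apply: cmeasJ; exact: cmeas_eit].
Qed.

Lemma CL1_cauchy p z : CL1 p -> nc z < 1 -> CL1 (fun t => p t / (1 - z * conjc (eit t))).
Proof.
move=> lp z1; apply: CL1_eq (CL1M (M := (1 - nc z)^-1) (cmeas_denomV z) _ lp) => t _.
  by rewrite mulrC.
exact: nc_denomV_le.
Qed.

(** Expand the kernel in a geometric series and integrate under the sign by dominated convergence.
    The Cauchy integral of an integrable function is thus the power series of its Fourier
    coefficients of index at least 0. *)
Lemma cauchy_cvg p z : CL1 p -> nc z < 1 ->
  (fun N => psum (coef p) N z) @ \oo --> cauchy p z.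
Proof.
move=> lp z1.
have -> : (fun N => psum (coef p) N z) =
    (fun N => cmean (fun t => p t * \sum_(n < N) (z * conjc (eit t)) ^+ n)).
  apply/funext => N; rewrite /psum.
  transitivity (\sum_(n < N) cmean (fun t => z ^+ n * (p t * conjc (eit t) ^+ n))).
    apply: eq_bigr => n _; rewrite cmeanZ; last exact: CL1_mul_eitJX.
    by rewrite mulrC.
  rewrite -cmean_sum; last by move=> n; apply: CL1Z; exact: CL1_mul_eitJX.
  by apply: eq_cmean => t _; rewrite mulr_sumr; apply: eq_bigr => n _; rewrite exprMn mulrCA.
have mp := CL1_meas lp.
have [] // := cmean_dct (p_ := fun N t => p t * \sum_(n < N) (z * conjc (eit t)) ^+ n)
  (p := fun t => p t / (1 - z * conjc (eit t))) (g := fun t => (1 - nc z)^-1 * nc (p t)).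
- move=> N; apply: cmeasM => //; apply: cmeas_sum => n; apply: cmeasX.
  by apply: cmeasM; [exact: cmeas_cst|apply: cmeasJ; exact: cmeas_eit].
- by apply: cmeasM => //; exact: cmeas_denomV.
- by apply: aeDW => t _; apply: cvgMr; apply: geometric_cvg; rewrite nc_mul_eitJ.
- by apply: L1Z; exact: L1_nc.
- apply: aeDW => t _ N; rewrite ncM mulrC ler_wpM2r ?nc_ge0//.
  apply: le_trans (nc_sum _ _ _) _; under eq_bigr do rewrite ncX nc_mul_eitJ.
  by apply: geometric_le; rewrite nc_ge0.
Qed.

Lemma disc_radius z : nc z < 1 -> exists r, [/\ nc z < r, 0 < r & r < 1].
Proof.
move=> z1; exists ((nc z + 1) / 2); have := nc_ge0 z; split; lra.
Qed.

Lemma nc_scale r (t : R) : 0 <= r -> nc (r%:C * eit t) = r.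
Proof. by move=> r0; rewrite ncM nc_eit mulr1 nc_real ger0_norm. Qed.

Lemma pseries_abs a f r : pseries a f -> 0 <= r < 1 ->
  exists2 B, 0 <= B & forall N, \sum_(n < N) nc (a n) * r ^+ n <= B.
Proof.
move=> af /andP[r0 r1].
(* Convergence at the larger radius [s] bounds the terms there, so that at radius [r] they decay
   like (r/s)^n. *)
pose s := (r + 1) / 2; have s0 : 0 < s by rewrite /s; lra.
have s1 : s < 1 by rewrite /s; lra.
have rs : r < s by rewrite /s; lra.
have ds : disc s%:C by apply/disc_nc; rewrite nc_real gtr0_norm.
have cs := af _ ds.
have [M hM] : exists M, forall N, nc (psum a N s%:C) <= M.
  have /cvg_seq_bounded/bounded_fun_has_ubound [M hM] :
      cvgn (fun N => nc (psum a N s%:C)) by apply/cvg_ex; eexists; exact: cvg_nc cs.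
  by exists M => N; apply: hM; exists N.
have hn n : nc (a n) * s ^+ n <= 2 * M.
  have -> : nc (a n) * s ^+ n = nc (psum a n.+1 s%:C - psum a n s%:C).
    by rewrite /psum big_ord_recr/= addrAC subrr add0r ncM ncX nc_real gtr0_norm.
  by apply: le_trans (ncB _ _) _; rewrite mulr_natl mulr2n lerD.
have M0 : 0 <= 2 * M.
  by apply: le_trans (hn 0%N); rewrite mulr_ge0 ?nc_ge0 ?exprn_ge0// ltW.
have q01 : 0 <= r / s < 1 by rewrite ltr_pdivrMr// mul1r rs andbT divr_ge0// ltW.
exists (2 * M * (1 - r / s)^-1).
  by rewrite mulr_ge0// invr_ge0 subr_ge0; case/andP: q01 => _ /ltW.
move=> N; apply: (@le_trans _ _ (2 * M * \sum_(n < N) (r / s) ^+ n)); last first.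
  by rewrite ler_wpM2l// geometric_le.
rewrite mulr_sumr ler_sum// => n _.
have -> : nc (a n) * r ^+ n = (nc (a n) * s ^+ n) * (r / s) ^+ n.
  by rewrite -mulrA -exprMn mulrC [s * _]mulrC divfK ?gt_eqF// mulrC.
by rewrite ler_wpM2r// exprn_ge0//; case/andP: q01.
Qed.

Lemma nc_psum_le a z r N : nc z <= r -> nc (psum a N z) <= \sum_(n < N) nc (a n) * r ^+ n.
Proof.
move=> zr; apply: le_trans (nc_sum _ _ _) _; apply: ler_sum => n _.
rewrite ncM ncX ler_wpM2l ?nc_ge0// lerXn2r ?nnegrE ?nc_ge0//.
exact: le_trans (nc_ge0 z) zr.
Qed.

Lemma pseries_bounded a f r : pseries a f -> 0 <= r < 1 ->
  exists B, forall z, nc z <= r -> nc (f z) <= B /\ forall N, nc (psum a N z) <= B.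
Proof.
move=> af r01; have [B B0 hB] := pseries_abs af r01; exists B => z zr.
have h N : nc (psum a N z) <= B by apply: le_trans (nc_psum_le _ _ zr) (hB N).
split=> //; have dz : disc z by apply/disc_nc; apply: le_lt_trans zr _; case/andP: r01.
by apply: nc_cvg_le (af z dz) _; exact: nearW.
Qed.

Lemma psum_tpoly a r N (t : R) : psum a N (r%:C * eit t) = tpoly (fun n => a n * r%:C ^+ n) N t.
Proof. by apply: eq_bigr => n _; rewrite exprMn mulrA. Qed.

Lemma disc_scale r (t : R) : 0 <= r < 1 -> disc (r%:C * eit t).
Proof. by move=> /andP[r0 r1]; apply/disc_nc; rewrite nc_scale. Qed.

Lemma cmeas_circle a f r : pseries a f -> 0 <= r < 1 -> cmeas (fun t => f (r%:C * eit t)).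
Proof.
move=> af r01; apply: (cmeas_cvg (p_ := fun N t => psum a N (r%:C * eit t))) => [N|t _].
  by apply: cmeas_eq (L2_tpoly (fun n => a n * r%:C ^+ n) N).1 => t _; rewrite psum_tpoly.
by apply: af; exact: disc_scale.
Qed.

Lemma circle_cvg a f r (q : R -> C) M : pseries a f -> 0 <= r < 1 -> cmeas q ->
  (forall t, nc (q t) <= M) ->
  (fun N => cmean (fun t => tpoly (fun n => a n * r%:C ^+ n) N t * q t)) @ \oo -->
  cmean (fun t => f (r%:C * eit t) * q t).
Proof.
move=> af r01 mq qM; have [B hB] := pseries_bounded af r01.
have M0 : 0 <= M by apply: le_trans (nc_ge0 (q 0)) (qM 0).
have [r0 r1] := andP r01.
have [] // := cmean_dct (p_ := fun N t => tpoly (fun n => a n * r%:C ^+ n) N t * q t)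
  (p := fun t => f (r%:C * eit t) * q t) (g := fun=> B * M).
- by move=> N; apply: cmeasM => //; exact: (L2_tpoly _ _).1.
- by apply: cmeasM => //; exact: cmeas_circle af r01.
- apply: aeDW => t _; apply: cvgMl; under eq_fun do rewrite -psum_tpoly.
  by apply: af; exact: disc_scale.
- exact: L1_cst.
- apply: aeDW => t _ N; rewrite ncM ler_pM ?nc_ge0// -psum_tpoly.
  by apply: (hB _ _).2; rewrite nc_scale.
Qed.

Lemma coef_circle a f r n : pseries a f -> 0 <= r < 1 ->
  coef (fun t => f (r%:C * eit t)) n = a n * r%:C ^+ n.
Proof.
move=> af r01.
have c := circle_cvg af r01 (M := 1) (cmeas_eitJX _ n) (fun t => ltac:(by rewrite nc_eitJX)).
apply: cvgC_uniq c _; apply: cvg_near_cst; exists n.+1 => // N /= nN.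
by rewrite -/(coef _ n) coef_tpoly nN.
Qed.

Lemma moment_tpoly a N m : cmean (fun t => tpoly a N t * eit t ^+ m.+1) = 0.
Proof.
rewrite /tpoly (@eq_cmean _ _ (fun t => \sum_(n < N) a n * eit t ^+ (n + m).+1)) => [|t _].
  rewrite cmean_sum; last by move=> n; apply: CL1Z; exact: CL1_eitX.
  by rewrite big1// => n _; rewrite cmeanZ ?cmean_eitX ?mulr0//; exact: CL1_eitX.
by rewrite mulr_suml; apply: eq_bigr => n _; rewrite -mulrA -exprD addnS.
Qed.

End Analytic.

(** * Closure properties of analytic functions *)

Section Weierstrass.
Variable R : realType.
Local Notation C := R[i].
Implicit Types (p q : R -> C) (a b : nat -> C) (f g : C -> C) (z w : C) (r : R).

Lemma CL1_circle a f r : pseries a f -> 0 <= r < 1 -> CL1 (fun t => f (r%:C * eit t)).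
Proof.
move=> af r01; have [B hB] := pseries_bounded af r01.
apply: (CL1_bounded (M := B)); first exact: cmeas_circle af r01.
by move=> t _; apply: (hB _ _).1; rewrite nc_scale//; case/andP: r01.
Qed.

Lemma real_complex_neq0 r : r != 0 -> r%:C != 0.
Proof. by move=> r0; rewrite -nc_gt0 nc_real normr_gt0. Qed.

Lemma cauchy_circle a f r z : pseries a f -> r < 1 -> nc z < r ->
  f z = cauchy (fun t => f (r%:C * eit t)) (z / r%:C).
Proof.
move=> af r1 zr; have r0 : 0 < r by apply: le_lt_trans (nc_ge0 z) zr.
have r01 : 0 <= r < 1 by rewrite ltW.
have zr1 : nc (z / r%:C) < 1 by rewrite ncM ncV nc_real gtr0_norm// ltr_pdivrMr// mul1r.
have := cauchy_cvg (CL1_circle af r01) zr1.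
apply: cvgC_uniq; apply: cvg_eq1 (af z _) => [N|]; last first.
  by apply/disc_nc; exact: lt_trans r1.
apply: eq_bigr => n _; rewrite (coef_circle n af r01) expr_div_n.
have h : r%:C ^+ n != 0 by rewrite expf_neq0// real_complex_neq0// gt_eqF.
by field.
Qed.

(** Pointwise convergence with local bounds is enough: on each circle the Fourier coefficients
    converge by dominated convergence, hence so do the Taylor coefficients, and Cauchy's formula
    passes to the limit. Products, compositions and exponentials are all obtained from this
    lemma. *)
Lemma weierstrass (f_ : nat -> C -> C) f : (forall k, analytic_disc (f_ k)) ->
  (forall r, 0 <= r < 1 -> exists M, forall k z, nc z <= r -> nc (f_ k z) <= M) ->
  (forall z, disc z -> f_ ^~ z @ \oo --> f z) -> analytic_disc f.
Proof.
move=> an bd cv.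
have [a_ ha] := choice (fun k => (analyticP (f_ k)).1 (an k)).
pose p r t := f (r%:C * eit t).
have lp r : 0 <= r < 1 -> CL1 (p r) /\ forall (q : R -> C) M, cmeas q -> (forall t, nc (q t) <= M) ->
   (fun k => cmean (fun t => f_ k (r%:C * eit t) * q t)) @ \oo --> cmean (fun t => p r t * q t).
  move=> r01; have [r0 r1] := andP r01; have [B hB] := bd _ r01.
  have mp : cmeas (p r).
    apply: (cmeas_cvg (p_ := fun k t => f_ k (r%:C * eit t))) => [k|t _].
      exact: cmeas_circle (ha k) r01.
    by apply: cv; exact: disc_scale.
  have pB t : nc (p r t) <= B.
    apply: (nc_cvg_le (F := \oo) _ (cv _ (disc_scale t r01))).
    by apply: nearW => k; apply: hB; rewrite nc_scale.
  split; first by apply: (CL1_bounded (M := B)).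
  move=> q M mq qM.
  have M0 : 0 <= M by apply: le_trans (nc_ge0 (q 0)) (qM 0).
  have [] // := cmean_dct (p_ := fun k t => f_ k (r%:C * eit t) * q t)
    (p := fun t => p r t * q t) (g := fun=> B * M).
  - by move=> k; apply: cmeasM => //; exact: cmeas_circle (ha k) r01.
  - exact: cmeasM.
  - by apply: aeDW => t _; apply: cvgMl; apply: cv; exact: disc_scale.
  - exact: L1_cst.
  - by apply: aeDW => t _ k; rewrite ncM ler_pM ?nc_ge0// hB// nc_scale.
have cf r n : 0 <= r < 1 -> (fun k => a_ k n * r%:C ^+ n) @ \oo --> coef (p r) n.
  move=> r01; apply: cvg_eq1 ((lp r r01).2 _ 1 (cmeas_eitJX _ n) _) => [k|t].
    by rewrite -(coef_circle n (ha k) r01).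
  by rewrite nc_eitJX.
have [h h01 h0] : exists2 h : R, 0 <= h < 1 & h != 0.
  by exists 2^-1; rewrite ?invr_eq0 ?pnatr_eq0// invr_ge0 ler0n/= invf_lt1// ltr1n.
(* The limit coefficients are read off on one fixed circle; [coefE] shows that they serve every
   radius. *)
pose a n := coef (p h) n / h%:C ^+ n.
have ca n : (fun k => a_ k n) @ \oo --> a n.
  have hn0 : h%:C ^+ n != 0 :> C by rewrite expf_neq0// real_complex_neq0.
  apply: (@cvg_eq1 _ _ _ _ (fun k => (a_ k n * h%:C ^+ n) * (h%:C ^+ n)^-1)) => [k|].
    by rewrite mulfK.
  by apply: cvgMl; exact: cf.
have coefE r n : 0 <= r < 1 -> coef (p r) n = a n * r%:C ^+ n.
  move=> r01; apply: cvgC_uniq (cf _ n r01) _; apply: cvgMl; exact: ca.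
apply/analyticP; exists a => z dz; have z1 := (disc_nc z).1 dz.
have [r [zr r0 r1]] := disc_radius z1.
have r01 : 0 <= r < 1 by rewrite ltW.
have zr1 : nc (z / r%:C) < 1 by rewrite ncM ncV nc_real gtr0_norm// ltr_pdivrMr// mul1r.
have -> : f z = cauchy (p r) (z / r%:C).
  apply: cvgC_uniq (cv z dz) _.
  apply: cvg_eq1 ((lp r r01).2 _ (1 - nc (z / r%:C))^-1 (cmeas_denomV (z / r%:C)) _) => [k|t].
    exact: cauchy_circle (ha k) r1 zr.
  exact: nc_denomV_le.
apply: cvg_eq1 (cauchy_cvg (lp r r01).1 zr1) => N; apply: eq_bigr => n _.
have rn : r%:C ^+ n != 0 by rewrite expf_neq0// real_complex_neq0// gt_eqF.
by rewrite coefE// expr_div_n; field.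
Qed.

Lemma analytic_eq f g : (forall z, disc z -> f z = g z) -> analytic_disc f -> analytic_disc g.
Proof. by move=> fg [a h]; exists a => z dz; rewrite -fg//; exact: h. Qed.

Lemma analytic_monomial (c : C) n : analytic_disc (fun z => c * z ^+ n).
Proof.
apply/analyticP; exists (fun m => if m == n then c else 0) => z _.
apply: cvg_near_cst; exists n.+1 => // N /= nN.
rewrite /psum (bigD1 (Ordinal nN))//= eqxx big1 ?addr0// => i ni.
by rewrite ifN ?mul0r//.
Qed.

Lemma analytic_cst (c : C) : analytic_disc (fun=> c).
Proof. by apply: analytic_eq (analytic_monomial c 0) => z _; rewrite mulr1. Qed.

Lemma analyticD f g : analytic_disc f -> analytic_disc g -> analytic_disc (fun z => f z + g z).
Proof.
move=> /analyticP[a ha] /analyticP[b hb]; apply/analyticP; exists (fun n => a n + b n) => z dz.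
apply: cvg_eq1 (cvgD (ha z dz) (hb z dz)) => N.
transitivity (psum a N z + psum b N z) => //.
by rewrite /psum -big_split/=; apply: eq_bigr => n _; rewrite mulrDl.
Qed.

Lemma analyticZ (c : C) f : analytic_disc f -> analytic_disc (fun z => c * f z).
Proof.
move=> /analyticP[a ha]; apply/analyticP; exists (fun n => c * a n) => z dz.
apply: cvg_eq1 (cvgMr (a := c) (ha z dz)) => N.
by rewrite /psum mulr_sumr; apply: eq_bigr => n _; rewrite mulrA.
Qed.

Lemma analyticN f : analytic_disc f -> analytic_disc (fun z => - f z).
Proof. by move=> /(analyticZ (-1)); apply: analytic_eq => z _; rewrite mulN1r. Qed.

Lemma analyticB f g : analytic_disc f -> analytic_disc g -> analytic_disc (fun z => f z - g z).
Proof. by move=> af /analyticN; exact: analyticD. Qed.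

Lemma analytic_sum (I : Type) (s : seq I) (F : I -> C -> C) :
  (forall i, analytic_disc (F i)) -> analytic_disc (fun z => \sum_(i <- s) F i z).
Proof.
move=> aF; elim: s => [|i s ih].
  by apply: analytic_eq (analytic_cst 0) => z _; rewrite big_nil.
by apply: analytic_eq (analyticD (aF i) ih) => z _; rewrite big_cons.
Qed.

Lemma analyticM f g : analytic_disc f -> analytic_disc g -> analytic_disc (fun z => f z * g z).
Proof.
move=> /analyticP[a ha] /analyticP[b hb].
apply: (weierstrass (f_ := fun N z => psum a N z * psum b N z)).
- move=> N; apply: analytic_eq (analytic_sum (index_enum 'I_N) (F := fun i z =>
    \sum_(j < N) (a i * b j) * z ^+ (i + j)) _) => [z _|i].
    rewrite /psum mulr_suml; apply: eq_bigr => i _; rewrite mulr_sumr.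
    by apply: eq_bigr => j _; rewrite exprD; ring.
  by apply: analytic_sum => j; exact: analytic_monomial.
- move=> r r01; have [A hA] := pseries_bounded ha r01; have [B hB] := pseries_bounded hb r01.
  exists (A * B) => k z zr; rewrite ncM ler_pM ?nc_ge0//; first exact: (hA z zr).2.
  exact: (hB z zr).2.
- by move=> z dz; apply: cvgM; [exact: ha|exact: hb].
Qed.

Lemma analyticX f n : analytic_disc f -> analytic_disc (fun z => f z ^+ n).
Proof.
move=> af; elim: n => [|n ih]; first exact: analytic_cst.
by apply: analytic_eq (analyticM af ih) => z _; rewrite exprS.
Qed.

Lemma analytic_bounded f r : analytic_disc f -> 0 <= r < 1 -> exists M, forall z, nc z <= r -> nc (f z) <= M.
Proof.
move=> /analyticP[a ha] r01; have [B hB] := pseries_bounded ha r01.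
by exists B => z /hB[].
Qed.

(** Asking that [g] map each smaller disc into a smaller disc keeps the partial sums of [f] at [g z]
    locally bounded, as [weierstrass] demands. *)
Lemma analytic_comp f g : analytic_disc f -> analytic_disc g ->
  (forall r, 0 <= r < 1 -> exists2 s, 0 <= s < 1 & forall z, nc z <= r -> nc (g z) <= s) ->
  analytic_disc (fun z => f (g z)).
Proof.
move=> /analyticP[a ha] ag hg.
apply: (weierstrass (f_ := fun N z => psum a N (g z))).
- by move=> N; apply: analytic_sum => n; apply: analyticZ; exact: analyticX.
- move=> r r01; have [s s01 gs] := hg r r01; have [A hA] := pseries_bounded ha s01.
  by exists A => k z /gs /hA[].
- move=> z /disc_nc z1; apply: ha; have [|s s01 gs] := hg (nc z); first by rewrite nc_ge0.
  by apply/disc_nc; apply: le_lt_trans (gs z _) _ => //; case/andP: s01.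
Qed.

End Weierstrass.

(** * The complex exponential *)

Section Exponential.
Variable R : realType.
Local Notation C := R[i].
Implicit Types (z w : C) (r : R).

Lemma cexpE z : cexp z = (expR (Re z))%:C * eit (Im z). Proof. by []. Qed.

Lemma nc_cexp z : nc (cexp z) = expR (Re z).
Proof. by rewrite cexpE ncM nc_eit mulr1 nc_real gtr0_norm// expR_gt0. Qed.

Lemma cexpD z w : cexp (z + w) = cexp z * cexp w.
Proof. by rewrite !cexpE ReD ImD expRD eitD rmorphM; ring. Qed.

Lemma cexp0 : cexp 0 = 1 :> C.
Proof. by rewrite cexpE expR0 eit0 mulr1. Qed.

Lemma cexp_nat z n : cexp (n%:R * z) = cexp z ^+ n.
Proof.
elim: n => [|n ih]; first by rewrite mul0r cexp0.
by rewrite exprS -ih -cexpD -nat1r mulrDl mul1r.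
Qed.

Lemma cvg_cexp (T : Type) (F : set_system T) (FF : Filter F) (f : T -> C) z :
  f @ F --> z -> (fun t => cexp (f t)) @ F --> cexp z.
Proof.
move=> fz.
have fr : (fun t => Re (f t)) @ F --> Re z by exact: cvgC_Re.
have fi : (fun t => Im (f t)) @ F --> Im z by exact: cvgC_Im.
apply: cvgM; apply: cvgC_ReIm => /=.
- exact: (cvg_comp _ _ fr (@continuous_expR R _)).
- exact: cvg_cst.
- apply: cvg_eq1 (_ : (fun t => cos (Im (f t))) @ F --> _) => [t|]; first by rewrite eitE.
  by rewrite eitE; exact: (cvg_comp _ _ fi (@continuous_cos R _)).
- apply: cvg_eq1 (_ : (fun t => sin (Im (f t))) @ F --> _) => [t|]; first by rewrite eitE.
  by rewrite eitE; exact: (cvg_comp _ _ fi (@continuous_sin R _)).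
Qed.

Lemma subX_le z w M n : 1 <= M -> nc z <= M -> nc w <= M ->
  nc (z ^+ n - w ^+ n) <= n%:R * nc (z - w) * M ^+ n.
Proof.
move=> M1 zM wM; have M0 : 0 <= M by exact: le_trans ler01 M1.
elim: n => [|n ih]; first by rewrite subrr nc0 !mul0r.
have -> : z ^+ n.+1 - w ^+ n.+1 = z * (z ^+ n - w ^+ n) + (z - w) * w ^+ n by rewrite !exprS; ring.
apply: le_trans (ncD _ _) _; rewrite !ncM -nat1r mulrDl mul1r mulrDl addrC lerD//.
  rewrite ler_wpM2l ?nc_ge0// ncX exprS (le_trans (y := M ^+ n))//; first by rewrite lerXn2r ?nnegrE ?nc_ge0.
  by rewrite ler_peMl// exprn_ge0.
by rewrite exprS mulrCA ler_pM ?nc_ge0.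
Qed.

Lemma derive_harmonic (h : R -> R) (d : R) : is_derive (0 : R) 1 h d ->
  (fun n => n.+1%:R * (h n.+1%:R^-1 - h 0)) @ \oo --> d.
Proof.
move=> [dh hd].
have : t^-1 *: ((h \o shift (0 : R)) (t *: (1 : R)) - h 0) @[t --> (0 : R)^'] --> d.
  by rewrite -hd; exact: dh.
move=> /cvg_dnbhs_at_right/cvg_at_rightP /(_ (fun n => n.+1%:R^-1)) H.
apply: cvg_eq1 (H _) => [n|].
  by rewrite /= /shift/= addr0 /GRing.scale/= mulr1 invrK.
by split; [move=> n; rewrite invr_gt0|exact: cvg_harmonic].
Qed.

(** Compare the base with [v n] = exp(z/(n+1)), whose power n+1 is exactly exp z. The powers differ
    by at most (n+1) times the distance of the bases, times exp|z|, and this tends to 0 because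
    (n+1)(v n - 1) tends to z, by differentiation at 0. The limit exhibits [cexp] of an analytic
    function as a limit of polynomials in it. *)
Lemma cvg_one_plus_div z : (fun n => (1 + z / n.+1%:R%:C) ^+ n.+1) @ \oo --> cexp z.
Proof.
pose v n := cexp (z / n.+1%:R%:C).
have n0 n : n.+1%:R != 0 :> R by rewrite pnatr_eq0.
have nC n : n.+1%:R = (n.+1%:R%:C : C) by rewrite rmorph_nat.
have vX n : v n ^+ n.+1 = cexp z.
  by rewrite /v -cexp_nat nC mulrCA mulfV ?mulr1// -nC pnatr_eq0.
pose M n := expR (nc z / n.+1%:R).
have MX n : M n ^+ n.+1 = expR (nc z) by rewrite /M -expRM_natl -mulr_natl; congr expR; field.
have nzn n : nc (z / n.+1%:R%:C) = nc z / n.+1%:R by rewrite ncM ncV nc_real ger0_norm.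
have vM n : nc (v n) <= M n.
  by rewrite nc_cexp ler_expR -nzn (le_trans (ler_norm _))// Re_le_nc.
have uM n : nc (1 + z / n.+1%:R%:C) <= M n.
  by rewrite (le_trans (ncD _ _))// nc1 nzn expR_ge1Dx.
have M1 n : 1 <= M n by rewrite -expR0 ler_expR divr_ge0 ?nc_ge0.
have Rez n : Re (z / n.+1%:R%:C) = n.+1%:R^-1 * Re z.
  by rewrite -fmorphV ReM /= mulr0 subr0 mulrC.
have Imz n : Im (z / n.+1%:R%:C) = n.+1%:R^-1 * Im z.
  by rewrite -fmorphV ImM /= mulr0 add0r mulrC.
have key : (fun n => n.+1%:R%:C * (v n - 1)) @ \oo --> z.
  apply: cvgC_ReIm => /=.
    apply: cvg_eq1 (derive_harmonic (h := fun t => expR (t * Re z) * cos (t * Im z)) (d := Re z) _) => [n|].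
      rewrite ReM ReB mul0r subr0 /v cexpE eitE !mul0r expR0 cos0 mul1r.
      by rewrite ReM/= mul0r subr0 Rez Imz.
    apply: is_derive_eq; rewrite /GRing.scale/= !mul0r sin0 cos0 expR0; ring.
  apply: cvg_eq1 (derive_harmonic (h := fun t => expR (t * Re z) * sin (t * Im z)) (d := Im z) _) => [n|].
    rewrite ImM ImB mul0r addr0 /v cexpE eitE !mul0r expR0 sin0 mul1r.
    by rewrite ImM/= mul0r addr0 Rez Imz.
  apply: is_derive_eq; rewrite /GRing.scale/= !mul0r sin0 cos0 expR0; ring.
apply/cvgC_nc.
apply: (@squeeze_cvgr _ _ _ _ (fun=> 0) (fun n => nc (n.+1%:R%:C * (v n - 1) - z) * expR (nc z))).
- apply: nearW => n; rewrite nc_ge0/= -(vX n) -(MX n).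
  apply: le_trans (subX_le _ (M1 n) (uM n) (vM n)) _.
  rewrite ler_wpM2r ?exprn_ge0 ?expR_ge0//.
  have -> : n.+1%:R * nc (1 + z / n.+1%:R%:C - v n) = nc (n.+1%:R%:C * (1 + z / n.+1%:R%:C - v n)).
    by rewrite ncM nc_real ger0_norm.
  have h : n.+1%:R%:C != 0 :> C by rewrite real_complex_neq0.
  rewrite -ncN le_eqVlt; apply/orP; left; apply/eqP; congr nc.
  by rewrite !mulrDr mulrN [_ * (z / _)]mulrC divfK//; ring.
- exact: cvg_cst.
- by rewrite -(mul0r (expR (nc z))); apply: cvgMl; apply/cvgC_nc.
Qed.

Lemma analytic_cexp (f : C -> C) : analytic_disc f -> analytic_disc (fun z => cexp (f z)).
Proof.
move=> af; apply: (weierstrass (f_ := fun n z => (1 + f z / n.+1%:R%:C) ^+ n.+1)).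
- move=> n; apply: analyticX; apply: analyticD; first exact: analytic_cst.
  by apply: analytic_eq (analyticZ (n.+1%:R%:C)^-1 af) => z _; rewrite mulrC.
- move=> r r01; have [M hM] := analytic_bounded af r01; exists (expR M) => n z zr.
  have nz : n.+1%:R != 0 :> R by rewrite pnatr_eq0.
  rewrite ncX (_ : expR M = expR (M / n.+1%:R) ^+ n.+1); last first.
    by rewrite -expRM_natl; congr expR; field.
  rewrite lerXn2r ?nnegrE ?nc_ge0 ?expR_ge0//.
  apply: le_trans (ncD _ _) _; rewrite nc1 ncM ncV nc_real ger0_norm//.
  apply: le_trans (expR_ge1Dx _) _; rewrite ler_expR ler_wpM2r ?invr_ge0//.
  exact: hM.
- by move=> z _; exact: cvg_one_plus_div.
Qed.

End Exponential.

(** * Fatou's lemma and monotone convergence for means *)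

Section Convergence.
Variable R : realType.
Local Notation C := R[i].
Local Notation mu := (@lebesgue_measure R).
Local Notation D := (@angles R).
Local Hint Resolve measurable_angles : core.
Implicit Types (g : R -> R) (p q : R -> C).

Lemma integral_mean g : L1 g -> (\int[mu]_(t in D) (g t)%:E)%E = (2 * pi * mean g)%:E.
Proof.
move=> lg; rewrite /mean mulVKf ?gt_eqF ?twopi_gt0// /Rintegral fineK//.
exact: (@integrable_fin_num _ _ _ mu D (@measurable_angles R) _ lg).
Qed.

Lemma mean_fatou (g_ : nat -> R -> R) g B :
  (forall n, L1 (g_ n)) -> (forall n t, D t -> 0 <= g_ n t) ->
  (forall n, mean (g_ n) <= B) -> meas g -> (forall t, D t -> 0 <= g t) ->
  aeD (fun t => g_ ^~ t @ \oo --> g t) -> L1 g /\ mean g <= B.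
Proof.
move=> lg g0 gB mg gg cg.
have mD := @measurable_angles R.
have le : (\int[mu]_(t in D) (g t)%:E <= (2 * pi * B)%:E)%E.
  rewrite (@integral_ae_nonmeasurable _ _ _ mu D _ (fun t => limn_einf (fun n => (g_ n t)%:E))); last first.
    apply: aeDS cg => t _ h.
    have /cvg_limn_einf_sup[-> _] // : (fun n => (g_ n t)%:E) @ \oo --> (g t)%:E.
    by apply: cvg_EFin => //; exact: nearW.
  apply: le_trans (fatou mu mD (f := fun n t => (g_ n t)%:E) _ _) _ => [n|n t Dt|].
  - by apply/measurable_EFinP; exact: L1_meas.
  - by rewrite lee_fin g0.
  rewrite limn_einf_lim; apply: lime_le; first exact: is_cvg_einfs.
  apply: nearW => n; apply: ereal_inf_le; exists (\int[mu]_(t in D) (g_ n t)%:E)%E.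
    by exists n => /=.
  by rewrite integral_mean// lee_fin ler_wpM2l// ltW// twopi_gt0.
have lg' : L1 g.
  apply/integrableP; split; first exact/measurable_EFinP.
  apply: le_lt_trans (ltry (2 * pi * B)); apply: le_trans le.
  rewrite le_eqVlt; apply/orP; left; apply/eqP; apply: eq_integral => t.
  by rewrite inE => Dt; rewrite /= ger0_norm// gg.
split=> //; rewrite -(ler_pM2l (@twopi_gt0 R)) -lee_fin -integral_mean//.
Qed.

Lemma aeD_null (P : R -> Prop) : aeD P ->
  exists N : set R, [/\ measurable N, mu N = 0%E & forall t, D t -> ~ N t -> P t].
Proof.
move=> [N [mN N0 h]]; exists N; split => // t Dt Nt.
by apply: contrapT => nP; apply: Nt; apply: h => /(_ Dt).
Qed.

Lemma null_aeD (N : set R) : measurable N -> mu N = 0%E -> aeD (fun t => ~ N t).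
Proof. by move=> mN N0; exists N; split => // t /= /not_implyP[_ /contrapT]. Qed.

Lemma meas_indic (N : set R) : measurable N -> meas (\1_N : R -> R).
Proof. by move=> mN; exact: measurable_indic. Qed.

Lemma indic_ge0 (N : set R) t : 0 <= \1_N t :> R.
Proof. by rewrite indicE; case: (_ \in _). Qed.

Lemma norm_indic_le1 (N : set R) t : `|\1_N t| <= 1 :> R.
Proof. by rewrite indicE; case: (_ \in _); rewrite ?normr1 ?normr0. Qed.

Lemma L1_indic (N : set R) : measurable N -> L1 (\1_N : R -> R).
Proof. by move=> mN; apply: (@L1_bounded _ _ 1) => [|t _]; [exact: meas_indic|exact: norm_indic_le1]. Qed.

(** Replacing the sequence by 0 on a Borel null set makes it converge everywhere; this provides a
    Borel limit although the Borel sigma-algebra is not complete. *)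
Lemma meas_ae_cvg (f_ : nat -> R -> R) : (forall n, meas (f_ n)) ->
  aeD (fun t => cvgn (f_ ^~ t)) ->
  exists2 f, meas f & aeD (fun t => f_ ^~ t @ \oo --> f t).
Proof.
move=> mf /aeD_null[N [mN N0 cf]].
pose h n t := f_ n t * \1_(~` N) t.
exists (fun t => limn (h ^~ t)).
  apply: (meas_cvg (f_ := h)) => [n|t Dt].
    by apply: measM => //; apply: meas_indic; exact: measurableC.
  have [Nt|Nt] := pselect (N t).
    have -> : h ^~ t = fun=> 0.
      by apply/funext => n; rewrite /h indicE memNset ?mulr0// => /(_ Nt).
    exact: is_cvg_cst.
  have -> : h ^~ t = f_ ^~ t by apply/funext => n; rewrite /h indicE mem_set ?mulr1.
  exact: cf.
apply: aeDS (null_aeD mN N0) => t Dt Nt.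
have -> : h ^~ t = f_ ^~ t by apply/funext => n; rewrite /h indicE mem_set ?mulr1.
exact: cf.
Qed.

(** Beppo Levi: the common bound on the means forces the increasing sequence to have a finite limit
    almost everywhere. *)
Lemma mean_monotone (g_ : nat -> R -> R) B :
  (forall n, L1 (g_ n)) -> (forall n t, D t -> 0 <= g_ n t) ->
  (forall t, D t -> {homo g_ ^~ t : n m / (n <= m)%N >-> n <= m}) ->
  (forall n, mean (g_ n) <= B) ->
  exists h, [/\ L1 h, mean h <= B & aeD (fun t => g_ ^~ t @ \oo --> h t)].
Proof.
move=> lg g0 gn gB.
have mD := @measurable_angles R.
pose G (t : R) : \bar R := limn (fun n => (g_ n t)%:E).
have mgn n : measurable_fun D (EFin \o g_ n) by apply/measurable_EFinP; exact: L1_meas.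
have cG t : D t -> (fun n => (g_ n t)%:E) @ \oo --> G t.
  move=> Dt; apply/cvg_ex; eexists; apply: ereal_nondecreasing_cvgn => n m nm.
  by rewrite lee_fin gn.
have iG : mu.-integrable D G.
  apply/integrableP; split.
    by apply: (emeasurable_fun_cvg (fun n => EFin \o g_ n)) => // t Dt; exact: cG.
  have cv := cvg_monotone_convergence (mu := mu) mD (g' := fun n t => (g_ n t)%:E) mgn.
  have {}cv : ((\int[mu]_(t in D) (g_ n t)%:E)%E @[n --> \oo] --> (\int[mu]_(t in D) G t)%E).
    by apply: cv => [n t Dt|t Dt n m nm]; rewrite lee_fin ?g0 ?gn.
  have -> : (\int[mu]_(t in D) `|G t| = \int[mu]_(t in D) G t)%E.
    apply: eq_integral => t; rewrite inE => Dt; rewrite gee0_abs//.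
    rewrite -(cvg_lim _ (cG t Dt))//; apply: lime_ge; first by apply/cvg_ex; eexists; exact: cG.
    by apply: nearW => n; rewrite lee_fin g0.
  apply: le_lt_trans (ltry (2 * pi * B)); rewrite -(cvg_lim _ cv)//.
  apply: lime_le; first by apply/cvg_ex; eexists; exact: cv.
  by apply: nearW => n; rewrite integral_mean// lee_fin ler_wpM2l// ltW// twopi_gt0.
have fG := @integrable_ae _ _ _ mu D mD _ iG.
have cg : aeD (fun t => g_ ^~ t @ \oo --> fine (G t)).
  by apply: aeDS fG => t Dt fGt; move: (cG t Dt); rewrite -{1}(fineK fGt) => /fine_cvg.
have [h mh hc] : exists2 f, meas f & aeD (fun t => g_ ^~ t @ \oo --> f t).
  apply: meas_ae_cvg => [n|]; first exact: L1_meas.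
  by apply: aeDS cg => t _ h; apply/cvg_ex; eexists; exact: h.
(* [mean_fatou] wants a limit that is nonnegative everywhere, and [h] is so only almost
   everywhere. *)
pose h' t := Num.max 0 (h t).
have hc' : aeD (fun t => g_ ^~ t @ \oo --> h' t).
  apply: aeDS hc => t Dt hh; rewrite /h' max_r//.
  have -> : h t = limn (g_ ^~ t) by rewrite (cvg_lim _ hh).
  apply: limr_ge; first by apply/cvg_ex; eexists; exact: hh.
  by apply: nearW => n; exact: g0.
exists h'; have [] := mean_fatou lg g0 gB _ _ hc'.
- by apply: measurable_maxr => //; exact: meas_cst.
- by move=> t _; rewrite /h' le_max lexx.
- by move=> l1 l2; split.
Qed.

End Convergence.

(** * The Riesz-Fischer theorem *)

Section RieszFischer.
Variable R : realType.
Local Notation C := R[i].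
Implicit Types (p q : R -> C) (a : nat -> C).

Lemma cvg_sqr (T : Type) (F : set_system T) (FF : Filter F) (f : T -> R) (x : R) :
  f @ F --> x -> (fun t => f t ^+ 2) @ F --> x ^+ 2.
Proof.
by move=> fx; rewrite expr2; apply: cvg_eq1 (fun t => expr2 (f t)) _; exact: cvgM.
Qed.

Lemma cvgn_bounded_variation (x : nat -> R) (B : R) :
  (forall K, \sum_(k < K) `|x k.+1 - x k| <= B) -> cvgn x.
Proof.
move=> h; pose u k := x k.+1 - x k.
have cu : cvgn (series u).
  apply: normed_cvg; apply: nondecreasing_is_cvgn.
    apply/nondecreasing_seqP => n; rewrite -subr_ge0 seriesSB; exact: normr_ge0.
  by exists B => _ [n _ <-]; rewrite /= /series/= big_mkord.
have -> : x = (fun n => series u n + x 0%N).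
  apply/funext => n; rewrite /series/= telescope_sumr// subrK//.
by apply: is_cvgD => //; exact: is_cvg_cst.
Qed.

Lemma mean_nc_le p : L2 p -> mean (fun t => nc (p t)) ^+ 2 <= n2 p.
Proof.
move=> lp; have := mean_cauchy_schwarz lp (L2_cst 1).
rewrite [X in _ <= _ * X](_ : _ = 1) ?mulr1; last first.
  by rewrite /n2 nc1 expr1n mean_cst.
by congr (_ ^+ 2 <= _); apply: eq_mean => t _; rewrite nc1 mulr1.
Qed.

Lemma n2B_sym p q : n2 (fun t => p t - q t) = n2 (fun t => q t - p t).
Proof. by apply: eq_mean => t _; rewrite ncC. Qed.

Lemma n2_tpolyB a M N : n2 (fun t => tpoly a N t - tpoly a M t) =
  `|\sum_(n < N) nc (a n) ^+ 2 - \sum_(n < M) nc (a n) ^+ 2|.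
Proof.
wlog MN : M N / (M <= N)%N => [H|].
  have [|/ltnW] := leqP M N; first exact: H.
  by move=> /H; rewrite distrC => <-; exact: n2B_sym.
have := bessel_eq M (L2_tpoly a N); rewrite n2_tpoly.
have -> : n2 (fun t => tpoly a N t - tpoly (coef (tpoly a N)) M t) = n2 (fun t => tpoly a N t - tpoly a M t).
  apply: eq_n2 => t _; congr (_ - _); apply: eq_bigr => n _.
  by rewrite coef_tpoly (leq_trans (ltn_ord n)).
move=> ->; rewrite ger0_norm.
  congr (_ - _); apply: eq_bigr => n _.
  by rewrite coef_tpoly (leq_trans (ltn_ord n)).
by rewrite subr_ge0 -(subnKC MN) big_split_ord/= lerDl sumr_ge0// => i _; exact: sqr_ge0.
Qed.

Lemma nc_cmean_small p q r : L2 p -> L2 q -> (forall t, nc (q t) = 1) -> n2 p <= r ^+ 2 -> 0 <= r ->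
  nc (cmean (fun t => p t * q t)) <= r.
Proof.
move=> lp lq q1 pr r0; rewrite -(ler_pXn2r (n := 2)) ?nnegrE ?nc_ge0//.
apply: le_trans (cauchy_schwarz lp lq) _.
rewrite (_ : n2 q = 1) ?mulr1//.
by rewrite -[RHS](mean_cst 1); apply: eq_mean => t _; rewrite q1 expr1n.
Qed.

(** Along a subsequence of partial sums with small tails the increments have summable means, so the
    subsequence has bounded variation, hence a limit, at almost every point. Fatou's lemma makes
    this limit a limit in [L2], and the Fourier data of the polynomials carry over by
    Cauchy-Schwarz. *)
Lemma riesz_fischer a (B : R) : (forall N, \sum_(n < N) nc (a n) ^+ 2 <= B) ->
  exists p, [/\ L2 p, forall n, coef p n = a n,
    forall m, cmean (fun t => p t * eit t ^+ m.+1) = 0 &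
    (fun N => n2 (fun t => p t - tpoly a N t)) @ \oo --> (0 : R)].
Proof.
move=> aB; pose S N := \sum_(n < N) nc (a n) ^+ 2.
have ndS : nondecreasing_seq S.
  by apply/nondecreasing_seqP => n; rewrite /S big_ord_recr/= lerDl sqr_ge0.
have cS : cvgn S.
  by apply: nondecreasing_is_cvgn => //; exists B => _ [n _ <-]; exact: aB.
pose L := limn S.
have SL n : S n <= L by exact: nondecreasing_cvgn_le.
have h2 : 0 <= 2^-1 :> R by rewrite invr_ge0.
(* The tolerance is a square because [n2] is a squared norm: the k-th increment then has mean
   modulus at most 2^-k. *)
have hN k : exists N, (k <= N)%N /\ L - S N <= (2^-1 ^+ k) ^+ 2.
  have /cvgrPdist_le /(_ ((2^-1 ^+ k) ^+ 2)) : S @ \oo --> L by [].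
  have p0 : 0 < (2^-1 ^+ k) ^+ 2 :> R by rewrite !exprn_gt0// invr_gt0.
  move=> /(_ p0)[N _ /(_ (maxn k N))] H; exists (maxn k N); rewrite leq_maxl; split=> //.
  by apply: le_trans (H _); [rewrite ler_norm|rewrite /= leq_maxr].
have [N_ hN_] := choice hN.
pose s k := tpoly a (N_ k).
have sL k : L2 (s k) by exact: L2_tpoly.
have sdist j k : (k <= j)%N -> n2 (fun t => s j t - s k t) <= (2^-1 ^+ k) ^+ 2.
  move=> kj; rewrite n2_tpolyB -/(S _) -/(S _).
  have h1 := (hN_ k).2; have h3 := (hN_ j).2; have h4 := SL (N_ k); have h5 := SL (N_ j).
  have h6 : (2^-1 ^+ j) ^+ 2 <= (2^-1 ^+ k) ^+ 2 :> R.
    by rewrite lerXn2r ?nnegrE ?exprn_ge0// ler_wiXn2l// invf_le1// ler1n.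
  by rewrite ler_norml; apply/andP; split; lra.
pose G K (t : R) := \sum_(k < K) nc (s k.+1 t - s k t).
have L1G K : L1 (G K).
  rewrite /G; elim: K => [|K ih].
    by apply: L1_eq (L1_cst 0) => t _; rewrite big_ord0.
  apply: L1_eq (L1D ih (L1_nc (L2_CL1 (L2B (sL K.+1) (sL K))))) => t _.
  by rewrite big_ord_recr.
have mG K : mean (G K) <= (1 - 2^-1)^-1.
  apply: (@le_trans _ _ (\sum_(k < K) 2^-1 ^+ k)); last first.
    by apply: geometric_le; rewrite h2 invf_lt1// ltr1n.
  elim: K => [|K ih].
    by rewrite big_ord0 /G (@eq_mean _ _ (fun=> 0)) ?mean_cst// => t _; rewrite big_ord0.
  have lK := L2B (sL K.+1) (sL K).
  rewrite (@eq_mean _ _ (fun t => G K t + nc (s K.+1 t - s K t))); last first.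
    by move=> t _; rewrite /G big_ord_recr.
  rewrite meanD//; last exact/L1_nc/L2_CL1.
  rewrite big_ord_recr/= lerD// -(ler_pXn2r (n := 2)) ?nnegrE ?exprn_ge0//; last first.
    by apply: mean_ge0 => t _; exact: nc_ge0.
  exact: le_trans (mean_nc_le lK) (sdist _ _ (leqnSn K)).
have [h [lh _ cG]] : exists h, [/\ L1 h, mean h <= (1 - 2^-1)^-1 & aeD (fun t => G ^~ t @ \oo --> h t)].
  apply: (mean_monotone L1G) => [n t _|t _|//].
    by apply: sumr_ge0 => k _; exact: nc_ge0.
  by apply/nondecreasing_seqP => n; rewrite /G big_ord_recr/= lerDl nc_ge0.
have bG : aeD (fun t => exists B' : R, forall K, G K t <= B').
  apply: aeDS cG => t _ H.
  have [B' hB'] : has_ubound (range (G ^~ t)).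
    by apply/bounded_fun_has_ubound/cvg_seq_bounded/cvg_ex; eexists; exact: H.
  by exists B' => K; apply: hB'; exists K.
have [p1 mp1 cp1] : exists2 f, meas f & aeD (fun t => (fun k => Re (s k t)) @ \oo --> f t).
  apply: meas_ae_cvg => [k|]; first exact: (sL k).1.1.
  apply: aeDS bG => t _ [B' hB']; apply: (@cvgn_bounded_variation _ B') => K.
  by apply: le_trans (hB' K); apply: ler_sum => k _; rewrite -ReB Re_le_nc.
have [p2 mp2 cp2] : exists2 f, meas f & aeD (fun t => (fun k => Im (s k t)) @ \oo --> f t).
  apply: meas_ae_cvg => [k|]; first exact: (sL k).1.2.
  apply: aeDS bG => t _ [B' hB']; apply: (@cvgn_bounded_variation _ B') => K.
  by apply: le_trans (hB' K); apply: ler_sum => k _; rewrite -ImB Im_le_nc.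
pose p t := Complex (p1 t) (p2 t).
have mp : cmeas p by [].
have cp : aeD (fun t => s ^~ t @ \oo --> p t).
  by apply: aeDS2 cp1 cp2 => t _ h1 h3; exact: cvgC_ReIm.
have ps k : L2 (fun t => p t - s k t) /\ n2 (fun t => p t - s k t) <= (2^-1 ^+ k) ^+ 2.
  have mps : cmeas (fun t => p t - s k t) by apply: cmeasB => //; exact: (sL k).1.
  have [l1 l2] : L1 (fun t => nc (p t - s k t) ^+ 2) /\ mean (fun t => nc (p t - s k t) ^+ 2) <= (2^-1 ^+ k) ^+ 2.
    apply: (mean_fatou (g_ := fun j t => nc (s (j + k)%N t - s k t) ^+ 2)).
    - by move=> j; exact: (L2B (sL _) (sL _)).2.
    - by move=> j t _; exact: sqr_ge0.
    - by move=> j; apply: sdist; exact: leq_addl.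
    - exact: meas_nc_sq.
    - by move=> t _; exact: sqr_ge0.
    - apply: aeDS cp => t _ hh; apply: cvg_sqr.
      have c : (fun j => nc (s (j + k)%N t - s k t)) @ \oo --> nc (p t - s k t).
        apply: cvg_nc; apply: cvgB; last exact: cvg_cst.
        by move: hh; rewrite -(cvg_shiftn k).
      exact: c.
  by split.
have lp : L2 p.
  by apply: L2_eq (L2D (ps 0%N).1 (sL 0%N)) => t _; rewrite subrK.
have lim0 (z : C) k0 : (forall k, (k0 < k)%N -> nc z <= 2^-1 ^+ k) -> z = 0.
  move=> hz; apply/eqP; rewrite -nc_eq0 eq_le nc_ge0 andbT.
  have c : (fun k => 2^-1 ^+ k : R) @ \oo --> (0 : R).
    by apply: cvg_expr; rewrite ger0_norm// invf_lt1// ltr1n.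
  rewrite -(cvg_lim _ c)//; apply: limr_ge; last by exists k0.+1.
  by apply/cvg_ex; eexists; exact: c.
have coefp n : coef p n = a n.
  apply/eqP; rewrite -subr_eq0; apply/eqP; apply: (lim0 _ n) => k nk.
  have -> : coef p n - a n = coef (fun t => p t - s k t) n.
    rewrite coefB ?coef_tpoly ?(leq_trans nk (hN_ k).1)//; first exact: L2_CL1.
    exact/L2_CL1/sL.
  by apply: nc_cmean_small; [exact: (ps k).1|exact: L2_eitJX|exact: nc_eitJX|exact: (ps k).2|exact: exprn_ge0].
have mom m : cmean (fun t => p t * eit t ^+ m.+1) = 0.
  apply: (lim0 _ 0%N) => k _.
  have -> : cmean (fun t => p t * eit t ^+ m.+1) = cmean (fun t => (p t - s k t) * eit t ^+ m.+1).
    rewrite [RHS](@eq_cmean _ _ (fun t => p t * eit t ^+ m.+1 - s k t * eit t ^+ m.+1)); last first.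
      by move=> t _; rewrite mulrBl.
    by rewrite cmeanB ?moment_tpoly ?subr0//; apply: CL1_mul_eitX; exact: L2_CL1.
  apply: nc_cmean_small; [exact: (ps k).1|exact: L2_eitX|exact: nc_eitX|exact: (ps k).2|exact: exprn_ge0].
have bN N : n2 (fun t => p t - tpoly a N t) = n2 p - S N.
  have := bessel_eq N lp; rewrite (eq_bigr (fun n : 'I_N => nc (a n) ^+ 2)); last by move=> n _; rewrite coefp.
  move=> <-; apply: eq_n2 => t _; congr (_ - _); apply: eq_bigr => n _; by rewrite coefp.
have n2p : n2 p = L.
  apply/eqP; rewrite -subr_eq0; apply/eqP.
  suff : (n2 p - L)%:C = 0 by move=> [].
  apply: (lim0 _ 0%N) => k _; rewrite nc_real.
  have := (ps k).2; rewrite bN => h1; have := n2_ge0 (fun t => p t - s k t); rewrite bN => h3.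
  have h4 := (hN_ k).2; have h5 := SL (N_ k).
  have h6 : (2^-1 ^+ k) ^+ 2 <= 2^-1 ^+ k :> R.
    by rewrite expr2 ler_piMr ?exprn_ge0// exprn_ile1// invf_le1// ler1n.
  by rewrite ler_norml; apply/andP; split; lra.
exists p; split => //; apply: cvg_eq1 bN _; rewrite n2p -(subrr L).
by apply: cvgB; [exact: cvg_cst|exact: cS].
Qed.

End RieszFischer.

                                            

(** * Poisson and Herglotz integrals *)

Section Poisson.
Variable R : realType.
Local Notation C := R[i].
Local Notation D := (@angles R).
Implicit Types (g : R -> R) (p q : R -> C) (z : C).

(** The Poisson kernel; on the circle 1 - z conj w has the same modulus as w - z. *)
Definition pk z (t : R) : R := (1 - nc z ^+ 2) / nc (1 - z * conjc (eit t)) ^+ 2.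
Definition pois g z : R := mean (fun t => pk z t * g t).
Definition cpois p z : C := cmean (fun t => (pk z t)%:C * p t).
(** The Herglotz integral: on the circle 2 / (1 - z conj w) - 1 = (w + z) / (w - z). It is analytic
    with real part [pois g]. *)
Definition herg g z : C := 2 * cauchy (fun t => (g t)%:C) z - (mean g)%:C.

Lemma denom_neq0 z (t : R) : nc z < 1 -> 1 - z * conjc (eit t) != 0.
Proof.
by move=> z1; rewrite -nc_gt0 (lt_le_trans _ (nc_denom_ge z t))// subr_gt0.
Qed.

(** Together with [pk_le] this is Harnack's inequality for the kernel: the modulus of 1 - z conj w
    lies between 1 - |z| and 1 + |z|. *)
Lemma pk_ge z (t : R) : nc z < 1 -> (1 - nc z) / (1 + nc z) <= pk z t.
Proof.
move=> z1; have z0 := nc_ge0 z; have d0 := denom_neq0 t z1.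
have dn : 0 < nc (1 - z * conjc (eit t)) by rewrite nc_gt0.
have du : nc (1 - z * conjc (eit t)) <= 1 + nc z.
  by apply: le_trans (ncB _ _) _; rewrite nc1 nc_mul_eitJ.
rewrite /pk ler_pdivlMr ?exprn_gt0// mulrAC ler_pdivrMr; last lra.
have -> : (1 - nc z ^+ 2) * (1 + nc z) = (1 - nc z) * (1 + nc z) ^+ 2 by ring.
rewrite ler_wpM2l//; first lra.
by rewrite lerXn2r// nnegrE; [exact: ltW|lra].
Qed.

Lemma pk_le z (t : R) : nc z < 1 -> pk z t <= (1 + nc z) / (1 - nc z).
Proof.
move=> z1; have z0 := nc_ge0 z.
have dn : 0 < nc (1 - z * conjc (eit t)) by rewrite nc_gt0 denom_neq0.
have du := nc_denom_ge z t.
rewrite /pk ler_pdivrMr ?exprn_gt0// mulrAC ler_pdivlMr; last lra.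
have -> : (1 - nc z ^+ 2) * (1 - nc z) = (1 + nc z) * (1 - nc z) ^+ 2 by ring.
rewrite ler_wpM2l//; first lra.
by rewrite lerXn2r// nnegrE; [lra|exact: ltW].
Qed.

Lemma harnack_gt0 z : nc z < 1 -> 0 < (1 - nc z) / (1 + nc z).
Proof. by move=> z1; have z0 := nc_ge0 z; rewrite divr_gt0//; lra. Qed.

Lemma pk_gt0 z (t : R) : nc z < 1 -> 0 < pk z t.
Proof. by move=> z1; apply: lt_le_trans (pk_ge t z1); exact: harnack_gt0. Qed.

Lemma pk_ge0 z (t : R) : nc z < 1 -> 0 <= pk z t.
Proof. by move=> /pk_gt0 /ltW. Qed.

Lemma meas_pk z : meas (pk z).
Proof.
apply: measM; first exact: meas_cst.
apply: meas_inv; apply: meas_nc_sq; apply: cmeasB; first exact: cmeas_cst.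
by apply: cmeasM; [exact: cmeas_cst|apply: cmeasJ; exact: cmeas_eit].
Qed.

Lemma L1_pk g z : nc z < 1 -> L1 g -> L1 (fun t => pk z t * g t).
Proof.
move=> z1 lg; apply: L1_le (L1Z ((1 + nc z) / (1 - nc z)) (L1_norm lg)).
  by apply: measM; [exact: meas_pk|exact: L1_meas].
move=> t _; rewrite normrM ler_wpM2r// ger0_norm ?pk_ge0//; exact: pk_le.
Qed.

Lemma pkE z (t : R) : nc z < 1 -> pk z t = Re (2 * (1 - z * conjc (eit t))^-1 - 1).
Proof.
move=> z1; have d0 := denom_neq0 t z1; set x := z * conjc (eit t) in d0 *.
rewrite /pk -/x -(nc_mul_eitJ z t) -/x.
have n0 : nc (1 - x) ^+ 2 != 0 by rewrite expf_neq0// nc_eq0.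
have -> : (1 - x)^-1 = conjc (1 - x) * ((nc (1 - x) ^+ 2)^-1)%:C.
  apply: (mulfI d0); rewrite divff// mulrA mulcJ -rmorphM mulfV//.
apply: (mulIf n0); rewrite divfK// ReB mulrBl.
have -> : Re (2 * (conjc (1 - x) * ((nc (1 - x) ^+ 2)^-1)%:C)) * nc (1 - x) ^+ 2 = 2 * Re (1 - x).
  by move: n0; move: (nc (1 - x) ^+ 2) => y y0; case: (x) => a b /=; field.
by rewrite !nc_sq; case: (x) => a b /=; ring.
Qed.

Lemma pk_complex z (t : R) : nc z < 1 ->
  (pk z t)%:C = (1 - z * conjc (eit t))^-1 + conjc (1 - z * conjc (eit t))^-1 - 1.
Proof.
move=> /pkE ->; move: ((1 - z * conjc (eit t))^-1) => x; case: x => a b.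
by apply: complex_eq => /=; ring.
Qed.

Lemma Re_herg g z : L1 g -> nc z < 1 -> Re (herg g z) = pois g z.
Proof.
move=> lg z1; have lc := CL1_cauchy (CL1_real lg) z1.
have -> : herg g z = cmean (fun t => 2 * ((g t)%:C / (1 - z * conjc (eit t))) - (g t)%:C).
  rewrite cmeanB; [|exact: CL1Z|exact: CL1_real].
  by rewrite cmeanZ// cmean_real.
apply: eq_mean => t _; rewrite pkE//; move: ((1 - z * conjc (eit t))^-1) => x; case: x => a b /=; ring.
Qed.

Lemma analytic_cauchy p : CL1 p -> analytic_disc (cauchy p).
Proof.
by move=> lp; apply/analyticP; exists (coef p) => z /disc_nc z1; exact: cauchy_cvg.
Qed.

Lemma analytic_herg g : L1 g -> analytic_disc (herg g).
Proof.
move=> lg; apply: analyticB; last exact: analytic_cst.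
by apply: analyticZ; apply: analytic_cauchy; exact: CL1_real.
Qed.

Lemma coef_cst (c : C) n : coef (fun=> c) n = if n == 0%N then c else 0.
Proof.
have := @coef_tpoly R (fun=> c) 1 n; rewrite ltnS leqn0 => <-.
by apply: eq_cmean => t _; rewrite /tpoly big_ord1 expr0 mulr1.
Qed.

Lemma cauchy_moments p z : CL1 p -> nc z < 1 -> (forall n, coef p n.+1 = 0) ->
  cauchy p z = cmean p.
Proof.
move=> lp z1 h; apply: cvgC_uniq (cauchy_cvg lp z1) _.
apply: cvg_near_cst; exists 1%N => // -[//|N] _ /=.
rewrite /psum big_ord_recl big1 ?addr0; last by move=> i _; rewrite h mul0r.
by rewrite expr0 mulr1; apply: eq_cmean => t _; rewrite mulr1.
Qed.

Lemma pois_cst c z : nc z < 1 -> pois (fun=> c) z = c.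
Proof.
move=> z1; rewrite -Re_herg//; last exact: L1_cst.
rewrite /herg mean_cst cauchy_moments//.
- by rewrite cmean_cst /=; ring.
- exact: CL1_cst.
- by move=> n; exact: coef_cst.
Qed.

Lemma poisD f g z : nc z < 1 -> L1 f -> L1 g -> pois (fun t => f t + g t) z = pois f z + pois g z.
Proof.
move=> z1 lf lg; rewrite /pois -meanD; [|exact: L1_pk|exact: L1_pk].
by apply: eq_mean => t _; rewrite mulrDr.
Qed.

Lemma poisZ c g z : nc z < 1 -> L1 g -> pois (fun t => c * g t) z = c * pois g z.
Proof.
move=> z1 lg; rewrite /pois -meanZ; last exact: L1_pk.
by apply: eq_mean => t _; rewrite mulrCA.
Qed.

Lemma poisB f g z : nc z < 1 -> L1 f -> L1 g -> pois (fun t => f t - g t) z = pois f z - pois g z.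
Proof.
move=> z1 lf lg; rewrite /pois -meanB; [|exact: L1_pk|exact: L1_pk].
by apply: eq_mean => t _; rewrite mulrBr.
Qed.

Lemma le_pois f g z : nc z < 1 -> L1 f -> L1 g -> (forall t, D t -> f t <= g t) -> pois f z <= pois g z.
Proof.
move=> z1 lf lg fg; apply: le_mean; [exact: L1_pk|exact: L1_pk|].
by move=> t Dt; rewrite ler_wpM2l ?fg// pk_ge0.
Qed.

Lemma pois_ge0 g z : nc z < 1 -> (forall t, D t -> 0 <= g t) -> 0 <= pois g z.
Proof. by move=> z1 g0; apply: mean_ge0 => t Dt; rewrite mulr_ge0 ?g0// pk_ge0. Qed.

Lemma pois_le_mean g z : nc z < 1 -> L1 g -> (forall t, D t -> 0 <= g t) ->
  pois g z <= (1 + nc z) / (1 - nc z) * mean g.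
Proof.
move=> z1 lg g0; rewrite -meanZ//; apply: le_mean; [exact: L1_pk|exact: L1Z|].
by move=> t Dt; rewrite ler_wpM2r ?g0// pk_le.
Qed.

Lemma mean_le_pois g z : nc z < 1 -> L1 g -> (forall t, D t -> 0 <= g t) ->
  (1 - nc z) / (1 + nc z) * mean g <= pois g z.
Proof.
move=> z1 lg g0; rewrite -meanZ//; apply: le_mean; [exact: L1Z|exact: L1_pk|].
by move=> t Dt; rewrite ler_wpM2r ?g0// pk_ge.
Qed.

Lemma pois_ae f g z : aeD (fun t => f t = g t) -> pois f z = pois g z.
Proof. by move=> fg; apply: mean_ae; apply: aeDS fg => t _ ->. Qed.

Lemma norm_pois_le g z : nc z < 1 -> L1 g -> `|pois g z| <= pois (fun t => `|g t|) z.
Proof.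
move=> z1 lg; apply: le_trans (ler_norm_mean (L1_pk z1 lg)) _.
by apply: le_mean; [apply: L1_norm; exact: L1_pk|apply: L1_pk => //; exact: L1_norm|move=> t _; rewrite normrM (ger0_norm (pk_ge0 t z1))].
Qed.

Lemma CL1_pk p z : nc z < 1 -> CL1 p -> CL1 (fun t => (pk z t)%:C * p t).
Proof.
move=> z1 lp; apply: (CL1M (M := (1 + nc z) / (1 - nc z))) => //; first by apply: cmeas_real; exact: meas_pk.
by move=> t _; rewrite nc_real ger0_norm ?pk_ge0// pk_le.
Qed.

Lemma nc_cpois_le p z : nc z < 1 -> CL1 p -> nc (cpois p z) <= pois (fun t => nc (p t)) z.
Proof.
move=> z1 lp; apply: le_trans (nc_cmean (CL1_pk z1 lp)) _.
apply: le_mean; [exact/L1_nc/CL1_pk|by apply: L1_pk => //; exact: L1_nc|].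
by move=> t _; rewrite ncM nc_real ger0_norm ?pk_ge0.
Qed.

Lemma cpois_ReIm p z : cpois p z = Complex (pois (fun t => Re (p t)) z) (pois (fun t => Im (p t)) z).
Proof.
by apply: complex_eq => /=; apply: eq_mean => t _; rewrite ?ReM ?ImM /= mul0r ?subr0 ?addr0.
Qed.

                                                                             
                                                                               
(** The Poisson kernel is the Cauchy kernel plus its conjugate minus 1. Against a function without
    negative frequencies the conjugate kernel yields only the mean, which the -1 cancels. *)
Lemma cpois_cauchy p z : CL1 p -> nc z < 1 ->
  (forall m, cmean (fun t => p t * eit t ^+ m.+1) = 0) -> cpois p z = cauchy p z.
Proof.
move=> lp z1 hm.
have lJ := CL1J lp.
have cJ : cmean (fun t => p t * conjc (1 - z * conjc (eit t))^-1) = cmean p.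
  rewrite -[RHS]conjcK -cmeanJ// -(cauchy_moments lJ z1); last first.
    move=> n; rewrite /coef -[RHS]conjc0 -(hm n) -cmeanJ; last exact: CL1_mul_eitX.
    by apply: eq_cmean => t _; rewrite conjcM conjcX.
  rewrite -cmeanJ; last exact: CL1_cauchy.
  by apply: eq_cmean => t _; rewrite conjcM conjcK.
have l1 := CL1_cauchy lp z1.
have l2 : CL1 (fun t => p t * conjc (1 - z * conjc (eit t))^-1).
  by apply: CL1_eq (CL1J (CL1_cauchy lJ z1)) => t _; rewrite conjcM conjcK.
rewrite -[RHS]addr0 -(subrr (cmean p)) -{1}cJ addrA -cmeanD// -cmeanB//; last exact: CL1D.
by apply: eq_cmean => t _; rewrite pk_complex//; ring.
Qed.

End Poisson.

(** * Estimates of the Poisson kernel near and far from a point *)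

Section KernelEstimates.
Variable R : realType.
Local Notation C := R[i].
Local Notation D := (@angles R).
Local Hint Resolve measurable_angles : core.
Implicit Types (g : R -> R) (p q : R -> C) (z : C) (a r t s d h eta eps : R).

Lemma denom_polar r a t :
  nc (1 - r%:C * eit a * conjc (eit t)) ^+ 2 = (1 - r) ^+ 2 + 2 * r * (1 - cos (t - a)).
Proof.
rewrite nc_sq !eitE cosB /=.
have c1 := cos2Dsin2 a; have c2 := cos2Dsin2 t.
have -> : (1 - r) ^+ 2 + 2 * r * (1 - (cos t * cos a + sin t * sin a)) =
  1 - 2 * r * (cos t * cos a + sin t * sin a) + r ^+ 2 * ((cos a ^+ 2 + sin a ^+ 2) * (cos t ^+ 2 + sin t ^+ 2)).
  by rewrite c1 c2; ring.
ring.
Qed.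

Lemma cos_le_cos s t : 0 <= s -> s <= t -> t <= pi -> cos t <= cos s.
Proof. by move=> s0 st tp; rewrite leNgt ltr_cos ?in_itv/= -?leNgt//; apply/andP; split; lra. Qed.

(** Since [a] is interior, angles far from [a] in [0, 2 pi] are also far from it modulo 2 pi; hence
    the minimum with [a] and 2 pi - a in the proof. *)
Lemma cos_far a d : 0 < a < 2 * pi -> 0 < d ->
  exists2 c, 0 < c & forall t, D t -> d <= `|t - a| -> c <= 1 - cos (t - a).
Proof.
move=> /andP[a0 a2] d0; have p0 := pi_gt0 R.
have [m1 [m0 md ma m2 mpi]] : exists m : R, [/\ 0 < m, m <= d, m <= a, m <= 2 * pi - a & m <= pi].
  exists (Num.min d (Num.min a (2 * pi - a))); split.
  - by rewrite !lt_min d0 a0 subr_gt0.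
  - by rewrite ge_min lexx.
  - by rewrite !ge_min lexx orbT.
  - by rewrite !ge_min lexx !orbT.
  - have [h|h] := leP a pi; rewrite !ge_min; first by rewrite h orbT.
    apply/orP; right; apply/orP; right; lra.
have e2 := eit_2pi R; move: e2; rewrite eitE => -[c2 s2].
have key s : m1 <= s -> s <= 2 * pi - m1 -> cos s <= cos m1.
  move=> h1 h2; have [sp|sp] := leP s pi.
    by apply: cos_le_cos => //; exact: ltW.
  have -> : cos s = cos (2 * pi - s) by rewrite cosB c2 s2; ring.
  by apply: cos_le_cos; lra.
exists (1 - cos m1).
  by rewrite subr_gt0 -cos0 ltr_cos// in_itv/=; apply/andP; split; lra.
move=> t; rewrite /angles/= in_itv/= => /andP[t0 t2] dt.
have cn : cos `|t - a| = cos (t - a) by case: ger0P => _; rewrite ?cosN.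
have := key `|t - a|; rewrite cn => /(_ (le_trans md dt)) h.
rewrite lerD2l lerN2; apply: h.
by rewrite ler_norml; apply/andP; split; lra.
Qed.

(** From 1 - cos s = 2 sin(s/2)^2 and sin x / x >= 1/2 near 0. *)
Lemma cos_near : exists2 d : R, 0 < d & forall s, `|s| < d -> s ^+ 2 / 8 <= 1 - cos s.
Proof.
have [dh hd] : is_derive (0 : R) 1 (@sin R) (cos 0) by exact: is_derive_sin.
have : t^-1 *: ((@sin R \o shift (0 : R)) (t *: (1 : R)) - sin 0) @[t --> (0 : R)^'] --> (1 : R).
  by rewrite -[X in _ --> X]cos0 -hd; exact: dh.
move=> /cvgrPdist_lt /(_ (2^-1)) []; first by rewrite invr_gt0.
move=> d /= d0 hd'; exists d => // s sd.
have [->|s0] := eqVneq s 0; first by rewrite cos0 subrr expr0n mul0r.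
have h0 : s / 2 != 0 by rewrite mulf_neq0// invr_eq0 pnatr_eq0.
have hs : `|s / 2| < d.
  rewrite normrM normfV (@ger0_norm _ 2)//; apply: le_lt_trans sd.
  by rewrite ler_pdivrMr// ler_peMr// ler1n.
have := hd' (s / 2); rewrite /ball_/= sub0r normrN => /(_ hs h0).
rewrite /shift/= addr0 sin0 subr0 /GRing.scale/= mulr1 => H.
have q1 : 2^-1 <= (s / 2)^-1 * sin (s / 2).
  by move: H; rewrite ltr_norml => /andP[]; lra.
have q2 : (2^-1) ^+ 2 <= ((s / 2)^-1 * sin (s / 2)) ^+ 2.
  by rewrite lerXn2r// nnegrE ?invr_ge0//; apply: le_trans q1; rewrite invr_ge0.
have cE : cos s = 1 - 2 * sin (s / 2) ^+ 2.
  by rewrite {1}(splitr s) cosD -!expr2; have := cos2Dsin2 (s / 2); lra.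
rewrite cE; move: q2; rewrite exprMn !exprVn.
have s2 : 0 < (s / 2) ^+ 2 by rewrite exprn_even_gt0.
rewrite ler_pdivlMl//; set y := sin _ ^+ 2 => q2.
have : (s / 2) ^+ 2 / 2 ^+ 2 = s ^+ 2 / 16 by field.
by lra.
Qed.

Lemma L1M (k : R -> R) (M : R) g : meas k -> (forall t, D t -> `|k t| <= M) -> L1 g ->
  L1 (fun t => k t * g t).
Proof.
move=> mk kM lg; apply: L1_le (L1Z M (L1_norm lg)); first by apply: measM => //; exact: L1_meas.
by move=> t Dt; rewrite normrM ler_wpM2r// kM.
Qed.

Definition near_ind a (h t : R) : R := \1_(ball a h : set R) t.

Lemma near_indE a h t : near_ind a h t = (`|t - a| < h)%R%:R.
Proof.
rewrite /near_ind indicE; congr (_ %:R); congr nat_of_bool.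
apply/idP/idP; rewrite inE /ball/= distrC//.
Qed.

Lemma meas_near_ind a h : meas (near_ind a h).
Proof. by apply: meas_indic; exact: measurable_ball. Qed.

Lemma near_ind_bound a h t : `|near_ind a h t| <= 1.
Proof. exact: norm_indic_le1. Qed.

Lemma near_ind_ge0 a h t : 0 <= near_ind a h t.
Proof. exact: indic_ge0. Qed.

(** Model of the Poisson kernel at (1 - eta) exp(i a): for eta at most 1/2 and t near a, the
    denominator of the kernel is at least the one used here. *)
Definition bump eta a t : R := eta / (eta ^+ 2 + (t - a) ^+ 2 / 8).

Lemma bump_denom eta a t : 0 < eta -> 0 < eta ^+ 2 + (t - a) ^+ 2 / 8.
Proof. by move=> e0; rewrite ltr_pwDl ?exprn_gt0// divr_ge0// sqr_ge0. Qed.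

Lemma bump_ge0 eta a t : 0 < eta -> 0 <= bump eta a t.
Proof. by move=> e0; rewrite divr_ge0 ?ltW// bump_denom. Qed.

Lemma bump_le eta a t : 0 < eta -> bump eta a t <= eta^-1.
Proof.
move=> e0; rewrite ler_pdivrMr ?bump_denom// mulrDr expr2 mulKf ?gt_eqF// lerDl.
by rewrite mulr_ge0 ?invr_ge0 ?(ltW e0)// divr_ge0// sqr_ge0.
Qed.

Lemma bump_far eta a h t : 0 < eta -> 0 < h -> h <= `|t - a| -> bump eta a t <= 8 * eta / h ^+ 2.
Proof.
move=> e0 h0 ht; rewrite ler_pdivrMr ?bump_denom// mulrAC ler_pdivlMr ?exprn_gt0//.
have h2 : h ^+ 2 <= (t - a) ^+ 2.
  by rewrite -[X in _ <= X]real_normK ?num_real// lerXn2r ?nnegrE// ltW.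
have -> : 8 * eta * (eta ^+ 2 + (t - a) ^+ 2 / 8) = eta * (8 * eta ^+ 2 + (t - a) ^+ 2) by field.
rewrite ler_wpM2l ?(ltW e0)//; have := sqr_ge0 eta; lra.
Qed.

Lemma meas_bump eta a : 0 < eta -> meas (bump eta a).
Proof.
move=> e0; apply: measM; first exact: meas_cst.
apply: meas_inv; apply: measD; first exact: meas_cst.
apply: measM; last exact: meas_cst.
apply: meas_sq; apply: meas_continuous => x; apply: cvgB; [exact: cvg_id|exact: cvg_cst].
Qed.

                                                                  
(** Dyadic decomposition. On the core |t - a| < eta the kernel is at most 1/eta, which costs [eps].
    On the ring 2^n eta <= |t - a| < 2^(n+1) eta it is at most 8 / (4^n eta), while [g] contributes
    at most 2^(n+1) eta eps, which costs 16 eps 2^-n. The total is at most 33 eps. *)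
Lemma mean_bump_le g a eps d eta : L1 g -> (forall t, D t -> 0 <= g t) -> 0 <= eps -> 0 < d ->
  (forall h, 0 < h -> h <= d -> mean (fun t => near_ind a h t * g t) <= eps * h) -> 0 < eta ->
  mean (fun t => near_ind a d t * (bump eta a t * g t)) <= 33 * eps.
Proof.
move=> lg g0 e0 d0 hA et0.
have lK : L1 (fun t => bump eta a t * g t).
  apply: (L1M (M := eta^-1)) lg; first exact: meas_bump.
  by move=> t _; rewrite ger0_norm ?bump_ge0// bump_le.
have lI h (f : R -> R) : L1 f -> L1 (fun t => near_ind a h t * f t).
  by move=> lf; apply: (L1M (M := 1)) lf; [exact: meas_near_ind|move=> t _; exact: near_ind_bound].
(* Radii are capped at [d], beyond which nothing is assumed about [g]. *)
pose b n := Num.min (2 ^+ n * eta) d.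
have hb n : 0 < 2 ^+ n * eta :> R by rewrite mulr_gt0// exprn_gt0.
have b0 n : 0 < b n by rewrite lt_min hb d0.
have bd n : b n <= d by rewrite ge_min lexx orbT.
have claim n : mean (fun t => near_ind a (b n) t * (bump eta a t * g t)) <= eps * (1 + 32 * (1 - 2^-1 ^+ n)).
  elim: n => [|n ih].
    have -> : eps * (1 + 32 * (1 - 2^-1 ^+ 0)) = eps by rewrite expr0; ring.
    apply: (@le_trans _ _ (eta^-1 * mean (fun t => near_ind a (b 0%N) t * g t))).
      rewrite -meanZ; last exact: lI.
      apply: le_mean; [exact: lI|by apply: L1Z; exact: lI|move=> t Dt].
      rewrite [X in _ <= X]mulrCA ler_wpM2l ?near_ind_ge0// ler_wpM2r ?g0// bump_le//.
    rewrite ler_pdivrMl// (le_trans (hA _ (b0 0%N) (bd 0%N)))// mulrC ler_wpM2r//.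
    by rewrite ge_min expr0 mul1r lexx.
  have q2 : 0 <= 2^-1 ^+ n :> R by rewrite exprn_ge0// invr_ge0.
  have qS : 2^-1 ^+ n.+1 = 2^-1 ^+ n / 2 :> R by rewrite exprSr.
  have [dh|dh] := leP d (2 ^+ n * eta).
    have -> : b n.+1 = b n.
      rewrite /b !min_r//; apply: le_trans dh _.
      by rewrite exprS -mulrA ler_peMl// ?ler1n// ltW.
    apply: le_trans ih _; rewrite ler_wpM2l//; lra.
  have bn : b n = 2 ^+ n * eta by rewrite /b min_l// ltW.
  have bS : b n.+1 <= 2 * (2 ^+ n * eta) by rewrite ge_min exprS mulrA lexx.
  have lS := lI (b n.+1) _ lg.
  apply: (@le_trans _ _ (mean (fun t => near_ind a (b n) t * (bump eta a t * g t)) +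
      8 * eta / (2 ^+ n * eta) ^+ 2 * mean (fun t => near_ind a (b n.+1) t * g t))).
    rewrite -meanZ// -meanD; [|exact: lI|exact: L1Z].
    apply: le_mean; [exact: lI|by apply: L1D; [exact: lI|exact: L1Z]|move=> t Dt].
    rewrite !near_indE; have gt := g0 t Dt; have kt := bump_ge0 a t et0.
    have k8 : 0 <= 8 * eta / (2 ^+ n * eta) ^+ 2.
      by rewrite divr_ge0 ?exprn_ge0 ?mulr_ge0 ?exprn_ge0 ?(ltW et0).
    have [l1|l1] := ltP `|t - a| (b n.+1); last by rewrite !mul0r mulr0 addr0 mulr_ge0// mulr_ge0.
    have [l2|l2] := ltP `|t - a| (b n); first by rewrite !mul1r lerDl mulr_ge0.
    rewrite mul1r mul0r add0r mul1r ler_wpM2r//; apply: bump_far => //.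
    by rewrite -bn.
  apply: (@le_trans _ _ (eps * (1 + 32 * (1 - 2^-1 ^+ n)) + 8 * eta / (2 ^+ n * eta) ^+ 2 * (eps * (2 * (2 ^+ n * eta))))).
    rewrite lerD// ler_wpM2l//.
      by rewrite divr_ge0 ?exprn_ge0 ?mulr_ge0 ?exprn_ge0 ?(ltW et0).
    by apply: le_trans (hA _ (b0 _) (bd _)) _; rewrite ler_wpM2l.
  have -> : 8 * eta / (2 ^+ n * eta) ^+ 2 * (eps * (2 * (2 ^+ n * eta))) = 16 * eps * 2^-1 ^+ n.
    have p2 : 2 ^+ n != 0 :> R by rewrite expf_neq0// pnatr_eq0.
    have en0 : eta != 0 by rewrite gt_eqF.
    by rewrite exprVn; move: p2; move: (2 ^+ n) => y y0; field; rewrite ?en0 ?y0.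
  by rewrite qS -subr_ge0 le_eqVlt; apply/orP; left; apply/eqP; field.
have [n hn] : exists n, d <= 2 ^+ n * eta.
  have [n hn] : exists n : nat, d / eta <= n%:R.
    by exists (Num.bound (d / eta)); apply: ltW; apply: archi_boundP; rewrite divr_ge0 ?ltW.
  exists n; rewrite -ler_pdivrMr//; apply: le_trans hn _.
  by rewrite -natrX ler_nat ltnW// ltn_expl.
have := claim n; rewrite /b min_r// => /le_trans; apply.
have : 0 <= eps * 2^-1 ^+ n by rewrite mulr_ge0// exprn_ge0// invr_ge0.
lra.
Qed.

End KernelEstimates.

(** * Fatou's theorem on radial limits *)

Section FatouTheorem.
Variable R : realType.
Local Notation C := R[i].
Local Notation mu := (@lebesgue_measure R).
Local Notation D := (@angles R).
Local Hint Resolve measurable_angles : core.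
Implicit Types (g : R -> R) (p q : R -> C) (z : C) (a r t s d h eta eps : R).

Lemma ball_angles a h : h <= a -> a <= 2 * pi - h -> ball a h `<=` D.
Proof.
move=> ha h2 t; rewrite /ball/= ltr_norml => /andP[t1 t2].
by rewrite /angles/= in_itv/=; apply/andP; split; lra.
Qed.

Lemma lebesgue_pt_mean g a eps : 0 < a < 2 * pi -> L1 g -> lebesgue_pt (g \_ D) a -> 0 < eps ->
  exists2 d : R, 0 < d & forall h, 0 < h -> h <= d ->
    mean (fun t => near_ind a h t * `|g t - g a|) <= eps * h.
Proof.
move=> /andP[a0 a2] lg lp e0.
have := lp (fun x => (x < eps%:E)%E).
move=> []; first by apply: open_nbhs_nbhs; split; [exact: open_ereal_lt_ereal|rewrite /= lte_fin].
move=> d /= d0 hd.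
pose d1 := Num.min (d / 2) (Num.min a (2 * pi - a)).
have d10 : 0 < d1 by rewrite !lt_min divr_gt0// a0 subr_gt0.
exists d1 => // h h0; rewrite !le_min => /and3P[hh ha h2].
have ballD : ball a h `<=` D by apply: ball_angles => //; lra.
have := hd h; rewrite /ball_/= sub0r normrN gtr0_norm// => /(_ _ h0) H.
have {}H : (davg (g \_ D) a h < eps%:E)%E by apply: H; lra.
have lga : L1 (fun t => `|g t - g a|) by apply: L1_norm; apply: L1B => //; exact: L1_cst.
have lI : L1 (fun t => near_ind a h t * `|g t - g a|).
  by apply: (L1M (M := 1)) lga => [|t _]; [exact: meas_near_ind|exact: near_ind_bound].
have aD : D a by apply: ballD; exact: ballxx.
have E : (\int[mu]_(t in ball a h) `|((center ((g \_ D) a) \o g \_ D) t)%:E| = (2 * pi * mean (fun t => near_ind a h t * `|g t - g a|))%:E)%E.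
  rewrite -integral_mean// -(setIidr ballD) integral_mkcondr; apply: eq_integral => t.
  rewrite inE => Dt; rewrite /patch near_indE.
  have bE : ball a h t = (`|t - a| < h) :> Prop by rewrite /ball/= distrC.
  case: ifPn => [/set_mem|/negP nb]; rewrite ?bE.
    by move=> ->; rewrite mul1r /shift/= !mem_set.
  rewrite (_ : (`|t - a| < h) = false) ?mul0r//; apply/negP => tb; apply: nb.
  by apply/mem_set; rewrite bE.
move: H; rewrite /davg /iavg E (_ : (lebesgue_measure (ball a h) = (h *+ 2)%:E)%E); last first.
  by apply: lebesgue_measure_ball; exact: ltW.
have h20 : 0 < h *+ 2 by rewrite mulrn_wgt0.
rewrite inver (gt_eqF h20) -EFinM lte_fin ltr_pdivrMl// => H.
(* The Lebesgue average divides by 2h and [mean] by 2 pi; as 2 pi >= 2, the bound [eps * h]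
   results. *)
have p2 := @pi_ge2 R; set m := mean _ in H *.
have m0 : 0 <= m by apply: mean_ge0 => t _; rewrite mulr_ge0// near_ind_ge0.
have : 2 * 1 * m <= 2 * pi * m by rewrite ler_wpM2r// ler_wpM2l//; lra.
by rewrite -mulr_natl in H; lra.
Qed.

(** At an interior Lebesgue point [a], split the Poisson integral of |g - g a|. Near [a] the kernel
    is at most twice [bump], so [mean_bump_le] applies; away from [a] the kernel tends to 0
    uniformly. *)
Lemma fatou_radial g : L1 g -> aeD (fun a => (fun r => pois g (r%:C * eit a)) @ (1 : R)^'- --> g a).
Proof.
move=> lg.
have leb := lebesgue_differentiation (integrable_locally_restrict (@measurable_angles R) lg).
have h0 : aeD (fun a => 0 < a < 2 * pi).
  have n1 (x : R) : aeD (fun a => a != x).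
    apply: aeDS (null_aeD (measurable_set1 x) (lebesgue_measure_set1 x)) => a _ ax.
    by apply/eqP.
  apply: aeDS2 (n1 0) (n1 (2 * pi)) => a; rewrite /angles/= in_itv/= => /andP[a1 a2] a3 a4.
  by rewrite !lt_neqAle a1 a2 eq_sym a3 a4.
have leb' : aeD (fun a => lebesgue_pt (g \_ D) a).
  by apply: negligibleS leb => a /=; apply: contra_not.
apply: aeDS2 h0 leb' => a Da a02 lp.
apply/cvgrPdist_le => /= e e0.
(* The near part will cost 2 times 33 [eps] and the far part one more. *)
have e67 : 0 < e / 100 by rewrite divr_gt0.
set eps := e / 100 in e67.
have [d1 d10 hd1] := lebesgue_pt_mean a02 lg lp e67.
have [d2 d20 hd2] := cos_near R.
pose d := Num.min d1 d2.
have d0 : 0 < d by rewrite lt_min d10.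
have [c c0 hc] := cos_far a02 d0.
pose psi t := `|g t - g a|.
have lpsi : L1 psi by apply: L1_norm; apply: L1B => //; exact: L1_cst.
have psi0 t : 0 <= psi t by exact: normr_ge0.
have hb eta : 0 < eta -> mean (fun t => near_ind a d t * (bump eta a t * psi t)) <= 33 * eps.
  move=> et0; apply: (mean_bump_le lpsi (fun t _ => psi0 t) (ltW e67) d0) => //.
  by move=> h h0 hd; apply: hd1 => //; apply: le_trans hd _; rewrite ge_min lexx.
have m0 : 0 <= mean psi by exact: mean_ge0.
(* Beyond 1/2 the comparison with [bump] holds; the second bound makes the far part at most
   [eps]. *)
pose rho := Num.max 2^-1 (1 - c * eps / (2 * (mean psi + 1))).
have rho1 : rho < 1.
  rewrite gt_max invf_lt1// ltr1n/= ltrBlDr ltrDl divr_gt0 ?mulr_gt0//; lra.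
have near1 : \forall r \near (1 : R)^'-, rho < r by exact: nbhs_left_gt.
have near2 : \forall r \near (1 : R)^'-, r < 1 by exact: nbhs_left_lt.
apply: filterS2 near1 near2 => r; rewrite gt_max => /andP[r12 rc] r1.
have r0 : 0 <= r by apply: le_trans (ltW r12); rewrite invr_ge0.
set z := r%:C * eit a.
have nz : nc z = r by exact: nc_scale.
have z1 : nc z < 1 by rewrite nz.
pose eta := 1 - r; have et0 : 0 < eta by rewrite subr_gt0.
have r2 : 1 <= 2 * r by move: r12; rewrite -div1r ltr_pdivrMr// => /ltW; lra.
have pkn t : `|t - a| < d -> pk z t <= 2 * bump eta a t.
  move=> ta; rewrite /pk denom_polar nz.
  have s8 : (t - a) ^+ 2 / 8 <= 1 - cos (t - a).
    by apply: hd2; apply: lt_le_trans ta _; rewrite ge_min lexx orbT.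
  have b0 := bump_denom a t et0.
  have s0 : 0 <= (t - a) ^+ 2 / 8 by rewrite divr_ge0// sqr_ge0.
  have den : eta ^+ 2 + (t - a) ^+ 2 / 8 <= (1 - r) ^+ 2 + 2 * r * (1 - cos (t - a)).
    rewrite lerD2l; apply: le_trans s8 _; rewrite ler_peMl//; exact: le_trans s0 s8.
  rewrite /bump mulrA ler_pM ?invr_ge0 ?(ltW (lt_le_trans b0 den))//.
  - by rewrite subr_ge0 exprn_ile1// ltW.
  - have -> : 1 - r ^+ 2 = (1 - r) * (1 + r) by ring.
    by rewrite mulrC ler_wpM2r ?(ltW et0)//; lra.
  - by rewrite lef_pV2// posrE// (lt_le_trans b0 den).
have pkf t : D t -> d <= `|t - a| -> pk z t <= 2 * eta / c.
  move=> Dt ta; rewrite /pk denom_polar nz.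
  have c1 := hc t Dt ta.
  have den : c <= (1 - r) ^+ 2 + 2 * r * (1 - cos (t - a)).
    apply: le_trans c1 _; rewrite ler_wpDl ?sqr_ge0// ler_peMl//; lra.
  rewrite ler_pM ?invr_ge0 ?(ltW (lt_le_trans c0 den))//.
  - by rewrite subr_ge0 exprn_ile1// ltW.
  - have -> : 1 - r ^+ 2 = (1 - r) * (1 + r) by ring.
    by rewrite mulrC ler_wpM2r ?(ltW et0)//; lra.
  - by rewrite lef_pV2// posrE// (lt_le_trans c0 den).
have -> : g a - pois g z = - pois (fun t => g t - g a) z.
  by rewrite poisB ?pois_cst ?opprB//; exact: L1_cst.
rewrite normrN; apply: le_trans (norm_pois_le z1 (L1B lg (L1_cst (g a)))) _.
have lb : L1 (fun t => near_ind a d t * (bump eta a t * psi t)).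
  apply: (L1M (M := 1)) => [|t _|]; [exact: meas_near_ind|exact: near_ind_bound|].
  apply: (L1M (M := eta^-1)) lpsi => [|t _]; first exact: meas_bump.
  by rewrite ger0_norm ?bump_ge0// bump_le.
apply: (@le_trans _ _ (2 * mean (fun t => near_ind a d t * (bump eta a t * psi t)) + 2 * eta / c * mean psi)).
  rewrite -!meanZ// -meanD; [|exact: L1Z|exact: L1Z].
  apply: le_mean; [exact: L1_pk|by apply: L1D; exact: L1Z|move=> t Dt].
  rewrite -/(psi t) near_indE; have [ta|ta] := ltP `|t - a| d.
    rewrite mul1r mulrA; apply: le_trans (_ : 2 * bump eta a t * psi t <= _).
      by rewrite ler_wpM2r// pkn.
    by rewrite lerDl mulr_ge0// divr_ge0 ?(ltW c0)// mulr_ge0// ltW.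
  by rewrite mul0r mulr0 add0r ler_wpM2r// pkf.
have := hb eta et0.
have : 2 * eta / c * mean psi <= eps.
  rewrite mulrAC ler_pdivrMr//.
  have : 1 - r <= c * eps / (2 * (mean psi + 1)) by lra.
  rewrite ler_pdivlMr; last by rewrite mulr_gt0//; lra.
  have : eta * mean psi <= eta * (mean psi + 1) by rewrite ler_wpM2l ?(ltW et0)//; lra.
  by rewrite /eta => h1 h2; lra.
by rewrite /eps; lra.
Qed.

Lemma fatou_radialC p : CL1 p -> aeD (fun a => (fun r => cpois p (r%:C * eit a)) @ (1 : R)^'- --> p a).
Proof.
move=> [l1 l2]; apply: aeDS2 (fatou_radial l1) (fatou_radial l2) => a _ h1 h2.
by apply: cvgC_ReIm; under eq_fun do rewrite cpois_ReIm.
Qed.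

End FatouTheorem.

                                              

(** * Boundary functions of H^2 *)

Section Boundary.
Variable R : realType.
Local Notation C := R[i].
Local Notation mu := (@lebesgue_measure R).
Local Notation D := (@angles R).
Implicit Types (p q : R -> C) (a : nat -> C) (f g : C -> C) (z : C) (r t : R).

Definition radial f p : Prop := aeD (fun t => (fun r => f (r%:C * eit t)) @ (1 : R)^'- --> p t).

Lemma near_left1 : \forall r \near (1 : R)^'-, 0 <= r < 1.
Proof.
have h1 : \forall r \near (1 : R)^'-, 0 < r by exact: nbhs_left_gt.
have h2 : \forall r \near (1 : R)^'-, r < 1 by exact: nbhs_left_lt.
by apply: filterS2 h1 h2 => r /ltW -> ->.
Qed.

Lemma cvg_eq_near (T : Type) (F : set_system T) (FF : Filter F) (f g : T -> C) (x : C) :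
  (\forall t \near F, f t = g t) -> g @ F --> x -> f @ F --> x.
Proof.
move=> fg gx; apply: cvg_trans gx.
by apply: near_eq_cvg; apply: filterS fg => t ->.
Qed.

Lemma radial_eq f g p : (forall z, disc z -> f z = g z) -> radial f p -> radial g p.
Proof.
move=> fg; apply: aeDS => t _; apply: cvg_eq_near.
by apply: filterS near_left1 => r r01; rewrite fg//; exact: disc_scale.
Qed.

Lemma radial_ae f p q : aeD (fun t => p t = q t) -> radial f p -> radial f q.
Proof. by move=> pq; rewrite /radial; apply: aeDS2 pq => t _ ->. Qed.

Lemma radial_uniq f p q : radial f p -> radial f q -> aeD (fun t => p t = q t).
Proof. by rewrite /radial; apply: aeDS2 => t _; exact: cvgC_uniq. Qed.

Lemma radialM f g p q : radial f p -> radial g q -> radial (fun z => f z * g z) (fun t => p t * q t).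
Proof. by rewrite /radial; apply: aeDS2 => t _ h1 h2; exact: (cvgM h1 h2). Qed.

Lemma radial_bv f p : radial f p -> aeD (fun t => bv f (eit t) = p t).
Proof. by apply: aeDS => t _ h; apply: cvg_lim => //; exact: norm_hausdorff. Qed.

Lemma integral_hardy f r : L2 (fun t => f (r%:C * eit t)) ->
  (\int[mu]_(t in D) (complex.Re `|f (r%:C * eit t)| ^+ 2)%:E)%E =
  (2 * pi * n2 (fun t => f (r%:C * eit t)))%:E.
Proof. by move=> l2; rewrite /n2 -integral_mean//; exact: l2.2. Qed.

Lemma L2_circle f r : analytic_disc f -> 0 <= r < 1 -> L2 (fun t => f (r%:C * eit t)).
Proof.
move=> /analyticP[a af] r01; have [B hB] := pseries_bounded af r01.
apply: (@L2_bounded _ _ B); first exact: cmeas_circle af r01.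
by move=> t _; apply: (hB _ _).1; rewrite nc_scale//; case/andP: r01.
Qed.

Lemma hardy2I f (M : R) : analytic_disc f ->
  (forall r, 0 <= r < 1 -> n2 (fun t => f (r%:C * eit t)) <= M) -> hardy2 f.
Proof.
move=> af fM; split=> //; exists (2 * pi * M) => r r01.
by rewrite integral_hardy ?lee_fin ?ler_wpM2l ?fM ?(ltW (@twopi_gt0 R))//; exact: L2_circle.
Qed.

Lemma hardy2E f : hardy2 f -> analytic_disc f /\ exists M, forall r, 0 <= r < 1 -> n2 (fun t => f (r%:C * eit t)) <= M.
Proof.
move=> [af [M hM]]; split=> //; exists ((2 * pi)^-1 * M) => r r01.
rewrite ler_pdivlMl ?twopi_gt0// -lee_fin -integral_hardy ?hM//; exact: L2_circle.
Qed.

Lemma hardy2_eq f g : (forall z, disc z -> f z = g z) -> hardy2 f -> hardy2 g.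
Proof.
move=> fg /hardy2E[af [M hM]]; apply: (@hardy2I _ M); first exact: analytic_eq af.
move=> r r01; rewrite -(@eq_n2 _ (fun t => f (r%:C * eit t))) ?hM// => t _.
by rewrite fg//; exact: disc_scale.
Qed.

Lemma hardy2_bounded f (M : R) : analytic_disc f -> (forall z, disc z -> nc (f z) <= M) -> hardy2 f.
Proof.
move=> af fM; apply: (@hardy2I _ (M ^+ 2)) => // r r01.
have M0 : 0 <= M by apply: le_trans (nc_ge0 _) (fM (r%:C * eit 0) (disc_scale _ r01)).
rewrite -[M ^+ 2](@mean_cst R); apply: le_mean; [exact: (L2_circle af r01).2|exact: L1_cst|].
by move=> t _; rewrite lerXn2r ?nnegrE ?nc_ge0// fM//; exact: disc_scale.
Qed.

Lemma cvg_bigsum (T : Type) (F : set_system T) (FF : Filter F) (N : nat) (u : nat -> T -> R) (l : nat -> R) :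
  (forall n, u n @ F --> l n) -> (fun x => \sum_(n < N) u n x) @ F --> \sum_(n < N) l n.
Proof.
move=> h; elim: N => [|N ih].
  rewrite big_ord0; apply: (@cvg_eq1 _ _ _ _ (fun=> 0)) => [x|]; last exact: cvg_cst.
  by rewrite big_ord0.
rewrite big_ord_recr/=; apply: cvg_eq1 (cvgD ih (h N)) => x.
by rewrite big_ord_recr.
Qed.

Lemma hardy2_coef_le a f (M : R) : pseries a f ->
  (forall r, 0 <= r < 1 -> n2 (fun t => f (r%:C * eit t)) <= M) ->
  forall N, \sum_(n < N) nc (a n) ^+ 2 <= M.
Proof.
move=> af fM N; have an : analytic_disc f by apply/analyticP; exists a.
have c : (fun r => \sum_(n < N) nc (a n) ^+ 2 * r ^+ (n * 2)) @ (1 : R)^'- --> \sum_(n < N) nc (a n) ^+ 2.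
  apply: (@cvg_bigsum _ _ _ N (fun n r => nc (a n) ^+ 2 * r ^+ (n * 2)) (fun n => nc (a n) ^+ 2)) => n.
  rewrite -[X in _ --> X]mulr1 -{2}(expr1n R (n * 2)); apply: cvgMr.
  by apply: cvg_at_left_filter; exact: exprn_continuous.
rewrite -(cvg_lim _ c)//; apply: limr_le; first by apply/cvg_ex; eexists; exact: c.
apply: filterS near_left1 => r r01; have [r0 r1] := andP r01.
apply: le_trans (fM r r01); apply: le_trans (bessel N (L2_circle an r01)).
rewrite le_eqVlt; apply/orP; left; apply/eqP; apply: eq_bigr => n _.
by rewrite (coef_circle n af r01) ncM ncX nc_real ger0_norm// exprMn exprM.
Qed.

                                                                              
                                                                            
(** Disc side and circle side of an H^2 function kept together. The function [p] of the angle is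
    Borel, whereas [bv f] has junk values and is only almost everywhere equal to [p]. *)
Definition boundary f p := [/\ L2 p, forall m, cmean (fun t => p t * eit t ^+ m.+1) = 0,
  radial f p & forall z, disc z -> f z = cauchy p z].

(** For such [p] the Cauchy integral is a Poisson integral, so Fatou's theorem supplies the radial
    limits. *)
Lemma boundary_cauchy p : L2 p -> (forall m, cmean (fun t => p t * eit t ^+ m.+1) = 0) ->
  boundary (cauchy p) p.
Proof.
move=> lp hm; split=> //; apply: aeDS (fatou_radialC (L2_CL1 lp)) => t _.
apply: cvg_eq_near; apply: filterS near_left1 => r r01.
rewrite cpois_cauchy//; first exact: L2_CL1.
by apply/disc_nc; exact: disc_scale.
Qed.

Lemma pseries_cauchy p : CL1 p -> pseries (coef p) (cauchy p).
Proof. by move=> lp z /disc_nc z1; exact: cauchy_cvg. Qed.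

Lemma hardy2_cauchy p : L2 p -> hardy2 (cauchy p).
Proof.
move=> lp; have pc := pseries_cauchy (L2_CL1 lp).
have an : analytic_disc (cauchy p) by exact/analytic_cauchy/L2_CL1.
apply: (@hardy2I _ (n2 p)) => // r r01; have [r0 r1] := andP r01.
have [||||||] // := mean_fatou (g_ := fun N t => nc (tpoly (fun n => coef p n * r%:C ^+ n) N t) ^+ 2)
  (g := fun t => nc (cauchy p (r%:C * eit t)) ^+ 2) (B := n2 p).
- by move=> N; exact: (L2_tpoly _ _).2.
- by move=> N t _; exact: sqr_ge0.
- move=> N; rewrite -/(n2 _) n2_tpoly; apply: le_trans (bessel N lp).
  apply: ler_sum => n _; rewrite ncM ncX nc_real ger0_norm// exprMn ler_piMr ?sqr_ge0//.
  by rewrite -exprM exprn_ile1// ltW.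
- exact: meas_nc_sq (L2_circle an r01).1.
- by move=> t _; exact: sqr_ge0.
- apply: aeDW => t _; apply: cvg_sqr; apply: cvg_nc.
  apply: cvg_eq1 (pc _ (disc_scale t r01)) => N.
  by rewrite psum_tpoly.
Qed.

Lemma boundary_hardy2 f p : boundary f p -> hardy2 f.
Proof.
move=> [lp _ _ fE]; apply: hardy2_eq (hardy2_cauchy lp) => z dz.
by rewrite fE.
Qed.

Lemma pseries_boundary f p : boundary f p -> pseries (coef p) f.
Proof.
by move=> [lp _ _ fE] z dz; rewrite fE//; apply: pseries_cauchy => //; exact: L2_CL1.
Qed.

(** The Taylor coefficients are square summable, and Riesz-Fischer turns them into a function on the
    circle whose Cauchy integral is [f]. *)
Lemma hardy2_boundary f : hardy2 f -> exists p, boundary f p.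
Proof.
move=> /hardy2E[/analyticP[a af] [M hM]].
have [p [lp cp mp _]] := riesz_fischer (hardy2_coef_le af hM).
have fE z : disc z -> f z = cauchy p z.
  move=> dz; apply: cvgC_uniq (af z dz) _.
  apply: cvg_eq1 (pseries_cauchy (L2_CL1 lp) dz) => N.
  by apply: eq_bigr => n _; rewrite cp.
exists p; have [_ _ rp _] := boundary_cauchy lp mp; split=> //.
by apply: radial_eq rp => z dz; rewrite fE.
Qed.

(** [riesz_fischer] gives the convergence for a function [q] of its own making; [p] and [q] are
    radial limits of the same Cauchy integral, so they agree almost everywhere. *)
Lemma boundary_tpoly f p : boundary f p -> (fun N => n2 (fun t => p t - tpoly (coef p) N t)) @ \oo --> (0 : R).
Proof.
move=> [lp mp _ _]; have [q [lq cq mq cv]] := riesz_fischer (fun N => bessel N lp).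
have [_ _ r1 _] := boundary_cauchy lp mp.
have [_ _ r2 _] := boundary_cauchy lq mq.
have r3 : radial (cauchy p) q.
  apply: radial_eq r2 => z dz; apply: cvgC_uniq (pseries_cauchy (L2_CL1 lq) dz) _.
  apply: cvg_eq1 (pseries_cauchy (L2_CL1 lp) dz) => N.
  by apply: eq_bigr => n _; rewrite cq.
apply: cvg_eq1 cv => N; apply: n2_ae; apply: aeDS (radial_uniq r1 r3) => t _ ->.
by [].
Qed.

Lemma boundary_eq f g p : (forall z, disc z -> f z = g z) -> boundary f p -> boundary g p.
Proof.
move=> fg [lp mp rp fE]; split=> //; first exact: radial_eq rp.
by move=> z dz; rewrite -fg ?fE.
Qed.

Lemma boundary_cpois f p z : boundary f p -> disc z -> f z = cpois p z.
Proof.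
move=> [lp mp rp fE] dz; rewrite fE// cpois_cauchy//; first exact: L2_CL1.
exact/disc_nc.
Qed.

Lemma boundary_inj f g p q : boundary f p -> boundary g q -> aeD (fun t => p t = q t) ->
  forall z, disc z -> f z = g z.
Proof.
move=> bf bg pq z dz; rewrite (boundary_cpois bf dz) (boundary_cpois bg dz).
by apply: cmean_ae; apply: aeDS pq => t _ ->.
Qed.

(** Maximum principle: [f] is an average of [p] against the Poisson kernel. *)
Lemma boundary_le f p (M : R) : boundary f p -> aeD (fun t => nc (p t) <= M) ->
  forall z, disc z -> nc (f z) <= M.
Proof.
move=> bf pM z dz; rewrite (boundary_cpois bf dz); have [lp _ _ _] := bf.
have z1 : nc z < 1 by exact/disc_nc.
apply: le_trans (nc_cpois_le z1 (L2_CL1 lp)) _.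
(* Capping at [M] makes the almost everywhere bound hold at every point, as [le_pois] requires. *)
rewrite (@pois_ae _ _ (fun t => Num.min (nc (p t)) M)); last first.
  by apply: aeDS pM => t _ h; rewrite min_l.
have lm : L1 (fun t => Num.min (nc (p t)) M).
  apply: L1_le (L1D (L1_nc (L2_CL1 lp)) (L1_cst `|M|)).
    by apply: measurable_minr; [exact: meas_nc lp.1|exact: meas_cst].
  move=> t _; have h3 := nc_ge0 (p t); have h1 := ler_norm M.
  have h2 : - M <= `|M| by rewrite -normrN ler_norm.
  by rewrite /= ler_norml /Num.min; case: ltP => h4; apply/andP; split; lra.
rewrite -[M in X in _ <= X](pois_cst M z1); apply: le_pois => //; first exact: L1_cst.
by move=> t _; rewrite ge_min lexx orbT.
Qed.

                                                                
(** The product is in general only integrable. Approximating [q] in [L2] by its Fourier polynomials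
    reduces the claim to the moments of [p]. *)
Lemma moment_mul g p q m : L2 p -> (forall m, cmean (fun t => p t * eit t ^+ m.+1) = 0) ->
  boundary g q -> cmean (fun t => p t * q t * eit t ^+ m.+1) = 0.
Proof.
move=> lp mp bq; have [lq _ _ _] := bq.
have cv := boundary_tpoly bq; pose s N := tpoly (coef q) N.
have lpe : L2 (fun t => p t * eit t ^+ m.+1).
  apply: L2_eq (L2M (M := 1) (cmeas_eitX _ m.+1) _ lp) => t _; first by rewrite mulrC.
  by rewrite nc_eitX.
have z0 N : cmean (fun t => p t * eit t ^+ m.+1 * s N t) = 0.
  have -> : cmean (fun t => p t * eit t ^+ m.+1 * s N t) =
      cmean (fun t => \sum_(n < N) coef q n * (p t * eit t ^+ (n + m).+1)).
    apply: eq_cmean => t _; rewrite mulr_sumr; apply: eq_bigr => n _.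
    by rewrite -addnS exprD; ring.
  rewrite cmean_sum; last by move=> n; apply/CL1Z/CL1_mul_eitX/L2_CL1.
  rewrite big1// => n _; rewrite cmeanZ ?mp ?mulr0//; exact/CL1_mul_eitX/L2_CL1.
set X := cmean _.
have XE N : X = cmean (fun t => p t * eit t ^+ m.+1 * (q t - s N t)).
  rewrite -[X]subr0 -(z0 N) /X (@eq_cmean _ _ (fun t => p t * eit t ^+ m.+1 * q t)); last by move=> t _; ring.
  rewrite -cmeanB; [|exact: CL1_mul|by apply: CL1_mul => //; exact: L2_tpoly].
  by apply: eq_cmean => t _; ring.
have hX N : nc X ^+ 2 <= n2 (fun t => p t * eit t ^+ m.+1) * n2 (fun t => q t - s N t).
  by rewrite (XE N); apply: cauchy_schwarz => //; apply: L2B => //; exact: L2_tpoly.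
apply: (nc_sqr_cvg0 hX); rewrite -[X in _ --> X](mulr0 (n2 (fun t => p t * eit t ^+ m.+1))).
by apply: cvgMr; exact: cv.
Qed.

End Boundary.

                                

(** * Outer functions and integrability of log|f| *)

Section Factorization.
Variable R : realType.
Local Notation C := R[i].
Local Notation mu := (@lebesgue_measure R).
Local Notation D := (@angles R).
Implicit Types (g k : R -> R) (p q : R -> C) (a : nat -> C) (f : C -> C) (z : C) (r t : R).

Lemma L1_ae (f g : R -> R) : meas f -> aeD (fun t => f t = g t) -> L1 g -> L1 f.
Proof.
move=> mf fg /integrableP[_ lg]; apply/integrableP; split; first exact/measurable_EFinP.
rewrite (@integral_ae_nonmeasurable _ _ _ mu D _ (fun t => `|(g t)%:E|%E))//.
by apply: aeDS fg => t _ /= ->.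
Qed.

Lemma cauchyB p q z : CL1 p -> CL1 q -> nc z < 1 -> cauchy (fun t => p t - q t) z = cauchy p z - cauchy q z.
Proof.
move=> lp lq z1; rewrite -cmeanB; [|exact: CL1_cauchy|exact: CL1_cauchy].
by apply: eq_cmean => t _; rewrite mulrBl.
Qed.

Lemma hergB g k z : L1 g -> L1 k -> nc z < 1 -> herg (fun t => g t - k t) z = herg g z - herg k z.
Proof.
move=> lg lk z1; rewrite /herg meanB// rmorphB/=.
rewrite (_ : cauchy (fun t => (g t - k t)%:C) z = cauchy (fun t => (g t)%:C) z - cauchy (fun t => (k t)%:C) z).
  by ring.
rewrite -cauchyB//; [|exact: CL1_real..].
by apply: eq_cmean => t _; rewrite rmorphB.
Qed.

Lemma cvg_herg (g_ : nat -> R -> R) g (h : R -> R) z : nc z < 1 ->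
  (forall n, meas (g_ n)) -> meas g -> aeD (fun t => g_ ^~ t @ \oo --> g t) -> L1 h ->
  aeD (fun t => forall n, `|g_ n t| <= h t) -> (fun n => herg (g_ n) z) @ \oo --> herg g z.
Proof.
move=> z1 mg_ mg cg lh gh; rewrite /herg.
have c1 : (fun n => cauchy (fun t => (g_ n t)%:C) z) @ \oo --> cauchy (fun t => (g t)%:C) z.
  have [] // := cmean_dct (p_ := fun n t => (g_ n t)%:C / (1 - z * conjc (eit t)))
    (p := fun t => (g t)%:C / (1 - z * conjc (eit t))) (g := fun t => (1 - nc z)^-1 * h t).
  - by move=> n; apply: cmeasM; [exact: cmeas_real|exact: cmeas_denomV].
  - by apply: cmeasM; [exact: cmeas_real|exact: cmeas_denomV].
  - apply: aeDS cg => t _ c; apply: cvgMl; apply: cvgC_ReIm => //; exact: cvg_cst.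
  - exact: L1Z.
  - apply: aeDS gh => t _ H n; rewrite ncM mulrC ler_pM ?nc_ge0 ?nc_denomV_le//.
    by rewrite nc_real.
have [_ c] := mean_dct mg_ mg cg lh gh.
have c2 : (fun n => (mean (g_ n))%:C) @ \oo --> (mean g)%:C.
  by apply: cvgC_ReIm => //; exact: cvg_cst.
exact: (cvgB (cvgMr (a := 2) c1) c2).
Qed.

Lemma nc_cexp_herg k z : L1 k -> nc z < 1 -> nc (cexp (herg k z)) = expR (pois k z).
Proof. by move=> lk z1; rewrite nc_cexp Re_herg. Qed.

Definition bounded_disc f := exists M : R, forall z, disc z -> nc (f z) <= M.

                                                                      
(** The form in which outerness is used: [f] can be multiplied towards 1 by bounded analytic
    functions while staying in the unit ball. Unlike the exponential formula, it is visibly stable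
    under products and under composition with an inner function. *)
Definition quasi_invertible f := exists e : nat -> C -> C,
  [/\ forall n, analytic_disc (e n), forall n, bounded_disc (e n),
      forall n z, disc z -> nc (e n z * f z) <= 1 &
      forall z, disc z -> (fun n => e n z * f z) @ \oo --> (1 : C)].

(** Truncate [k] below at -n to get [kn n], and let e_n be the inverse of the outer function of
    [kn n]; it is bounded by e^n. The product e_n f is [cexp] of the Herglotz integral of k - kn n,
    which is nonpositive and tends to 0 with [|k|] as a dominating function. *)
Lemma cexp_herg_quasi_invertible (c : C) k : nc c = 1 -> L1 k ->
  quasi_invertible (fun z => c * cexp (herg k z)).
Proof.
move=> c1 lk; have c0 : c != 0 by rewrite -nc_gt0 c1.
pose kn n t := Num.max (k t) (- n%:R).
have lkn n : L1 (kn n).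
  apply: L1_le (L1D (L1_norm lk) (L1_cst n%:R)).
    by apply: measurable_maxr; [exact: L1_meas|exact: meas_cst].
  move=> t _; have h1 := ler_norm (k t); have h2 : - k t <= `|k t| by rewrite -normrN ler_norm.
  have h3 : 0 <= n%:R :> R by exact: ler0n.
  by rewrite /= ler_norml /kn /Num.max; case: ltP => h4; apply/andP; split; lra.
have efE n z : disc z -> c^-1 * cexp (- herg (kn n) z) * (c * cexp (herg k z)) = cexp (herg (fun t => k t - kn n t) z).
  move=> /disc_nc z1; rewrite hergB// cexpD mulrACA mulVf// mul1r; exact: mulrC.
exists (fun n z => c^-1 * cexp (- herg (kn n) z)); split.
- by move=> n; apply: analyticZ; apply: analytic_cexp; apply: analyticN; exact: analytic_herg.
- move=> n; exists (expR n%:R) => z /disc_nc z1.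
  rewrite ncM ncV c1 invr1 mul1r nc_cexp ReN Re_herg// ler_expR lerNl.
  rewrite -(pois_cst (- n%:R) z1); apply: le_pois => //; first exact: L1_cst.
  by move=> t _; rewrite le_max lexx orbT.
- move=> n z dz; have z1 := (disc_nc z).1 dz.
  rewrite efE// nc_cexp_herg//; last exact: L1B.
  rewrite -expR0 ler_expR -(pois_cst 0 z1); apply: le_pois => //; [exact: L1B|exact: L1_cst|].
  by move=> t _; rewrite subr_le0 le_max lexx.
- move=> z dz; have z1 := (disc_nc z).1 dz.
  apply: cvg_eq1 (fun n => efE n z dz) _; rewrite -cexp0; apply: cvg_cexp.
  have -> : 0 = herg (fun=> 0) z.
    rewrite /herg /cauchy mean_cst (@eq_cmean _ _ (fun=> 0)) ?cmean_cst ?mulr0 ?subr0// => t _.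
    by rewrite mul0r.
  apply: (cvg_herg (h := fun t => `|k t|)) => //.
  + by move=> n; exact: L1_meas (L1B lk (lkn n)).
  + exact: meas_cst.
  + apply: aeDW => t _; apply: cvg_near_cst.
    exists (Num.bound `|k t|) => // n /= hn; rewrite /kn max_l ?subrr//.
    have h : `|k t| < (Num.bound `|k t|)%:R by apply: archi_boundP.
    have hn' : (Num.bound `|k t|)%:R <= n%:R :> R by rewrite ler_nat.
    have : - k t <= `|k t| by rewrite -normrN ler_norm.
    lra.
  + exact: L1_norm.
  + apply: aeDW => t _ n; rewrite /kn /Num.max; case: ltP => h; last by rewrite subrr normr0.
    have h3 : 0 <= n%:R :> R by exact: ler0n.
    have k0 : k t < 0 by lra.
    by rewrite ltr0_norm ?(ltr0_norm k0); lra.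
Qed.

(** On the circle (w + z) / (w - z) = 2 / (1 - z conj w) - 1, so an outer function is a unimodular
    constant times [cexp] of a Herglotz integral. *)
Lemma outer_quasi_invertible f : outer_function f -> quasi_invertible f.
Proof.
move=> [c [k [c1 lk fE]]].
have c1' : nc c = 1 by apply: (@complexI R); rewrite -normcE c1.
have [e [e1 e2 e3 e4]] := cexp_herg_quasi_invertible c1' lk.
have E z : disc z -> f z = c * cexp (herg (fun t => k (eit t)) z).
  move=> dz; rewrite fE//; congr (_ * cexp _).
  have z1 := (disc_nc z).1 dz.
  have lc := CL1_cauchy (CL1_real lk) z1.
  rewrite /herg -cmean_real -cmeanZ// -cmeanB; [|exact: CL1Z|exact: CL1_real].
  apply: eq_cmean => t _; have e0 := eit_neq0 t.
  have d0 := denom_neq0 t z1.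
  have ez : eit t - z = eit t * (1 - z * conjc (eit t)).
    by rewrite mulrBr mulr1 mulrCA eitJ mulr1.
  have ez2 : eit t + z = eit t * (2 - (1 - z * conjc (eit t))).
    by transitivity (eit t + z * (eit t * conjc (eit t))); [rewrite eitJ mulr1|ring].
  by rewrite ez ez2; field; rewrite e0 d0.
exists e; split=> // [n z dz|z dz]; first by rewrite E// e3.
by apply: cvg_eq1 (e4 z dz) => n; rewrite E.
Qed.

Lemma hardy2M_bounded f (g : C -> C) : hardy2 f -> analytic_disc g -> bounded_disc g -> hardy2 (fun z => g z * f z).
Proof.
move=> /hardy2E[af [M hM]] ag [B gB]; apply: (@hardy2I _ _ (B ^+ 2 * M)); first exact: analyticM.
move=> r r01; apply: le_trans (_ : B ^+ 2 * n2 (fun t => f (r%:C * eit t)) <= _); last first.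
  by rewrite ler_wpM2l ?sqr_ge0 ?hM.
have lf := L2_circle af r01.
rewrite /n2 -meanZ; last exact: lf.2.
apply: le_mean; [exact: (L2_circle (analyticM ag af) r01).2|exact/L1Z/lf.2|].
move=> t _; rewrite ncM exprMn ler_wpM2r ?sqr_ge0//.
have h := gB _ (disc_scale t r01); rewrite lerXn2r ?nnegrE ?nc_ge0//.
exact: le_trans (nc_ge0 _) h.
Qed.

Section Log.
Variables (f : C -> C) (p : R -> C).
Hypothesis bf : boundary f p.

Let eps (n : nat) : R := n.+1%:R^-1.
(** log|p| cut off below at log(1/(n+1)), so as to be integrable before log|p| is known to be. *)
Let v n t := ln (Num.max (nc (p t)) (eps n)).

Let eps_gt0 n : 0 < eps n. Proof. by rewrite invr_gt0. Qed.
Let eps_le1 n : eps n <= 1. Proof. by rewrite invf_le1// ler1n. Qed.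
Let max_gt0 n t : 0 < Num.max (nc (p t)) (eps n).
Proof. by rewrite lt_max eps_gt0 orbT. Qed.

Let v_ge n t : ln (eps n) <= v n t.
Proof. by rewrite ler_ln ?posrE// le_max lexx orbT. Qed.

Let v_le n t : v n t <= nc (p t).
Proof.
apply: le_trans (_ : ln (1 + nc (p t)) <= _).
  rewrite ler_ln ?posrE//; last by rewrite ltr_pwDl ?nc_ge0.
  by rewrite ge_max lerDr ler01/= (le_trans (eps_le1 n))// lerDl nc_ge0.
by apply: le_ln1Dx; rewrite (lt_le_trans _ (nc_ge0 _))// ltrN10.
Qed.

Let meas_v n : meas (v n).
Proof.
apply: (@meas_comp _ (@ln R)); first exact: measurable_ln.
apply: measurable_maxr; last exact: meas_cst.
by apply: meas_nc; case: bf => -[].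
Qed.

Let L1_v n : L1 (v n).
Proof.
have [lp _ _ _] := bf.
apply: L1_le (L1D (L1_nc (L2_CL1 lp)) (L1_cst `|ln (eps n)|)) => // t _.
have h1 := v_ge n t; have h2 := v_le n t; have h3 := nc_ge0 (p t).
have h4 : - ln (eps n) <= `|ln (eps n)| by rewrite -normrN ler_norm.
have h5 : 0 <= `|ln (eps n)| by [].
by rewrite /= ler_norml; apply/andP; split; lra.
Qed.

(** Dividing [f] by [cexp] of the Herglotz integral of [v n] gives an H^2 function with boundary
    modulus |p| / max(|p|, eps n), at most 1; then apply the maximum principle. *)
Let bound_v n z : disc z -> nc (f z) <= expR (pois (v n) z).
Proof.
move=> dz.
pose E z := cexp (- herg (v n) z).
have aE : analytic_disc E by apply: analytic_cexp; apply: analyticN; exact: analytic_herg.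
have ncE w : disc w -> nc (E w) = expR (- pois (v n) w).
  by move=> /disc_nc w1; rewrite nc_cexp ReN Re_herg.
have bE : bounded_disc E.
  exists (expR (- ln (eps n))) => w dw; rewrite ncE// ler_expR lerN2.
  have w1 := (disc_nc w).1 dw.
  by rewrite -(pois_cst (ln (eps n)) w1); apply: le_pois => //; exact: L1_cst.
have hf := boundary_hardy2 bf.
have [q bq] := hardy2_boundary (hardy2M_bounded hf aE bE).
have [_ _ rf _] := bf; have [_ _ rq _] := bq.
have q1 : aeD (fun t => nc (q t) <= 1).
  apply: aeDS2 (aeD_and rf rq) (fatou_radial (L1_v n)) => t _ [h1 h2] h3.
  have c1 : (fun r => nc (E (r%:C * eit t) * f (r%:C * eit t))) @ (1 : R)^'- --> nc (q t) by exact: (cvg_nc h2).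
  have c2 : (fun r => expR (- pois (v n) (r%:C * eit t)) * nc (f (r%:C * eit t))) @ (1 : R)^'- --> expR (- v n t) * nc (p t).
    have d2 : (fun r => nc (f (r%:C * eit t))) @ (1 : R)^'- --> nc (p t) by exact: (cvg_nc h1).
    have d1 : (fun r => expR (- pois (v n) (r%:C * eit t))) @ (1 : R)^'- --> expR (- v n t).
      exact: (cvg_comp _ _ (cvgN h3) (@continuous_expR R _)).
    exact: (cvgM d1 d2).
  have c3 : (fun r => nc (E (r%:C * eit t) * f (r%:C * eit t))) @ (1 : R)^'- --> expR (- v n t) * nc (p t).
    apply: cvg_trans c2; apply: near_eq_cvg; apply: filterS (near_left1 R) => r r01.
    by rewrite ncM ncE//; exact: disc_scale.
  rewrite (cvg_unique _ c1 c3)//.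
  by rewrite expRN lnK ?posrE// mulrC ler_pdivrMr// mul1r le_max lexx.
have := boundary_le bq q1 dz; rewrite ncM ncE// expRN mulrC ler_pdivrMr ?expR_gt0// mul1r.
by [].
Qed.

Hypothesis f0 : nonzero_disc f.

Let k t := ln (nc (p t)).

(** At a point where [f] is nonzero, [bound_v] and Harnack's inequality bound the means of the
    increasing functions v 0 - v n, so these have an integrable limit. Where [p] vanishes they equal
    ln(n+1), which is unbounded; so [p] is nonzero almost everywhere. The pointwise bound is the
    limit of [bound_v]. *)
Lemma log_integrable : [/\ aeD (fun t => p t != 0), L1 k &
  forall z, disc z -> nc (f z) <= expR (pois k z)].
Proof.
have [z0 dz0 fz0] := f0; have z1 := (disc_nc z0).1 dz0.
have [lp _ _ _] := bf.
pose H := (1 - nc z0) / (1 + nc z0); have H0 : 0 < H by exact: harnack_gt0.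
have vmono n m t : (n <= m)%N -> v m t <= v n t.
  move=> nm; rewrite ler_ln ?posrE// ge_max !le_max lexx/=; apply/orP; right.
  by rewrite lef_pV2 ?posrE// ler_nat ltnS.
pose g_ n t := v 0%N t - v n t.
have lg n : L1 (g_ n) by exact: L1B.
have g0 n t : D t -> 0 <= g_ n t by rewrite subr_ge0 vmono.
pose K := H^-1 * (pois (v 0%N) z0 - ln (nc (f z0))).
have gK n : mean (g_ n) <= K.
  rewrite /K ler_pdivlMl//; apply: le_trans (mean_le_pois z1 (lg n) (g0 n)) _.
  rewrite poisB// lerD2l lerN2 -ler_expR lnK ?posrE ?nc_gt0//.
  exact: bound_v.
have gmono t : D t -> {homo g_ ^~ t : n m / (n <= m)%N >-> n <= m}.
  by move=> _ n m nm; rewrite /g_ lerD2l lerN2 vmono.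
have [h [lh _ ch]] := mean_monotone lg g0 gmono gK.
have p0 : aeD (fun t => p t != 0).
  apply: aeDS ch => t _ ct; apply/negP => /eqP pt0.
  have [B hB] : has_ubound (range (g_ ^~ t)).
    by apply/bounded_fun_has_ubound/cvg_seq_bounded/cvg_ex; eexists; exact: ct.
  have gE n : g_ n t = ln n.+1%:R.
    rewrite /g_ /v pt0 nc0 !max_r ?(ltW (eps_gt0 _))// /eps invr1 ln1 sub0r lnV ?posrE// opprK//.
  have := hB (g_ (Num.bound (expR B)) t); rewrite gE => /(_ _)H1.
  have : ln (Num.bound (expR B)).+1%:R <= B by apply: H1; exists (Num.bound (expR B)) => //; rewrite gE.
  rewrite -ler_expR lnK ?posrE//.
  have : expR B < (Num.bound (expR B))%:R.
    by have := archi_boundP (expR_ge0 B).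
  by rewrite -natr1; lra.
have cv : aeD (fun t => (v ^~ t) @ \oo --> k t).
  apply: aeDS p0 => t _ pt; apply: cvg_near_cst.
  have n0 : 0 < nc (p t) by rewrite nc_gt0.
  exists (Num.bound (nc (p t))^-1) => // n /= hn; rewrite /v max_l//.
  rewrite /eps -[X in _ <= X]invrK lef_pV2 ?posrE ?invr_gt0//.
  have h1 : (nc (p t))^-1 < (Num.bound (nc (p t))^-1)%:R by apply: archi_boundP; rewrite invr_ge0 ltW.
  have h2 : (Num.bound (nc (p t))^-1)%:R <= n.+1%:R :> R by rewrite ler_nat (leq_trans hn).
  by apply: le_trans h2; exact: ltW.
have mk : meas k.
  by apply: (@meas_comp _ (@ln R)); [exact: measurable_ln|exact: meas_nc lp.1].
have lk : L1 k.
  apply: (L1_ae mk (g := fun t => v 0%N t - h t)); last exact: L1B.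
  apply: aeDS2 cv ch => t _ c1 c2.
  have c3 : g_ ^~ t @ \oo --> v 0%N t - k t by apply: cvgB; [exact: cvg_cst|exact: c1].
  by rewrite -(cvg_unique _ c3 c2)//; ring.
split=> // z dz; have zz := (disc_nc z).1 dz.
have [_ c] : L1 (fun t => pk z t * k t) /\ (fun n => mean (fun t => pk z t * v n t)) @ \oo --> mean (fun t => pk z t * k t).
  apply: (mean_dct (g := fun t => pk z t * (`|k t| + `|v 0%N t|))) => //.
  - by move=> n; apply: measM => //; exact: meas_pk.
  - by apply: measM => //; exact: meas_pk.
  - by apply: aeDS cv => t _ ct; apply: cvgMr.
  - by apply: L1_pk => //; apply: L1D; exact: L1_norm.
  - apply: aeDS p0 => t _ pt n; rewrite normrM (ger0_norm (pk_ge0 t zz)) ler_wpM2l ?pk_ge0//.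
    have h1 := vmono 0%N n t (leq0n n).
    have h2 : k t <= v n t by rewrite ler_ln ?posrE ?nc_gt0// le_max lexx.
    have h3 : - k t <= `|k t| by rewrite -normrN ler_norm.
    have h4 : v 0%N t <= `|v 0%N t| by exact: ler_norm.
    have h5 : 0 <= `|k t| by []. have h6 : 0 <= `|v 0%N t| by [].
    by rewrite ler_norml; apply/andP; split; lra.
have c' : (fun n => expR (pois (v n) z)) @ \oo --> expR (pois k z).
  exact: (cvg_comp _ _ c (@continuous_expR R _)).
rewrite -(cvg_lim _ c')//; apply: limr_ge; first by apply/cvg_ex; eexists; exact: c'.
by apply: nearW => n; exact: bound_v.
Qed.

End Log.

End Factorization.

(** * Inner-outer factorization *)

Section InnerOuter.
Variable R : realType.
Local Notation C := R[i].
Implicit Types (g k : R -> R) (p q : R -> C) (a : nat -> C) (f : C -> C) (z : C) (r t : R).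

Lemma cvg_psum0 a : (fun N => psum a N 0) @ \oo --> a 0%N.
Proof.
apply: cvg_near_cst; exists 1%N => // -[//|N] _; rewrite /psum big_ord_recl expr0 mulr1 big1 ?addr0//.
by move=> i _; rewrite exprS mul0r mulr0.
Qed.

Lemma cmean_circle f r : analytic_disc f -> 0 <= r < 1 -> cmean (fun t => f (r%:C * eit t)) = f 0.
Proof.
move=> /analyticP[a af] r01; have := coef_circle 0 af r01; rewrite expr0 mulr1 => h.
rewrite (@eq_cmean _ _ (fun t => f (r%:C * eit t) * conjc (eit t) ^+ 0)); last by move=> t _; rewrite expr0 mulr1.
rewrite -/(coef _ 0) h; apply: cvgC_uniq (@cvg_psum0 a) _.
by apply: af; apply/disc_nc; rewrite nc0.
Qed.

Lemma pois0 g : pois g 0 = mean g.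
Proof.
apply: eq_mean => t _; rewrite /pk nc0 mul0r subr0 nc1 expr1n expr0n subr0 divr1.
exact: mul1r.
Qed.

(** Jensen's inequality: the exponential lies above its tangent line at [A]. *)
Lemma expR_pois_le k z : nc z < 1 -> L1 k -> L1 (fun t => expR (k t)) ->
  expR (pois k z) <= pois (fun t => expR (k t)) z.
Proof.
move=> z1 lk le; set A := pois k z.
have lk1 : L1 (fun t => (1 - A) + k t) by apply: L1D => //; exact: L1_cst.
have -> : expR A = pois (fun t => expR A * ((1 - A) + k t)) z.
  by rewrite poisZ// poisD ?pois_cst//; [rewrite -/A subrK mulr1|exact: L1_cst].
apply: le_pois => //; first exact: L1Z.
move=> t _; have -> : k t = A + (k t - A) by ring.
by rewrite expRD ler_wpM2l ?expR_ge0//; apply: le_trans (expR_ge1Dx _); lra.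
Qed.

(** The outer factor is [cexp] of the Herglotz integral of k = log|p|. The quotient is bounded by 1
    by [log_integrable], and its boundary modulus is |p| exp(-k) = 1. Jensen's inequality puts the
    outer factor in H^2. *)
Lemma inner_outer f : hardy2 f -> nonzero_disc f ->
  exists I O ι, [/\ boundary I ι, aeD (fun t => nc (ι t) = 1), hardy2 O,
    quasi_invertible O & forall z, disc z -> f z = I z * O z].
Proof.
move=> hf f0; have [p bp] := hardy2_boundary hf.
have [p0 lk fk] := log_integrable bp f0.
set k := fun t => ln (nc (p t)) in lk fk.
have [lp _ rp _] := bp.
have af : analytic_disc f by exact: hf.1.
pose O z := cexp (herg k z); pose I : C -> C := fun z => f z * cexp (- herg k z).
have aO : analytic_disc O by apply: analytic_cexp; exact: analytic_herg.
have aI : analytic_disc I.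
  by apply: (analyticM af); apply: analytic_cexp; apply: analyticN; exact: analytic_herg.
have ncI z : disc z -> nc (I z) = nc (f z) * expR (- pois k z).
  by move=> /disc_nc z1; rewrite ncM nc_cexp ReN Re_herg.
have I1 z : disc z -> nc (I z) <= 1.
  by move=> dz; rewrite ncI// expRN ler_pdivrMr ?expR_gt0// mul1r fk.
have [ι bι] := hardy2_boundary (hardy2_bounded aI I1).
have [_ _ rι _] := bι.
exists I, O, ι; split=> //.
- apply: aeDS2 (aeD_and rp rι) (aeD_and p0 (fatou_radial lk)) => t _ [h1 h2] [pt h3].
  have c1 : (fun r => nc (I (r%:C * eit t))) @ (1 : R)^'- --> nc (ι t) by exact: (cvg_nc h2).
  have d1 : (fun r => nc (f (r%:C * eit t))) @ (1 : R)^'- --> nc (p t) by exact: (cvg_nc h1).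
  have d2 : (fun r => expR (- pois k (r%:C * eit t))) @ (1 : R)^'- --> expR (- k t).
    exact: (cvg_comp _ _ (cvgN h3) (@continuous_expR R _)).
  have c3 : (fun r => nc (I (r%:C * eit t))) @ (1 : R)^'- --> nc (p t) * expR (- k t).
    apply: cvg_trans (cvgM d1 d2); apply: near_eq_cvg; apply: filterS (near_left1 R) => r r01.
    by rewrite ncI//; exact: disc_scale.
  rewrite (cvg_unique _ c1 c3)//.
  by rewrite expRN lnK ?posrE ?nc_gt0// mulfV// nc_eq0.
- have le2 : L1 (fun t => expR (2 * k t)).
    apply: (L1_ae _ _ lp.2).
      apply: (@meas_comp _ (@expR R)); first exact: measurable_expR.
      by apply: measM; [exact: meas_cst|exact: L1_meas].
    apply: aeDS p0 => t _ pt; rewrite expRM_natl lnK ?posrE ?nc_gt0//.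
  have ak : analytic_disc (herg (fun t => expR (2 * k t))) by exact: analytic_herg.
  apply: (@hardy2I _ _ (mean (fun t => expR (2 * k t)))) => // r r01.
  (* The mean of exp(2k) is also the mean over the circle of radius [r] of its Poisson integral, and
     against that Jensen's inequality compares integrands pointwise. *)
  have -> : mean (fun t => expR (2 * k t)) = mean (fun t => Re (herg (fun t => expR (2 * k t)) (r%:C * eit t))).
    have h := congr1 (@complex.Re R) (cmean_circle ak r01).
    by rewrite -[RHS]/(Re (cmean _)) h Re_herg ?pois0// nc0.
  have [a ha] := (analyticP _).1 ak.
  apply: le_mean; [exact: (L2_circle aO r01).2|exact: (CL1_circle ha r01).1|].
  move=> t _; have z1 : nc (r%:C * eit t) < 1 by apply/disc_nc; exact: disc_scale.
  rewrite nc_cexp Re_herg// Re_herg// -expRM_natl.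
  rewrite -poisZ//; apply: expR_pois_le => //; exact: L1Z.
- have [e [e1 e2 e3 e4]] := cexp_herg_quasi_invertible (nc1 R) lk.
  exists e; split=> // [n z dz|z dz].
    by have := e3 n z dz; rewrite mul1r.
  by apply: cvg_eq1 (e4 z dz) => n; rewrite mul1r.
- by move=> z dz; rewrite /I /O -mulrA -cexpD addNr cexp0 mulr1.
Qed.

Lemma n2_le1 p : L2 p -> aeD (fun t => nc (p t) <= 1) -> n2 p <= 1.
Proof.
move=> lp p1; rewrite -[X in _ <= X](mean_cst 1) /n2.
rewrite (@mean_ae _ _ (fun t => Num.min (nc (p t) ^+ 2) 1)); last first.
  by apply: aeDS p1 => t _ h; rewrite min_l// exprn_ile1// nc_ge0.
apply: le_mean; [|exact: L1_cst|by move=> t _; rewrite ge_min lexx orbT].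
apply: (@L1_bounded _ _ 1) => [|t _].
  by apply: measurable_minr; [exact: meas_nc_sq lp.1|exact: meas_cst].
by rewrite ger0_norm ?ge_min ?lexx ?orbT// le_min sqr_ge0 ler01.
Qed.

(** The coefficient of index 0 already exhausts Bessel's inequality, so all others vanish. *)
Lemma unimodular_const f p : boundary f p -> aeD (fun t => nc (p t) <= 1) -> nc (f 0) = 1 ->
  forall z, disc z -> f z = f 0.
Proof.
move=> bf p1 f01; have pf := pseries_boundary bf; have [lp _ _ _] := bf.
have d0 : disc (0 : C) by apply/disc_nc; rewrite nc0.
have c0 : coef p 0%N = f 0 by exact: cvgC_uniq (@cvg_psum0 _) (pf _ d0).
have n21 := n2_le1 lp p1.
have cn n : (0 < n)%N -> coef p n = 0.
  case: n => // n _; apply/eqP; rewrite -nc_eq0 -sqrf_eq0 eq_le sqr_ge0 andbT.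
  have := le_trans (bessel n.+2 lp) n21; rewrite big_ord_recl.
  rewrite c0 f01 expr1n gerDl.
  rewrite big_ord_recr/=; apply: le_trans; rewrite lerDr.
  by apply: sumr_ge0 => i _; exact: sqr_ge0.
move=> z dz; apply: (@cvgC_uniq _ _ \oo _ (fun N => psum (coef p) N z)); first exact: pf.
apply: cvg_near_cst; exists 1%N => // -[//|N] _; rewrite /psum big_ord_recl expr0 mulr1 big1 ?addr0//.
by move=> i _; rewrite cn ?mul0r.
Qed.

End InnerOuter.

                                           

(** * Angles of circle points, and Poisson integrals of open sets *)

Section Angle.
Variable R : realType.
Local Notation C := R[i].
Local Notation D := (@angles R).
Implicit Types (g : R -> R) (p q : R -> C) (z : C) (r t s : R) (U : set R).

                                                                             
(** Clamping makes the arc cosine monotone on the whole line, hence Borel. *)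
Definition clamped_acos (x : R) : R := acos (Num.max (-1) (Num.min x 1)).
Definition angle z : R :=
  if 0 <= Im z then clamped_acos (Re z) else 2 * pi - clamped_acos (Re z).

Lemma clamp_bound (x : R) : -1 <= Num.max (-1) (Num.min x 1) <= 1.
Proof. by rewrite le_max lexx/= ge_max ge_min lexx orbT andbT; lra. Qed.

Lemma clamped_acos_bound (x : R) : 0 <= clamped_acos x <= pi.
Proof. by rewrite acos_ge0 ?acos_lepi ?clamp_bound. Qed.

Lemma meas_clamped_acos : measurable_fun [set: R] clamped_acos.
Proof.
apply: nonincreasing_measurable => // x y xy.
rewrite leNgt; apply/negP => h.
have bx := clamped_acos_bound x; have by_ := clamped_acos_bound y.
have : cos (clamped_acos y) < cos (clamped_acos x) by rewrite ltr_cos ?in_itv.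
rewrite /clamped_acos !acosK ?in_itv/= ?clamp_bound// ltNge => /negP; apply.
by rewrite ge_max !le_max lexx/=; apply/orP; right; rewrite le_min !ge_min xy lexx !orbT.
Qed.

Lemma angle_bound z : D (angle z).
Proof.
rewrite /angles/= in_itv/= /angle; have /andP[h1 h2] := clamped_acos_bound (Re z).
by case: ifP => _; apply/andP; split; lra.
Qed.

Lemma eit_angle z : nc z = 1 -> eit (angle z) = z.
Proof.
move=> z1.
have sq : Re z ^+ 2 + Im z ^+ 2 = 1 by rewrite -nc_sq z1 expr1n.
have rz : -1 <= Re z <= 1 by rewrite -ler_norml -z1 Re_le_nc.
have cz : clamped_acos (Re z) = acos (Re z).
  by move/andP: rz => [h1 h2]; rewrite /clamped_acos min_l// max_r.
have ca : cos (acos (Re z)) = Re z by rewrite acosK// in_itv.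
have sa : sin (acos (Re z)) = `|Im z|.
  rewrite sin_acos//; have -> : 1 - Re z ^+ 2 = Im z ^+ 2 by rewrite -sq; ring.
  exact: sqrtr_sqr.
rewrite /angle cz; case: ifPn => iz.
  by apply: complex_eq; rewrite eitE/= ?ca// sa ger0_norm.
have := eit_2pi R; rewrite eitE => -[c2 s2].
apply: complex_eq; rewrite eitE/=; first by rewrite cosB c2 s2 mul1r mul0r addr0.
by rewrite sinB c2 s2 mul0r mul1r sub0r sa ler0_norm ?opprK// ltW// ltNge.
Qed.

Lemma meas_angle p : cmeas p -> meas (fun t => angle (p t)).
Proof.
move=> [m1 m2]; have mc := meas_comp meas_clamped_acos m1.
have m2p : meas (fun t => 2 * pi - clamped_acos (Re (p t))) by apply: measB => //; exact: meas_cst.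
apply: (measurable_fun_if (@measurable_angles R)).
- by apply: measurable_fun_ler => //; exact: measurable_cst.
- by apply: measurable_funS mc => //; exact: measurable_angles.
- by apply: measurable_funS m2p => //; exact: measurable_angles.
Qed.

(** The angles 0 and 2 pi give the same point of the circle, so [U] has to contain both in order to
    cover a neighbourhood of that point. *)
Lemma circle_separation U s : open U -> U 0 -> U (2 * pi) -> D s -> U s ->
  exists2 c : R, 0 < c & forall t, D t -> ~ U t -> c <= 1 - cos (t - s).
Proof.
move=> oU U0 U2 Ds Us.
have nb (x : R) : U x -> exists2 d : R, 0 < d & forall t, ~ U t -> d <= `|t - x|.
  move=> Ux; have [d /= d0 hd] := oU _ Ux; exists d => // t nU.
  by rewrite leNgt; apply/negP => h; apply: nU; apply: hd; rewrite /ball_/= distrC.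
have [d2 d20 hd2] := nb _ U2; have [d1 d10 hd1] := nb _ U0; have [d d0 hd] := nb _ Us.
have p0 := pi_gt0 R.
have [si|sb] := boolP (0 < s < 2 * pi).
  have [c c0 hc] := cos_far si d0; exists c => // t Dt nU; apply: hc => //; exact: hd.
have {}sb : s = 0 \/ s = 2 * pi.
  move: Ds sb; rewrite /angles/= in_itv/= => /andP[s0 s2]; rewrite negb_and -!leNgt => /orP[h|h].
    by left; apply/eqP; rewrite eq_le h.
  by right; apply/eqP; rewrite eq_le s2.
have [c c0 hc] : exists2 c : R, 0 < c & forall t, D t -> ~ U t -> c <= 1 - cos t.
  pose m := Num.min pi (Num.min d1 d2).
  have m0 : 0 < m by rewrite !lt_min p0 d10.
  have mp : m <= pi by rewrite ge_min lexx.
  have md1 : m <= d1 by rewrite !ge_min lexx orbT.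
  have md2 : m <= d2 by rewrite !ge_min lexx !orbT.
  exists (1 - cos m); first by rewrite subr_gt0 -cos0 ltr_cos// in_itv/=; apply/andP; split; lra.
  move=> t; rewrite /angles/= in_itv/= => /andP[t0 t2] nU.
  have := hd1 t nU; rewrite subr0 ger0_norm// => h1.
  have := hd2 t nU; rewrite ler0_norm ?subr_le0// opprB => h2.
  rewrite lerD2l lerN2.
  have [tp|tp] := leP t pi; first by apply: cos_le_cos; lra.
  have := eit_2pi R; rewrite eitE => -[c2 s2].
  have -> : cos t = cos (2 * pi - t) by rewrite cosB c2 s2; ring.
  by apply: cos_le_cos; lra.
exists c => // t Dt nU; case: sb => ->; first by rewrite subr0 hc.
have := eit_2pi R; rewrite eitE => -[c2 s2].
by rewrite cosB c2 s2 mulr1 mulr0 addr0 hc.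
Qed.

Lemma nc_sub_eit z t : nc (eit t - z) = nc (1 - z * conjc (eit t)).
Proof.
rewrite -[RHS]mul1r -[X in _ = X * _](nc_eit t) -ncM; congr nc.
by rewrite mulrBr mulr1 mulrCA eitJ mulr1.
Qed.

                                                                               
                                                                                 
(** The kernel has total mass 1, and off [U] it is at most (1 - |w|^2) / d^2. The approach of [w] to
    the circle is arbitrary because the lemma is applied along psi(r e^(it)), which need not be
    radial. *)
Lemma pois_open U s (T : Type) (F : set_system T) (FF : Filter F) (w : T -> C) :
  open U -> U 0 -> U (2 * pi) -> D s -> U s ->
  w @ F --> eit s -> (\forall x \near F, nc (w x) < 1) ->
  (fun x => pois (\1_U : R -> R) (w x)) @ F --> (1 : R).
Proof.
move=> oU U0 U2 Ds Us cw w1.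
have mU : measurable (U : set (measurableTypeR R)) by exact: open_measurable.
have lU : L1 (\1_U : R -> R) by exact: L1_indic.
have [c c0 hc] := circle_separation oU U0 U2 Ds Us.
(* The squared chord |e^(it) - e^(is)|^2 = 2 (1 - cos(t - s)) is at least 2c off [U]; taking half
   the chord leaves room for [w] close to e^(is). *)
have c20 : 0 < Num.sqrt (2 * c) / 2 by rewrite divr_gt0// sqrtr_gt0 mulr_gt0.
set d := Num.sqrt (2 * c) / 2 in c20.
have sep t : D t -> ~ U t -> 2 * d <= nc (eit t - eit s).
  move=> Dt nU; rewrite /d mulrC divfK//.
  rewrite -(ler_pXn2r (n := 2)) ?nnegrE ?sqrtr_ge0 ?nc_ge0// sqr_sqrtr; last by rewrite mulr_ge0// ltW.
  have -> : nc (eit t - eit s) ^+ 2 = 2 * (1 - cos (t - s)).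
    by rewrite nc_sub_eit; have := denom_polar 1 s t; rewrite mul1r subrr expr0n add0r mulr1.
  by rewrite ler_wpM2l// hc.
have up : \forall x \near F, `|1 - pois (\1_U : R -> R) (w x)| <= (1 - nc (w x) ^+ 2) / d ^+ 2.
  have /cvgC_nc/cvgrPdist_lt /(_ d c20) near1 := cw.
  apply: filterS2 near1 w1 => x /=; rewrite sub0r normrN ger0_norm ?nc_ge0// => h1 h2.
  have E : 1 - pois (\1_U : R -> R) (w x) = pois (fun t => 1 - \1_U t) (w x).
    by rewrite poisB ?pois_cst//; exact: L1_cst.
  have le1 t : 0 <= 1 - \1_U t :> R by rewrite indicE; case: (_ \in _); rewrite ?subrr ?subr0.
  rewrite E ger0_norm ?pois_ge0// -[X in _ <= X](@mean_cst R).
  apply: le_mean; [by apply: L1_pk => //; apply: L1B => //; exact: L1_cst|exact: L1_cst|].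
  have n2 : 0 <= 1 - nc (w x) ^+ 2 by rewrite subr_ge0 exprn_ile1 ?nc_ge0// ltW.
  move=> t Dt; rewrite indicE; case: (boolP (t \in U)) => [|/negP nU].
    by rewrite subrr mulr0 divr_ge0 ?sqr_ge0.
  have {}nU : ~ U t by move=> h; apply: nU; apply/mem_set.
  rewrite subr0 mulr1 /pk ler_wpM2l//.
  have dn : d <= nc (1 - w x * conjc (eit t)).
    rewrite -nc_sub_eit.
    have := sep t Dt nU; have := ncBD (eit t - eit s) (w x - eit s).
    have -> : eit t - eit s - (w x - eit s) = eit t - w x by ring.
    lra.
  by rewrite lef_pV2 ?posrE ?exprn_gt0// ?(lt_le_trans c20 dn)// lerXn2r ?nnegrE ?(ltW c20)// nc_ge0.
have cz : (fun x => (1 - nc (w x) ^+ 2) / d ^+ 2) @ F --> (0 : R).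
  have c1 : (fun x => nc (w x)) @ F --> (1 : R) by rewrite -(nc_eit s); exact: (cvg_nc cw).
  have c2 : (fun x => 1 - nc (w x) ^+ 2) @ F --> (1 - 1 ^+ 2 : R).
    by apply: cvgB; [exact: cvg_cst|exact: cvg_sqr].
  have -> : (0 : R) = (1 - 1 ^+ 2) * (d ^+ 2)^-1 by rewrite expr1n subrr mul0r.
  exact: (cvgM c2 (cvg_cst _)).
apply/cvgrPdist_le => /= e e0.
have /cvgrPdist_le /(_ e e0) near2 := cz.
apply: filterS2 up near2 => x h1 /=; rewrite sub0r normrN => h2.
by apply: le_trans h1 _; apply: le_trans (ler_norm _) h2.
Qed.

Definition radius (n : nat) : R := 1 - n.+1%:R^-1.

Lemma radius_bound n : 0 <= radius n < 1.
Proof.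
by rewrite subr_ge0 invf_le1// ler1n/= ltrBlDr ltrDl invr_gt0.
Qed.

Lemma cvg_radius : radius @ \oo --> (1 : R)^'-.
Proof.
have c : radius @ \oo --> (1 : R).
  by rewrite -[X in _ --> X]subr0; apply: cvgB; [exact: cvg_cst|exact: cvg_harmonic].
move=> A [e /= e0 h]; have /cvgrPdist_lt/(_ e e0) := c.
apply: filterS => n /= hn; apply: h => //=.
by have /andP[] := radius_bound n.
Qed.

Lemma radial_seq (f : C -> C) p : radial f p ->
  aeD (fun t => (fun n => f ((radius n)%:C * eit t)) @ \oo --> p t).
Proof. by apply: aeDS => t _ h; exact: (cvg_comp _ _ cvg_radius h). Qed.

Lemma boundary_n2_le (f : C -> C) p (M : R) : boundary f p ->
  (forall r, 0 <= r < 1 -> n2 (fun t => f (r%:C * eit t)) <= M) -> n2 p <= M.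
Proof.
move=> bf fM; have [lp _ rp _] := bf.
have af : analytic_disc f by exact: (boundary_hardy2 bf).1.
have [] // := mean_fatou (g_ := fun n t => nc (f ((radius n)%:C * eit t)) ^+ 2)
  (g := fun t => nc (p t) ^+ 2) (B := M).
- by move=> n; exact: (L2_circle af (radius_bound n)).2.
- by move=> n t _; exact: sqr_ge0.
- by move=> n; exact: fM (radius_bound n).
- exact: meas_nc_sq lp.1.
- by move=> t _; exact: sqr_ge0.
- apply: aeDS (radial_seq rp) => t _ h; apply: cvg_sqr; exact: (cvg_nc h).
Qed.

(** The sum of the |p_n|^2 has finite mean, so it is finite almost everywhere and its terms tend to
    0. *)
Lemma cvg_ae_summable (p_ : nat -> R -> C) (B : R) : (forall n, L2 (p_ n)) ->
  (forall n, n2 (p_ n) <= B * 2^-1 ^+ n) -> aeD (fun t => p_ ^~ t @ \oo --> (0 : C)).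
Proof.
move=> lp pB.
pose G K t := \sum_(k < K) nc (p_ k t) ^+ 2.
have lG K : L1 (G K).
  rewrite /G; elim: K => [|K ih].
    by apply: L1_eq (L1_cst 0) => t _; rewrite big_ord0.
  by apply: L1_eq (L1D ih (lp K).2) => t _; rewrite big_ord_recr.
have h2 : 0 <= 2^-1 :> R by rewrite invr_ge0.
have B0 : 0 <= B by have := pB 0%N; rewrite expr0 mulr1; apply: le_trans; exact: n2_ge0.
have mG K : mean (G K) <= B * (1 - 2^-1)^-1.
  apply: (@le_trans _ _ (B * \sum_(k < K) 2^-1 ^+ k)); last first.
    by rewrite ler_wpM2l//; apply: geometric_le; rewrite h2 invf_lt1// ltr1n.
  elim: K => [|K ih].
    by rewrite big_ord0 mulr0 /G (@eq_mean _ _ (fun=> 0)) ?mean_cst// => t _; rewrite big_ord0.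
  rewrite (@eq_mean _ _ (fun t => G K t + nc (p_ K t) ^+ 2)); last first.
    by move=> t _; rewrite /G big_ord_recr.
  by rewrite meanD//; [rewrite big_ord_recr/= mulrDr lerD// pB|exact: (lp K).2].
have Gm t : D t -> {homo G ^~ t : n m / (n <= m)%N >-> n <= m}.
  by move=> _; apply/nondecreasing_seqP => n; rewrite /G big_ord_recr/= lerDl sqr_ge0.
have [h [_ _ ch]] := mean_monotone lG (fun n t _ => sumr_ge0 _ (fun k _ => sqr_ge0 _)) Gm mG.
apply: aeDS ch => t _ ct; apply/cvgC_nc.
have c0 : (fun n => nc (p_ n t) ^+ 2) @ \oo --> (0 : R).
  have : (fun n => G n.+1 t - G n t) @ \oo --> (h t - h t).
    by apply: cvgB => //; move: ct; rewrite -(cvg_shiftS (G ^~ t)).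
  rewrite subrr; apply: cvg_eq1 => n; by rewrite /G big_ord_recr/= addrAC subrr add0r.
have -> : (0 : R) = Num.sqrt 0 by rewrite sqrtr0.
have := cvg_comp _ _ c0 (@sqrt_continuous R 0).
apply: cvg_eq1 => n; rewrite subr0 /=.
by rewrite sqrtr_sqr ger0_norm ?nc_ge0.
Qed.

End Angle.

(** * Boundary functions of differences and polynomials *)

Section BoundaryPoly.
Variable R : realType.
Local Notation C := R[i].
Implicit Types (p q : R -> C) (a : nat -> C) (f g : C -> C) (z : C) (r t : R).

Lemma boundary_ae f p q : boundary f p -> cmeas q -> aeD (fun t => p t = q t) -> boundary f q.
Proof.
move=> [lp mp rp fE] mq pq.
have lq : L2 q.
  split=> //; apply: (L1_ae _ _ lp.2); first exact: meas_nc_sq.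
  by apply: aeDS pq => t _ ->.
split; first exact: lq.
- move=> m; rewrite -(mp m); apply: cmean_ae; apply: aeDS pq => t _ ->.
  by [].
- exact: radial_ae rp.
- move=> z dz; rewrite fE//; apply: cmean_ae; apply: aeDS pq => t _ ->.
  by [].
Qed.

Lemma boundaryB f g p q : boundary f p -> boundary g q ->
  boundary (fun z => f z - g z) (fun t => p t - q t).
Proof.
move=> [lp mp rp fE] [lq mq rq gE]; split.
- exact: L2B.
- move=> m; rewrite (@eq_cmean _ _ (fun t => p t * eit t ^+ m.+1 - q t * eit t ^+ m.+1)).
    by rewrite cmeanB ?mp ?mq ?subrr//; exact/CL1_mul_eitX/L2_CL1.
  by move=> t _; rewrite mulrBl.
- by apply: aeDS2 rp rq => t _ h1 h2; exact: (cvgB h1 h2).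
- by move=> z dz; rewrite fE// gE// cauchyB//; [exact: L2_CL1|exact: L2_CL1|exact/disc_nc].
Qed.

Lemma cvg_psum a N (T : Type) (F : set_system T) (FF : Filter F) (w : T -> C) z :
  w @ F --> z -> (fun x => psum a N (w x)) @ F --> psum a N z.
Proof.
move=> wz.
have cX n : (fun x => w x ^+ n) @ F --> z ^+ n.
  elim: n => [|n ih]; first exact: cvg_cst.
  rewrite exprS; apply: cvg_eq1 (cvgM wz ih) => x; exact: exprS.
elim: N => [|N ih].
  have c : (fun=> 0 : C) @ F --> (0 : C) by exact: cvg_cst.
  by rewrite /psum big_ord0; apply: cvg_eq1 c => x; rewrite big_ord0.
rewrite /psum big_ord_recr; apply: cvg_eq1 (cvgD ih (cvgMr (a := a N) (cX N))) => x.
by rewrite /= big_ord_recr.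
Qed.

Lemma psum_eit a N t : psum a N (eit t) = tpoly a N t.
Proof. by []. Qed.

Lemma boundary_psum a N : boundary (psum a N) (tpoly a N).
Proof.
have b := boundary_cauchy (L2_tpoly a N) (moment_tpoly a N).
apply: boundary_eq b => z /disc_nc z1.
apply: cvgC_uniq (cauchy_cvg (L2_CL1 (L2_tpoly a N)) z1) _.
apply: cvg_near_cst; exists N => // M /= NM; rewrite /psum.
rewrite (big_ord_widen M (fun n => a n * z ^+ n) NM) [RHS]big_mkcond/=.
by apply: eq_bigr => i _; rewrite coef_tpoly; case: ifP; rewrite ?mul0r.
Qed.

Lemma pois_sqr_le (g : R -> R) z : nc z < 1 -> L1 g -> L1 (fun t => g t ^+ 2) ->
  pois g z ^+ 2 <= pois (fun t => g t ^+ 2) z.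
Proof.
move=> z1 lg lg2; set A := pois g z.
have l1 : L1 (fun t => 2 * A * g t - A ^+ 2) by apply: L1B; [exact: L1Z|exact: L1_cst].
have -> : A ^+ 2 = pois (fun t => 2 * A * g t - A ^+ 2) z.
  rewrite (poisB z1 (L1Z _ lg) (L1_cst (A ^+ 2))) (poisZ _ z1 lg) (pois_cst (A ^+ 2) z1) -/A; ring.
apply: le_pois => // t _; rewrite -subr_ge0.
have -> : g t ^+ 2 - (2 * A * g t - A ^+ 2) = (g t - A) ^+ 2 by ring.
exact: sqr_ge0.
Qed.

Lemma boundary_sqr_le f p z : boundary f p -> disc z -> nc (f z) ^+ 2 <= pois (fun t => nc (p t) ^+ 2) z.
Proof.
move=> bf dz; have z1 := (disc_nc z).1 dz; have [lp _ _ _] := bf.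
apply: le_trans (pois_sqr_le z1 (L1_nc (L2_CL1 lp)) lp.2).
rewrite (boundary_cpois bf dz) lerXn2r ?nnegrE ?nc_ge0//; last exact: nc_cpois_le z1 (L2_CL1 lp).
by apply: pois_ge0 => // t _; exact: nc_ge0.
Qed.

End BoundaryPoly.

(** * Composition with an inner function *)

Section Composition.
Variable R : realType.
Local Notation C := R[i].
Local Notation mu := (@lebesgue_measure R).
Local Notation D := (@angles R).
Implicit Types (g : R -> R) (p q : R -> C) (f : C -> C) (z : C) (r t : R) (U : set R).
Variables (psi : C -> C) (B : R -> R).
Hypotheses (BD : forall t, D (B t)) (mB : meas B)
  (bpsi : boundary psi (fun t => eit (B t))) (psi0 : nc (psi 0) < 1).

Let apsi : analytic_disc psi.
Proof. exact: (boundary_hardy2 bpsi).1. Qed.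

                                                                                    
(** Harnack's inequality for the nonnegative harmonic function 1 - Re(c psi), where the unimodular
    [c] is chosen so that c psi(z) = |psi(z)|. *)
Lemma inner_schwarz z : disc z -> (1 - nc z) / (1 + nc z) * (1 - nc (psi 0)) <= 1 - nc (psi z).
Proof.
move=> dz; have z1 := (disc_nc z).1 dz; have d0 : disc (0 : C) by apply/disc_nc; rewrite nc0.
have [c [c1 cE]] : exists c : C, nc c = 1 /\ Re (c * psi z) = nc (psi z).
  have [w0|w0] := eqVneq (psi z) 0; first by exists 1; rewrite nc1 w0 mulr0 nc0.
  have n0 : nc (psi z) != 0 by rewrite nc_eq0.
  exists (conjc (psi z) * ((nc (psi z))^-1)%:C); split.
    by rewrite ncM nc_conj nc_real ger0_norm ?invr_ge0 ?nc_ge0// mulfV.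
  rewrite mulrAC [conjc _ * _]mulrC mulcJ -rmorphM/=.
  by rewrite expr2 mulfK.
have [lp _ _ _] := bpsi.
have lcb : L1 (fun t => Re (c * eit (B t))) by exact: (CL1Z c (L2_CL1 lp)).1.
pose g t := 1 - Re (c * eit (B t)).
have lg : L1 g by apply: L1B => //; exact: L1_cst.
have gp w : disc w -> pois g w = 1 - Re (c * psi w).
  move=> dw; have w1 := (disc_nc w).1 dw.
  rewrite poisB ?pois_cst//; last exact: L1_cst.
  rewrite (boundary_cpois bpsi dw) -cmeanZ; last by apply: CL1_pk => //; exact: L2_CL1.
  congr (_ - _); apply: eq_mean => t _ /=; rewrite mulrCA.
  by case: (c * _) => x y /=; rewrite mul0r subr0.
have g0 t : D t -> 0 <= g t.
  by move=> _; rewrite subr_ge0 (le_trans (ler_norm _))// (le_trans (Re_le_nc _))// ncM c1 nc_eit mul1r.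
rewrite -cE -gp//; apply: le_trans (mean_le_pois z1 lg g0).
rewrite ler_wpM2l ?(ltW (harnack_gt0 z1))// -pois0 gp// lerD2l lerN2.
by rewrite (le_trans (ler_norm _))// (le_trans (Re_le_nc _))// ncM c1 mul1r.
Qed.

Lemma inner_ball r : 0 <= r < 1 -> exists2 s, 0 <= s < 1 & forall z, nc z <= r -> nc (psi z) <= s.
Proof.
move=> /andP[r0 r1]; exists (1 - (1 - r) / (1 + r) * (1 - nc (psi 0))).
  have h : 0 < (1 - r) / (1 + r) by rewrite divr_gt0//; lra.
  have h1 : (1 - r) / (1 + r) <= 1 by rewrite ler_pdivrMr; lra.
  have n0 := nc_ge0 (psi 0).
  have n1 : 0 < 1 - nc (psi 0) by rewrite subr_gt0.
  rewrite subr_ge0 ltrBlDr ltrDl mulr_gt0// andbT.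
  by apply: le_trans (ler_piMl (ltW n1) h1) _; rewrite lerBlDr lerDl.
move=> z zr; have z0 := nc_ge0 z; have z1 : nc z < 1 by exact: le_lt_trans r1.
have := inner_schwarz ((disc_nc z).2 z1).
have h : (1 - r) / (1 + r) <= (1 - nc z) / (1 + nc z).
  by rewrite ler_pdivrMr ?ltr_pwDl// mulrAC ler_pdivlMr ?ltr_pwDl//; nra.
have n1 : 0 <= 1 - nc (psi 0) by rewrite subr_ge0 ltW.
by move: (ler_wpM2r n1 h); lra.
Qed.

Lemma inner_disc z : disc z -> disc (psi z).
Proof.
move=> /disc_nc z1; have zr : 0 <= nc z < 1 by rewrite nc_ge0.
have [s /andP[_ s1] h] := inner_ball zr.
by apply/disc_nc; apply: le_lt_trans s1; exact: h.
Qed.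

Lemma analytic_comp_inner f : analytic_disc f -> analytic_disc (fun z => f (psi z)).
Proof. by move=> af; apply: analytic_comp => // r; exact: inner_ball. Qed.

(** The integrand is the real part of the analytic function (herg g) o psi, which has the mean value
    property. *)
Lemma mean_pois_comp g r : L1 g -> 0 <= r < 1 ->
  L1 (fun t => pois g (psi (r%:C * eit t))) /\ mean (fun t => pois g (psi (r%:C * eit t))) = pois g (psi 0).
Proof.
move=> lg r01; have ah := analytic_comp_inner (analytic_herg lg).
have E t : Re (herg g (psi (r%:C * eit t))) = pois g (psi (r%:C * eit t)).
  by rewrite Re_herg//; apply/disc_nc/inner_disc; exact: disc_scale.
have [a ha] := (analyticP _).1 ah.
split; first by apply: L1_eq (CL1_circle ha r01).1 => t _; exact: E.
have := congr1 (@complex.Re R) (cmean_circle ah r01); rewrite Re_herg// => <-.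
by apply: eq_mean => t _; rewrite E.
Qed.

(** Harnack's constant at [psi 0]; it bounds [pois g (psi 0)] by a multiple of [mean g] for
    nonnegative [g]. *)
Let c0 : R := (1 + nc (psi 0)) / (1 - nc (psi 0)).

Let c0_ge0 : 0 <= c0.
Proof. by apply: divr_ge0; [rewrite addr_ge0 ?nc_ge0|rewrite subr_ge0 ltW]. Qed.

Lemma radial_psi : aeD (fun t => (fun n => psi ((radius R n)%:C * eit t)) @ \oo --> eit (B t)).
Proof. by have [_ _ rp _] := bpsi; exact: radial_seq. Qed.

Lemma meas_indic_comp U : measurable U -> meas (fun t => \1_U (B t)).
Proof. by move=> mU; apply: (@meas_comp _ (\1_U : R -> R)) => //; exact: measurable_indic. Qed.

(** Where the boundary value of psi lies in [U], the Poisson integral of the indicator tends to 1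
    along psi(r e^(it)). Fatou's lemma bounds the mean of the limit by means that [mean_pois_comp]
    evaluates at [psi 0], where Harnack's inequality applies. *)
Lemma mean_open_comp U : open U -> U 0 -> U (2 * pi) ->
  mean (fun t => \1_U (B t)) <= c0 * mean (\1_U : R -> R).
Proof.
move=> oU U0 U2.
have mU : measurable (U : set (measurableTypeR R)) by exact: open_measurable.
have b1 t : `|\1_U t| <= 1 :> R by exact: norm_indic_le1.
have i0 t : 0 <= \1_U t :> R by exact: indic_ge0.
have lU : L1 (\1_U : R -> R) by exact: L1_indic.
have mUB := meas_indic_comp mU.
have d0 : disc (0 : C) by apply/disc_nc; rewrite nc0.
have dr n t : disc (psi ((radius R n)%:C * eit t)) by apply/inner_disc/disc_scale; exact: radius_bound.
have pd n t : 0 <= pois (\1_U : R -> R) (psi ((radius R n)%:C * eit t)).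
  exact: (pois_ge0 ((disc_nc _).1 (dr n t)) (fun s _ => i0 s)).
(* The factor [\1_U (B t)] makes the sequence converge, to 0, also where [B t] is outside [U]; the
   Poisson integrals alone need not converge there. *)
have [] // := mean_fatou (g_ := fun n t => \1_U (B t) * pois (\1_U : R -> R) (psi ((radius R n)%:C * eit t)))
  (g := fun t => \1_U (B t)) (B := c0 * mean (\1_U : R -> R)).
- move=> n; exact: (L1M (k := fun t => \1_U (B t)) (M := 1) mUB (fun t _ => b1 _) (mean_pois_comp lU (radius_bound R n)).1).
- by move=> n t _; exact: (mulr_ge0 (i0 _) (pd n t)).
- move=> n; have [l1 m1] := mean_pois_comp lU (radius_bound R n).
  apply: le_trans (_ : mean (fun t => pois (\1_U : R -> R) (psi ((radius R n)%:C * eit t))) <= _).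
    apply: le_mean => //; first exact: (L1M (k := fun t => \1_U (B t)) (M := 1) mUB (fun t _ => b1 _) l1).
    by move=> t _; apply: (ler_piMl (pd n t)); exact: le_trans (ler_norm _) (b1 _).
  rewrite m1; exact: (pois_le_mean psi0 lU).
- apply: aeDS radial_psi => t Dt ct.
  have [Ut|Ut] := pselect (U (B t)).
    have e1 : \1_U (B t) = 1 :> R by rewrite indicE mem_set.
    apply: (@cvg_eq1 _ _ _ _ (fun n => pois (\1_U : R -> R) (psi ((radius R n)%:C * eit t)))) => [n|].
      by rewrite e1 mul1r.
    have near1 : \forall n \near \oo, nc (psi ((radius R n)%:C * eit t)) < 1.
      by apply: nearW => n; exact: (disc_nc _).1 (dr n t).
    rewrite [X in _ --> X]e1; exact: (pois_open _ oU U0 U2 (BD t) Ut ct near1).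
  have e1 : \1_U (B t) = 0 :> R by rewrite indicE memNset.
  rewrite [X in _ --> X]e1; apply: (@cvg_eq1 _ _ _ _ (fun=> 0)) => [n|]; first by rewrite e1 mul0r.
  exact: cvg_cst.
Qed.

Lemma mean_indic U : measurable U -> mean (\1_U : R -> R) = (2 * pi)^-1 * fine (mu (U `&` D)).
Proof.
move=> mU; rewrite /mean /Rintegral; congr (_ * fine _).
by rewrite integral_indic//; exact: measurable_angles.
Qed.

(** This makes F o psi meaningful for a symbol given almost everywhere. By outer regularity it
    reduces to small open sets, which [mean_open_comp] controls. *)
Lemma null_comp (N : set R) : measurable N -> mu N = 0%E -> aeD (fun t => ~ N (B t)).
Proof.
(* With both endpoints added, every open set around [N'] meets the hypotheses of
   [mean_open_comp]. *)
move=> mN N0; pose N' : set R := N `|` ([set 0] `|` [set 2 * pi]).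
have mN' : measurable N' by do 2 (apply: measurableU => //).
have N'0 : mu N' = 0%E.
  have h1 : mu ([set 0] `|` [set 2 * pi]) = 0%E.
    by apply: null_set_setU => //; exact: lebesgue_measure_set1.
  by apply: null_set_setU => //; apply: measurableU.
have lB (A : set R) : measurable A -> L1 (fun t => \1_A (B t)).
  by move=> mA; exact: L1_bounded (meas_indic_comp mA) (fun t _ => norm_indic_le1 A (B t)).
have li := lB _ mN'.
have small (e : R) : 0 < e -> mean (fun t => \1_N' (B t)) <= c0 * ((2 * pi)^-1 * e).
  move=> e0; have muN' : (mu N' < +oo)%E by rewrite N'0 ltry.
  have [U [oU NU mUN]] := lebesgue_regularity_outer mN' muN' e0.
  have mU : measurable (U : set (measurableTypeR R)) by exact: open_measurable.
  apply: le_trans (_ : mean (fun t => \1_U (B t)) <= _).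
    apply: le_mean => [//||t _]; [exact: lB|rewrite !indicE ler_nat].
    case: (boolP (B t \in N')) => // /set_mem /NU h; by rewrite mem_set.
  apply: le_trans (mean_open_comp oU _ _) _; [by apply: NU; right; left|by apply: NU; right; right|].
  rewrite ler_wpM2l// mean_indic// ler_wpM2l ?invr_ge0 ?(ltW (@twopi_gt0 R))//.
  have mUe : (mu (U `&` D) <= e%:E)%E.
    have mUD : measurable (U `&` D) by apply: measurableI => //; exact: measurable_angles.
    apply: (@le_trans _ _ (mu U)).
      by apply: le_measure; [exact: mem_set|exact: mem_set|exact: subIsetl].
    have mD : measurable (U `\` N') by exact: measurableD.
    have UE : U = (U `\` N') `|` N' by rewrite setUC setDUK.
    have h : (mu (U `\` N' `|` N') <= mu (U `\` N') + mu N')%E by exact: measureU2.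
    by rewrite N'0 adde0 in h; rewrite [X in mu X]UE; exact: le_trans h (ltW mUN).
  by rewrite -lee_fin fineK// ge0_fin_numE// (le_lt_trans mUe)// ltry.
have m0 : mean (fun t => \1_N' (B t)) = 0.
  apply/eqP; rewrite eq_le mean_ge0 ?andbT => [|t _]; last exact: indic_ge0.
  rewrite leNgt; apply/negP => h; set M := mean _ in h small.
  have c1 : 0 < c0 + 1 by rewrite ltr_wpDl.
  have p2 := @twopi_gt0 R.
  (* With this [e] the bound becomes c0 M / (c0 + 1), which is less than M. *)
  have /small : 0 < 2 * pi * (M / (c0 + 1)) by rewrite mulr_gt0// divr_gt0.
  by rewrite mulKf ?gt_eqF// mulrA ler_pdivlMr//; nra.
apply: aeDS (mean_eq0_ae li (fun t _ => indic_ge0 _ _) m0) => t _ h Nt.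
have : \1_N' (B t) = 1 :> R by rewrite indicE mem_set//; left.
by rewrite h => /eqP; rewrite eq_sym oner_eq0.
Qed.

Lemma aeD_comp (P : R -> Prop) : aeD P -> aeD (fun t => P (B t)).
Proof.
move=> /aeD_null[N [mN N0 NP]]; apply: aeDS (null_comp mN N0) => t _.
exact: NP (BD t).
Qed.

Lemma cmeas_comp p : cmeas p -> cmeas (fun t => p (B t)).
Proof.
have BDD : B @` D `<=` D by move=> _ [t _ <-].
by move=> [m1 m2]; split; [apply: (measurable_comp (@measurable_angles R) BDD m1 mB)
  |apply: (measurable_comp (@measurable_angles R) BDD m2 mB)].
Qed.

(** Littlewood subordination: |f|^2 is at most the Poisson integral of |p|^2, whose composition with
    psi has a mean given by its value at [psi 0]. *)
Lemma n2_comp_circle f p r : boundary f p -> 0 <= r < 1 ->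
  n2 (fun t => f (psi (r%:C * eit t))) <= c0 * n2 p.
Proof.
move=> bf r01; have [lp _ _ _] := bf; have [l1 m1] := mean_pois_comp lp.2 r01.
have af : analytic_disc f by exact: (boundary_hardy2 bf).1.
apply: le_trans (_ : pois (fun t => nc (p t) ^+ 2) (psi 0) <= _).
  rewrite -m1; apply: le_mean => //; first exact: (L2_circle (analytic_comp_inner af) r01).2.
  by move=> t _; apply: boundary_sqr_le => //; apply: inner_disc; exact: disc_scale.
by apply: pois_le_mean => //; [exact: lp.2|move=> t _; exact: sqr_ge0].
Qed.

Lemma hardy2_comp f : hardy2 f -> hardy2 (fun z => f (psi z)).
Proof.
move=> hf; have [p bf] := hardy2_boundary hf.
apply: (@hardy2I _ _ (c0 * n2 p)); first exact/analytic_comp_inner/hf.1.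
by move=> r; exact: n2_comp_circle.
Qed.

(** For polynomials this is continuity. In general take partial sums with squared errors at most
    2^-k: they converge to [p] almost everywhere, hence also at [B t] by [null_comp], and by
    [n2_comp_circle] their composites converge almost everywhere to the boundary function [q] of f o
    psi. *)
Lemma boundary_comp f p : boundary f p -> boundary (fun z => f (psi z)) (fun t => p (B t)).
Proof.
move=> bf; have [lp _ _ _] := bf.
have [q bq] := hardy2_boundary (hardy2_comp (boundary_hardy2 bf)).
apply: (boundary_ae bq); first exact: cmeas_comp lp.1.
pose s N := tpoly (coef p) N.
have /choice[N_ hN] : forall k, exists N, n2 (fun t => p t - s N t) <= 2^-1 ^+ k.
  move=> k; have e0 : 0 < 2^-1 ^+ k :> R by rewrite exprn_gt0// invr_gt0.
  have /cvgrPdist_le/(_ _ e0) [N _ h] := boundary_tpoly bf.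
  exists N; have := h N (leqnn N); rewrite sub0r normrN ger0_norm//; exact: n2_ge0.
have c1 : aeD (fun t => (fun k => p t - s (N_ k) t) @ \oo --> (0 : C)).
  apply: (@cvg_ae_summable _ (fun k t => p t - s (N_ k) t) 1) => k; last by rewrite mul1r.
  by apply: L2B => //; exact: L2_tpoly.
have bs N : boundary (fun z => f (psi z) - psum (coef p) N (psi z)) (fun t => q t - s N (B t)).
  have b2 := boundaryB bf (boundary_psum (coef p) N).
  have [w bw] := hardy2_boundary (hardy2_comp (boundary_hardy2 b2)).
  have [_ _ rw _] := bw; have [lq _ rq _] := bq; have [_ _ rp _] := bpsi.
  apply: (boundary_ae bw).
    apply: cmeasB; [exact: lq.1|apply: (@cmeas_comp (s N)); exact: (L2_tpoly _ _).1].
  apply: aeDS2 (aeD_and rw rq) rp => t _ [h1 h2] h3.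
  apply: cvgC_uniq h1 _.
  have h4 : (fun r => psum (coef p) N (psi (r%:C * eit t))) @ (1 : R)^'- --> s N (B t).
    by rewrite /s -psum_eit; exact: (cvg_psum _ h3).
  exact: (cvgB h2 h4).
have c2 : aeD (fun t => (fun k => q t - s (N_ k) (B t)) @ \oo --> (0 : C)).
  apply: (@cvg_ae_summable _ (fun k t => q t - s (N_ k) (B t)) c0) => k.
    by have [] := bs (N_ k).
  apply: (boundary_n2_le (bs (N_ k))) => r r01.
  apply: le_trans (n2_comp_circle (boundaryB bf (boundary_psum (coef p) (N_ k))) r01) _.
  by rewrite ler_wpM2l.
apply: aeDS2 c2 (aeD_comp c1) => t _ h1 h2; apply/eqP; rewrite -subr_eq0; apply/eqP.
apply: (@cvgC_uniq _ _ \oo _ (fun k => (q t - s (N_ k) (B t)) - (p (B t) - s (N_ k) (B t)))).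
  by apply: (@cvg_eq1 _ _ _ _ (fun=> q t - p (B t))) => [k|]; [ring|exact: cvg_cst].
rewrite -[X in _ --> X](subrr 0); exact: (cvgB h1 h2).
Qed.

Lemma quasi_invertible_comp f : quasi_invertible f -> quasi_invertible (fun z => f (psi z)).
Proof.
move=> [e [e1 e2 e3 e4]]; exists (fun n z => e n (psi z)); split.
- by move=> n; exact: (analytic_comp_inner (e1 n)).
- by move=> n; have [M h] := e2 n; exists M => z dz; exact: (h _ (inner_disc dz)).
- by move=> n z dz; exact: (e3 n _ (inner_disc dz)).
- by move=> z dz; exact: (e4 _ (inner_disc dz)).
Qed.

End Composition.

                         

(** * Toeplitz kernels through boundary functions *)

Section ToeplitzKernel.
Variable R : realType.
Local Notation C := R[i].
Local Notation D := (@angles R).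
Implicit Types (p q s : R -> C) (a : nat -> C) (f g h k : C -> C) (z c : C) (r t M : R).

Lemma norm_ncP z M : `|z| <= M%:C <-> nc z <= M.
Proof. by rewrite normcE lecR. Qed.

Lemma circle_rep f (q : R -> C) M : cmeas q -> aeD (fun t => f (eit t) = q t) ->
  aeD (fun t => nc (q t) <= M) -> Linfty f.
Proof.
move=> [m1 m2] fq qM; split; first by exists q.
exists M; apply: aeDS2 fq qM => t _ -> h; exact/norm_ncP.
Qed.

Lemma Linfty_rep h : Linfty h ->
  exists q M, [/\ cmeas q, forall t, nc (q t) <= M & aeD (fun t => h (eit t) = q t)].
Proof.
move=> [[q [m1 m2 hq]] [M hM]].
have mq : cmeas q by [].
(* Scaling by [k] truncates [q] to modulus at most |M|. Where [q] is 0 the inverse is 0, so [k] is 0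
   there, harmlessly. *)
pose k t := Num.min 1 (`|M| * (nc (q t))^-1).
have mk : meas k.
  apply: measurable_minr; first exact: meas_cst.
  exact: (measM (meas_cst _) (meas_inv (meas_nc mq))).
have k0 t : 0 <= k t by rewrite le_min ler01 mulr_ge0 ?invr_ge0 ?nc_ge0.
exists (fun t => (k t)%:C * q t), `|M|; split.
- by apply: cmeasM => //; exact: cmeas_real.
- move=> t; rewrite ncM nc_real ger0_norm//.
  have [q0|q0] := eqVneq (nc (q t)) 0; first by rewrite q0 mulr0.
  have qp : 0 < nc (q t) by rewrite lt_neqAle eq_sym q0 nc_ge0.
  by rewrite -ler_pdivlMr// ge_min lexx orbT.
- apply: aeDS2 hq hM => t _ -> /norm_ncP h1.
  have [q0|q0] := eqVneq (q t) 0; first by rewrite q0 mulr0.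
  have qp : 0 < nc (q t) by rewrite nc_gt0.
  rewrite /k min_l ?mul1r// ler_pdivlMr// mul1r.
  exact: le_trans h1 (ler_norm _).
Qed.

Lemma boundary_monomial m : boundary (fun z : C => z ^+ m) (fun t => eit t ^+ m).
Proof.
pose a (n : nat) : C := (n == m)%:R.
have E z : psum a m.+1 z = z ^+ m.
  rewrite /psum big_ord_recr/= /a eqxx mul1r big1 ?add0r// => i _.
  by rewrite (ltn_eqF (ltn_ord i)) mul0r.
apply: boundary_ae (cmeas_eitX R m) _.
  by apply: boundary_eq (boundary_psum a m.+1) => z _; exact: E.
by apply: aeDW => t _; rewrite -psum_eit E.
Qed.

Lemma boundary_cst0 : boundary (fun=> 0 : C) (fun=> 0).
Proof.
apply: boundary_ae (cmeas_cst 0) _; first by apply: boundary_eq (boundary_psum (fun=> 0) 0) => z _; rewrite /psum big_ord0.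
by apply: aeDW => t _; rewrite /tpoly big_ord0.
Qed.

Lemma inner_L2E f g p q : aeD (fun t => f (eit t) = p t) -> aeD (fun t => g (eit t) = q t) ->
  inner_L2 f g = cmean (fun t => p t * conjc (q t)).
Proof.
move=> fp gq; rewrite -[LHS]/(cmean (fun t => f (eit t) * conjc (g (eit t)))).
by apply: cmean_ae; apply: aeDS2 fp gq => t _ -> ->.
Qed.

Lemma L2_conj_shift q M p : cmeas q -> (forall t, nc (q t) <= M) -> L2 p ->
  L2 (fun t => conjc (eit t) * conjc (q t * p t)).
Proof.
move=> mq qM lp; apply: (L2M (M := 1)) (L2J (L2M mq (fun t _ => qM t) lp)) => [|t _].
  exact/cmeasJ/cmeas_eit.
by rewrite nc_conj nc_eit.
Qed.

(** The product h f is orthogonal to H^2 exactly when its conjugate has only positive frequencies,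
    that is, when conj(z h f) is the boundary function of some g in H^2. *)
Lemma kerTP h f p : Linfty h -> boundary f p ->
  kerT h f <-> exists g s, boundary g s /\ aeD (fun t => h (eit t) * p t = conjc (eit t * s t)).
Proof.
move=> /Linfty_rep[H [M [mH HM hH]]] bf; have [lp _ rp _] := bf.
have lHp : L2 (fun t => H t * p t) by exact: L2M mH (fun t _ => HM t) lp.
have inE k s : boundary k s ->
    inner_L2 (fun w => h w * bv f w - bv (fun=> 0 : C) w) (bv k) = cmean (fun t => H t * p t * conjc (s t)).
  move=> [_ _ rs _]; apply: inner_L2E; last exact: radial_bv.
  have [_ _ r0 _] := boundary_cst0.
  apply: aeDS2 (aeD_and (radial_bv rp) (radial_bv r0)) hH => t _ [-> ->] ->.
  by rewrite subr0.
split.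
- move=> [_ [_ hk]]; pose X t := conjc (eit t) * conjc (H t * p t).
  have lX : L2 X by exact: L2_conj_shift mH HM lp.
  have mX m : cmean (fun t => X t * eit t ^+ m.+1) = 0.
    (* Orthogonality to z^m is, after conjugation, the vanishing of the pairing of [X] with
       z^(m+1). *)
    have := hk _ (boundary_hardy2 (boundary_monomial m)).
    rewrite (inE _ _ (boundary_monomial m)) => E.
    rewrite (@eq_cmean _ _ (fun t => conjc (H t * p t * conjc (eit t ^+ m)))).
      rewrite cmeanJ ?E ?conjc0//; apply: CL1_mul => //; apply: L2J; exact: L2_eitX.
    move=> t _; rewrite conjcM conjcK /X exprS.
    transitivity ((eit t * conjc (eit t)) * (conjc (H t * p t) * eit t ^+ m)); first by ring.
    by rewrite eitJ mul1r.
  exists (cauchy X), X; split; first exact: boundary_cauchy.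
  apply: aeDS hH => t _ ->; rewrite /X mulrA eitJ mul1r.
  by rewrite conjcK.
- move=> [g [s [bg E]]]; split; first exact: boundary_hardy2 bf.
  split; first exact: boundary_hardy2 boundary_cst0.
  move=> k /hardy2_boundary[q bq]; rewrite (inE _ _ bq).
  have [ls ms _ _] := bg; have [lq _ _ _] := bq.
  rewrite (@cmean_ae _ _ (fun t => conjc (s t * q t * eit t ^+ 1))).
    by rewrite cmeanJ ?(moment_mul 0 ls ms bq) ?conjc0//; apply: CL1_mul_eitX; exact: CL1_mul.
  apply: aeDS2 E hH => t _ + <- => ->.
  by rewrite -conjcM expr1; congr conjc; ring.
Qed.

Lemma quasi_invertibleM f g : quasi_invertible f -> quasi_invertible g ->
  quasi_invertible (fun z => f z * g z).
Proof.
move=> [e [e1 e2 e3 e4]] [d [d1 d2 d3 d4]]; exists (fun n z => e n z * d n z).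
have E n z : e n z * d n z * (f z * g z) = e n z * f z * (d n z * g z) by ring.
split.
- by move=> n; exact: (analyticM (e1 n) (d1 n)).
- move=> n; have [M hM] := e2 n; have [N hN] := d2 n; exists (M * N) => z dz.
  by rewrite ncM ler_pM ?nc_ge0 ?hM ?hN.
- move=> n z dz; rewrite E ncM -[X in _ <= X]mulr1.
  by rewrite ler_pM ?nc_ge0 ?e3 ?d3.
- move=> z dz; apply: cvg_eq1 (fun n => E n z) _.
  by rewrite -[X in _ --> X]mulr1; exact: (cvgM (e4 z dz) (d4 z dz)).
Qed.

Lemma quasi_invertible_rotate f g c : nc c = 1 -> (forall z, disc z -> g z = c * f z) ->
  quasi_invertible f -> quasi_invertible g.
Proof.
move=> c1 gE [e [e1 e2 e3 e4]]; have c0 : c != 0 by rewrite -nc_gt0 c1.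
have E n z : disc z -> c^-1 * e n z * g z = e n z * f z.
  by move=> dz; rewrite gE// mulrACA mulVf ?mul1r.
exists (fun n z => c^-1 * e n z); split.
- by move=> n; exact: (analyticZ _ (e1 n)).
- by move=> n; have [M hM] := e2 n; exists M => z dz; rewrite ncM ncV c1 invr1 mul1r hM.
- by move=> n z dz; rewrite E ?e3.
- by move=> z dz; apply: cvg_eq1 (fun n => E n z dz) (e4 z dz).
Qed.

Lemma boundary_at0 f p : boundary f p -> f 0 = cmean p.
Proof.
move=> [_ _ _ ->]; last by apply/disc_nc; rewrite nc0.
by apply: eq_cmean => t _; rewrite mul0r subr0 divr1.
Qed.

(** Shows that functions in the unit ball whose values at 0 tend to 1 have boundary functions
    tending to 1 in [L2]. *)
Lemma n2_sub1_le f p : boundary f p -> aeD (fun t => nc (p t) <= 1) ->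
  n2 (fun t => p t - 1) <= 2 - 2 * Re (f 0).
Proof.
move=> bf p1; have [lp _ _ _] := bf; have lRe := (L2_CL1 lp).1.
have -> : n2 (fun t => p t - 1) = mean (fun t => (nc (p t) ^+ 2 + 1) + (-2) * Re (p t)).
  by apply: eq_mean => t _; rewrite !nc_sq; case: (p t) => x y /=; ring.
rewrite meanD; [|by apply: L1D; [exact: lp.2|exact: L1_cst]|exact: L1Z].
rewrite meanZ// meanD; [|exact: lp.2|exact: L1_cst].
by rewrite mean_cst (boundary_at0 bf) /=; have := n2_le1 lp p1; rewrite /n2; lra.
Qed.

Lemma radial_nc_le f p M : radial f p -> (forall z, disc z -> nc (f z) <= M) ->
  aeD (fun t => nc (p t) <= M).
Proof.
move=> rp fM; apply: aeDS rp => t _ h.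
apply: (nc_cvg_le _ h); apply: filterS (near_left1 R) => r r01; apply: fM; exact: disc_scale.
Qed.

Lemma hardy2_bounded_disc f : analytic_disc f -> bounded_disc f -> hardy2 f.
Proof. by move=> af [M hM]; exact: hardy2_bounded af hM. Qed.

(** Division by an outer function, as in the Smirnov theorem. The products e_n f lie in the unit
    ball and their values at 0 tend to 1, so by [n2_sub1_le] their boundary functions tend to 1 in
    [L2], and the moment of [q] is the limit of vanishing ones. *)
Lemma quasi_invertible_moment f p q m : analytic_disc f -> quasi_invertible f -> radial f p -> L2 q ->
  (forall e s, bounded_disc e -> boundary e s -> cmean (fun t => q t * (s t * p t) * eit t ^+ m.+1) = 0) ->
  cmean (fun t => q t * eit t ^+ m.+1) = 0.
Proof.
move=> af [e [e1 e2 e3 e4]] rp lq hq; set X := cmean _.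
have lqe : L2 (fun t => q t * eit t ^+ m.+1).
  apply: L2_eq (L2M (M := 1) (cmeas_eitX R m.+1) _ lq) => t _; first by rewrite mulrC.
  by rewrite nc_eitX.
have d0 : disc (0 : C) by apply/disc_nc; rewrite nc0.
have hX n : nc X ^+ 2 <= n2 (fun t => q t * eit t ^+ m.+1) * (2 - 2 * Re (e n 0 * f 0)).
  have [s bs] := hardy2_boundary (hardy2_bounded_disc (e1 n) (e2 n)).
  have aE : analytic_disc (fun z => e n z * f z) by exact: (analyticM (e1 n) af).
  have [w bw] := hardy2_boundary (hardy2_bounded aE (e3 n)).
  have [lw _ rw _] := bw; have [_ _ rs _] := bs.
  have ws := radial_uniq rw (radialM rs rp).
  (* Subtracting the moment of [q w], which vanishes by hypothesis, leaves a pairing with [w - 1],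
     to be made small by Cauchy-Schwarz. *)
  have XE : X = - cmean (fun t => q t * eit t ^+ m.+1 * (w t - 1)).
    rewrite (@eq_cmean _ _ (fun t => q t * w t * eit t ^+ m.+1 - q t * eit t ^+ m.+1)); last by move=> t _; ring.
    rewrite cmeanB; [|by apply: CL1_mul_eitX; exact: CL1_mul|exact: L2_CL1].
    rewrite (@cmean_ae _ _ (fun t => q t * (s t * p t) * eit t ^+ m.+1)); last by apply: aeDS ws => t _ ->.
    by rewrite (hq _ _ (e2 n) bs) sub0r opprK.
  rewrite XE ncN; apply: le_trans (cauchy_schwarz lqe (L2B lw (L2_cst 1))) _.
  rewrite ler_wpM2l ?n2_ge0//; apply: (n2_sub1_le bw).
  exact: radial_nc_le rw (e3 n).
apply: (nc_sqr_cvg0 hX).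
have c1 : (fun n => Re (e n 0 * f 0)) @ \oo --> Re (1 : C) by exact: (cvgC_Re (e4 _ d0)).
have -> : (0 : R) = n2 (fun t => q t * eit t ^+ m.+1) * (2 - 2 * Re (1 : C)).
  by rewrite /= mulr1 subrr mulr0.
by apply: cvgM; [exact: cvg_cst|apply: cvgB; [exact: cvg_cst|exact: (cvgM (cvg_cst _) c1)]].
Qed.

Lemma nonzero_boundary f p : boundary f p -> aeD (fun t => p t != 0) -> nonzero_disc f.
Proof.
move=> bf p0; apply: contrapT => nf.
have fz z : disc z -> f z = 0.
  by move=> dz; apply: contrapT => h; apply: nf; exists z => //; exact/eqP.
have [t _] : exists2 t, D t & False; last by [].
apply: aeD_ex; have [_ _ r0 _] := boundary_cst0; have [_ _ rp _] := bf.
have r1 : radial f (fun=> 0) by apply: radial_eq r0 => z dz; rewrite fz.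
by apply: aeDS2 (radial_uniq rp r1) p0 => t _ -> /eqP.
Qed.

Lemma boundary_neq0 f p : boundary f p -> nonzero_disc f -> aeD (fun t => p t != 0).
Proof. by move=> bf f0; have [] := log_integrable bf f0. Qed.

Lemma boundary_mul_bounded f g p q : bounded_disc g -> boundary g q -> boundary f p ->
  boundary (fun z => g z * f z) (fun t => q t * p t).
Proof.
move=> bdg bg bf; have hg := boundary_hardy2 bg; have hf := boundary_hardy2 bf.
have [w bw] := hardy2_boundary (hardy2M_bounded hf hg.1 bdg).
have [lq _ rq _] := bg; have [lp _ rp _] := bf; have [_ _ rw _] := bw.
apply: (boundary_ae bw); first by apply: cmeasM; [exact: lq.1|exact: lp.1].
exact: radial_uniq rw (radialM rq rp).
Qed.

Lemma cmeas_eit_comp (B : R -> R) : meas B -> cmeas (fun t => eit (B t)).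
Proof.
move=> mB; split.
  apply: (@meas_comp _ (@cos R)) => //; apply: continuous_measurable_fun; exact: continuous_cos.
apply: (@meas_comp _ (@sin R)) => //; apply: continuous_measurable_fun; exact: continuous_sin.
Qed.

Lemma inner_boundary psi : inner_function psi ->
  exists b, [/\ boundary psi b, aeD (fun t => nc (b t) = 1) & bounded_disc psi].
Proof.
move=> [apsi [M psiM] psi1].
have bpsi : bounded_disc psi by exists M => z dz; apply/norm_ncP; exact: psiM.
have [b bb] := hardy2_boundary (hardy2_bounded_disc apsi bpsi).
exists b; split=> //; have [_ _ rb _] := bb.
apply: aeDS2 psi1 (radial_bv rb) => t _ + E.
by rewrite E normcE => /complexI.
Qed.

(** Nonconstancy enters as |psi 0| < 1: equality would make psi constant by [unimodular_const]. *)
Lemma inner_angle psi : inner_function psi -> nonconstant_disc psi ->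
  exists B : R -> R, [/\ forall t, D (B t), meas B, boundary psi (fun t => eit (B t)) & nc (psi 0) < 1].
Proof.
move=> /inner_boundary[b [bb b1 _]] [z [w [dz dw zw]]].
exists (fun t => angle (b t)); have [lb _ _ _] := bb.
have mB : meas (fun t => angle (b t)) by exact: meas_angle lb.1.
split=> //.
- by move=> t; exact: angle_bound.
- apply: (boundary_ae bb); first exact: cmeas_eit_comp.
  by apply: aeDS b1 => t _ h; rewrite eit_angle.
- have b2 : aeD (fun t => nc (b t) <= 1) by apply: aeDS b1 => t _ ->.
  rewrite lt_neqAle (boundary_le bb b2) ?andbT; last by apply/disc_nc; rewrite nc0.
  apply/eqP => h; move/eqP: zw; apply.
  by rewrite (unimodular_const bb b2 h dz) (unimodular_const bb b2 h dw).
Qed.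

End ToeplitzKernel.

(** * Cofactors of kernel elements and of maximal vectors *)

Section MaximalVector.
Variable R : realType.
Local Notation C := R[i].
Implicit Types (p q s : R -> C) (f g h F : C -> C) (z c : C) (t : R).

Lemma LinftyM_bv g q h : boundary g q -> bounded_disc g -> Linfty h -> Linfty (fun w => bv g w * h w).
Proof.
move=> bg [N gN] /Linfty_rep[k [M [mk kM hk]]]; have [lq _ rq _] := bg.
apply: (@circle_rep _ _ (fun t => q t * k t) (N * M)).
- by apply: cmeasM => //; exact: lq.1.
- by apply: aeDS2 hk (radial_bv rq) => t _ -> ->.
- apply: aeDS (radial_nc_le rq gN) => t _ h1.
  by rewrite ncM ler_pM ?nc_ge0.
Qed.

Lemma unimodular_conj z : nc z = 1 -> z * conjc z = 1.
Proof. by move=> z1; rewrite mulcJ z1 expr1n. Qed.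

Lemma inner_outer_boundary g s : boundary g s -> nonzero_disc g ->
  exists (I Q : C -> C) (i om : R -> C),
  [/\ boundary I i, aeD (fun t => nc (i t) = 1), forall z, disc z -> nc (I z) <= 1 &
    [/\ boundary Q om, quasi_invertible Q, forall z, disc z -> g z = I z * Q z &
      aeD (fun t => s t = i t * om t)]].
Proof.
move=> bg g0; have [I [Q [i [bI i1 hQ qQ gE]]]] := inner_outer (boundary_hardy2 bg) g0.
have [om bQ] := hardy2_boundary hQ.
have I1 : forall z, disc z -> nc (I z) <= 1.
  by apply: (boundary_le bI); apply: aeDS i1 => t _ ->.
exists I, Q, i, om; split=> //; split=> //.
have [_ _ rg _] := bg; have [_ _ rIQ _] := boundary_mul_bounded (ex_intro _ 1 I1) bI bQ.
by apply: (radial_uniq rg); apply: radial_eq rIQ => z dz; rewrite gE.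
Qed.

(** Write the cofactor as g = I Q. Minimality of ker T_F at [f], tested with the symbol I F, sends I
    f into ker T_(I F), and this says that I divides the outer factor Q. Then |I(0)| = 1, so I is
    constant. *)
Lemma maximal_quasi_invertible F f p g s : Linfty F -> maximal_vector f (kerT F) ->
  boundary f p -> boundary g s -> nonzero_disc g ->
  aeD (fun t => F (eit t) * p t = conjc (eit t * s t)) -> quasi_invertible g.
Proof.
move=> lF [_ _ [_ _ minF]] bf bg g0 Fp.
have [I [Q [i [om [bI i1 I1 [bO qO gE sE]]]]]] := inner_outer_boundary bg g0.
have i1' : aeD (fun t => nc (i t) <= 1) by apply: aeDS i1 => t _ ->.
have bdI : bounded_disc I by exists 1.
have [_ _ rI _] := bI.
(* Multiplying the symbol by I cancels the conjugate of I in F f = conj(z I Q), so [f] has cofactor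
   Q for [h]. *)
pose h w := bv I w * F w; have lh : Linfty h by exact: LinftyM_bv bI bdI lF.
have hE : aeD (fun t => h (eit t) = i t * F (eit t)).
  by apply: aeDS (radial_bv rI) => t _ E; rewrite /h E.
have hp : aeD (fun t => h (eit t) * p t = conjc (eit t * om t)).
  apply: aeDS2 (aeD_and hE i1) (aeD_and Fp sE) => t _ [-> it] [Ft st].
  rewrite -mulrA Ft st !conjcM mulrCA; congr (_ * _).
  by rewrite mulrA unimodular_conj// mul1r.
have Kh : kerT F `<=` kerT h.
  apply: minF => // _ ->; apply/(kerTP lh bf); by exists Q, om.
have bIf := boundary_mul_bounded bdI bI bf.
(* The same identity, read with I attached to [f] instead of F. *)
have : kerT F (fun z => I z * f z).
  apply/(kerTP lF bIf); exists Q, om; split=> //.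
  by apply: aeDS2 hp hE => t _ <- ->; ring.
move=> /Kh /(kerTP lh bIf)[q [s' [bq E]]].
have oE : aeD (fun t => om t = i t * s' t).
  apply: aeDS2 (aeD_and E hp) i1 => t _ [E1 E2] it.
  have E3 : i t * conjc (eit t * om t) = conjc (eit t * s' t) by rewrite -E1 -E2; ring.
  have := congr1 (fun x => conjc (eit t) * i t * conjc x) E3.
  rewrite /= !conjcM !conjcK.
  have -> : conjc (eit t) * i t * (eit t * s' t) = eit t * conjc (eit t) * (i t * s' t) by ring.
  have -> : conjc (eit t) * i t * (conjc (i t) * (eit t * om t)) =
    eit t * conjc (eit t) * (i t * conjc (i t)) * om t by ring.
  by rewrite eitJ unimodular_conj// !mul1r.
have OE := boundary_inj bO (boundary_mul_bounded bdI bI bq) oE.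
have d0 : disc (0 : C) by apply/disc_nc; rewrite nc0.
have [e [e1 e2 e3 e4]] := qO.
(* On the circle |e_n q| = |e_n I q| = |e_n Q| is at most 1. *)
have eq1 n : nc (e n 0 * q 0) <= 1.
  have [w bw] := hardy2_boundary (hardy2_bounded_disc (e1 n) (e2 n)).
  apply: (boundary_le (boundary_mul_bounded (e2 n) bw bq)) => //.
  have [_ _ rw _] := bw; have [_ _ rO _] := bO.
  apply: aeDS2 (radial_nc_le (radialM rw rO) (e3 n)) (aeD_and oE i1) => t _ h1 [omt it].
  by move: h1; rewrite omt !ncM it mul1r.
(* At 0, e_n Q = I e_n q tends to 1, while e_n q has modulus at most 1. *)
have I01 : 1 <= nc (I 0).
  have c : (fun n => nc (e n 0 * Q 0)) @ \oo --> (1 : R) by rewrite -(nc1 R); exact: (cvg_nc (e4 0 d0)).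
  rewrite -(cvg_lim _ c)//; apply: limr_le; first by apply/cvg_ex; eexists; exact: c.
  apply: nearW => n; rewrite OE// mulrCA ncM -[X in _ <= X]mulr1.
  by rewrite ler_wpM2l ?nc_ge0.
have {}I01 : nc (I 0) = 1 by apply/eqP; rewrite eq_le I01 I1.
apply: (quasi_invertible_rotate I01 _ qO) => z dz.
by rewrite gE// (unimodular_const bI i1' I01 dz).
Qed.

(** A vanishing cofactor would give F p = 0, hence F = 0, almost everywhere. *)
Lemma cofactor_nonzero F p g s : ~ ae_circle (fun w => F w = 0) -> aeD (fun t => p t != 0) ->
  boundary g s -> aeD (fun t => F (eit t) * p t = conjc (eit t * s t)) -> nonzero_disc g.
Proof.
move=> F0 p0 bg Fp; apply: contrapT => ng; apply: F0.
have [_ _ r0 _] := boundary_cst0 R; have [_ _ rg _] := bg.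
have r1 : radial g (fun=> 0).
  apply: radial_eq r0 => z dz; apply: contrapT => h; apply: ng; exists z => //.
  by apply/eqP => h1; apply: h.
apply: aeDS2 (aeD_and p0 Fp) (radial_uniq rg r1) => t _ [pt Ft] st.
by move: Ft; rewrite st mulr0 conjc0 => /eqP; rewrite mulf_eq0 (negPf pt) orbF => /eqP.
Qed.

(** Multiplying [f] by the inner factor of its cofactor strips that factor from the cofactor, since
    the inner factor times its conjugate is 1 on the circle. *)
Lemma exists_quasi_invertible F f : Linfty F -> ~ ae_circle (fun w => F w = 0) ->
  kerT F f -> nonzero_disc f ->
  exists f1 p g s, [/\ kerT F f1, boundary f1 p, boundary g s, quasi_invertible g &
    aeD (fun t => F (eit t) * p t = conjc (eit t * s t))].
Proof.
move=> lF F0 Kf f0; have [p bf] := hardy2_boundary Kf.1.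
have [g [s [bg Fp]]] := (kerTP lF bf).1 Kf.
have p0 := boundary_neq0 bf f0.
have g0 := cofactor_nonzero F0 p0 bg Fp.
have [I [Q [i [om [bI i1 I1 [bO qO gE sE]]]]]] := inner_outer_boundary bg g0.
have bIf := boundary_mul_bounded (ex_intro _ 1 I1) bI bf.
have E : aeD (fun t => F (eit t) * (i t * p t) = conjc (eit t * om t)).
  apply: aeDS2 (aeD_and Fp i1) sE => t _ [Ft it] st.
  rewrite mulrCA Ft st !conjcM mulrCA; congr (_ * _).
  by rewrite mulrA unimodular_conj// mul1r.
exists (fun z => I z * f z), (fun t => i t * p t), Q, om; split; [|exact: bIf|exact: bO|exact: qO|exact: E].
by apply/(kerTP lF bIf); exists Q, om.
Qed.

End MaximalVector.

(** * The kernel of T_G *)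

Section WeightedComposition.
Variable R : realType.
Local Notation C := R[i].
Local Notation D := (@angles R).
Implicit Types (p q s : R -> C) (f g h : C -> C) (z c : C) (t : R).
Variables (F psi u uo : C -> C) (B : R -> R) (v om : R -> C).
Hypotheses (lF : Linfty F) (BD : forall t, D (B t)) (mB : meas B)
  (bpsi : boundary psi (fun t => eit (B t))) (psi0 : nc (psi 0) < 1)
  (bu : boundary u v) (bo : boundary uo om) (uo_qi : quasi_invertible uo)
  (v0 : aeD (fun t => v t != 0)) (vo : aeD (fun t => nc (v t) = nc (om t)))
  (image_hardy2 : weighted_comp u psi @` kerT F `<=` hardy2 (R := R)).

Local Notation G := (symbol_G F psi u uo).

Lemma symbol_G_circle : aeD (fun t =>
  G (eit t) = eit (B t) * F (eit (B t)) * (conjc (v t) / (eit t * om t))).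
Proof.
have [_ _ rp _] := bpsi; have [_ _ ru _] := bu; have [_ _ ro _] := bo.
by apply: aeDS2 (aeD_and (radial_bv ru) (radial_bv ro)) (radial_bv rp) => t _ [h1 h2] h3; rewrite /symbol_G h1 h2 h3.
Qed.

(** Since |u| = |uo| almost everywhere, G has the modulus of F o psi. *)
Lemma Linfty_symbol_G : Linfty G.
Proof.
have [k [M [mk kM Fk]]] := Linfty_rep lF.
have [lv _ _ _] := bu; have [lo _ _ _] := bo; have [lp _ _ _] := bpsi.
apply: (@circle_rep _ _ (fun t => eit (B t) * k (B t) * (conjc (v t) / (eit t * om t))) M).
- apply: cmeasM; [apply: cmeasM; [exact: lp.1|exact: (cmeas_comp BD mB mk)]|].
  apply: cmeasM; [exact: cmeasJ lv.1|apply: cmeasV; apply: cmeasM; [exact: cmeas_eit|exact: lo.1]].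
- by apply: aeDS2 symbol_G_circle (aeD_comp BD mB bpsi psi0 Fk) => t _ -> ->.
- apply: aeDS2 v0 vo => t _ h1 h2.
  rewrite !ncM ncV ncM !nc_eit nc_conj mul1r -h2 mul1r mulfV ?mulr1//.
  by rewrite nc_eq0.
Qed.

Lemma boundary_image f p : kerT F f -> boundary f p ->
  boundary (weighted_comp u psi f) (fun t => v t * p (B t)).
Proof.
move=> Kf bf.
have [k bk] : exists k, boundary (weighted_comp u psi f) k.
  by apply: hardy2_boundary; apply: image_hardy2; exists f.
have [lp _ rfp _] := boundary_comp BD mB bpsi psi0 bf.
have [_ _ rk _] := bk; have [lv _ ru _] := bu.
apply: (boundary_ae bk); first by apply: cmeasM; [exact: lv.1|exact: lp.1].
exact: radial_uniq rk (radialM ru rfp).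
Qed.

(** In G u (f o psi) the factor psi cancels against its conjugate from F o psi, and u conj(u) = uo
    conj(uo); so the cofactor of the image is (g o psi) uo. *)
Lemma symbol_G_image f p s : aeD (fun t => F (eit t) * p t = conjc (eit t * s t)) ->
  aeD (fun t => G (eit t) * (v t * p (B t)) = conjc (eit t * (s (B t) * om t))).
Proof.
move=> Fp; apply: aeDS2 (aeD_and symbol_G_circle (aeD_comp BD mB bpsi psi0 Fp)) (aeD_and v0 vo).
move=> t _ [-> Ft] [v0t vot].
have e0 := eit_neq0 t; have o0 : om t != 0 by rewrite -nc_eq0 -vot nc_eq0.
transitivity (eit (B t) * (F (eit (B t)) * p (B t)) * ((v t * conjc (v t)) / (eit t * om t))); first by ring.
rewrite Ft mulcJ vot -mulcJ !conjcM.
transitivity ((eit (B t) * conjc (eit (B t))) * conjc (s (B t)) * ((om t * conjc (om t)) / (eit t * om t))); first by ring.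
rewrite eitJ mul1r.
have -> : conjc (eit t) = (eit t)^-1 by apply: (mulfI e0); rewrite eitJ mulfV.
by field; rewrite e0 o0.
Qed.

(** A product of two H^2 functions is a priori only in H^1. Here (g o psi) uo coincides with [X],
    which is square integrable because G is bounded, and its moments vanish by [moment_mul]. *)
Lemma image_sub_kerT : weighted_comp u psi @` kerT F `<=` kerT G.
Proof.
move=> _ [f Kf <-]; have [p bf] := hardy2_boundary Kf.1.
have [g [s [bg Fp]]] := (kerTP lF bf).1 Kf.
have bk := boundary_image Kf bf; have [lk _ _ _] := bk.
have E := symbol_G_image f Fp.
have [k [M [mk kM Gk]]] := Linfty_rep Linfty_symbol_G.
pose X t := conjc (eit t) * conjc (k t * (v t * p (B t))).
have lX : L2 X by exact: L2_conj_shift mk kM lk.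
have XE : aeD (fun t => X t = s (B t) * om t).
  apply: aeDS2 Gk E => t _ -> E1; rewrite /X E1 conjcK mulrA.
  by rewrite [conjc _ * _]mulrC eitJ mul1r.
have [ls ms _ _] := boundary_comp BD mB bpsi psi0 bg.
have mX m : cmean (fun t => X t * eit t ^+ m.+1) = 0.
  rewrite -(moment_mul m ls ms bo); apply: cmean_ae; apply: aeDS XE => t _ ->.
  by [].
apply/(kerTP Linfty_symbol_G bk); exists (cauchy X), X; split; first exact: boundary_cauchy.
by apply: aeDS2 E XE => t _ -> ->.
Qed.

(** The heart of minimality: one [f] with an outer cofactor suffices. For x in ker T_G the candidate
    cofactor X = conj(z h x) is a quotient of q r by the outer function (g o psi) uo, and it is
    square integrable, hence in H^2. *)
Lemma kerT_G_sub f p g s h : kerT F f -> boundary f p -> boundary g s -> quasi_invertible g ->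
  aeD (fun t => F (eit t) * p t = conjc (eit t * s t)) ->
  Linfty h -> kerT h (weighted_comp u psi f) -> kerT G `<=` kerT h.
Proof.
move=> Kf bf bg g_qi Fp lh Kh x Kx.
have [y bx] := hardy2_boundary Kx.1; have [ly _ _ _] := bx.
have [r [rho [br Gx]]] := (kerTP Linfty_symbol_G bx).1 Kx.
have bk := boundary_image Kf bf.
have [q [sigma [bq hk]]] := (kerTP lh bk).1 Kh.
have E := symbol_G_image f Fp.
have [k [M [mk kM hk']]] := Linfty_rep lh.
pose X t := conjc (eit t) * conjc (k t * y t).
have lX : L2 X by exact: L2_conj_shift mk kM ly.
                                                                         
(* Cross-multiplication: (h x)(G k) = (h k)(G x), with k the image of [f], after conjugation and
   removal of the factors z. *)
have XE : aeD (fun t => X t * (s (B t) * om t) = sigma t * rho t).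
  apply: aeDS2 (aeD_and E Gx) (aeD_and hk hk') => t _ [E1 E2] [E3 E4].
  have : (k t * y t) * conjc (eit t * (s (B t) * om t)) = conjc (eit t * sigma t) * conjc (eit t * rho t).
    by rewrite -E1 -E2 -E3 E4; ring.
  move=> /(congr1 (fun z => conjc (eit t) ^+ 2 * conjc z)); rewrite /= !conjcM !conjcK => E5.
  transitivity ((eit t * conjc (eit t)) * X t * (s (B t) * om t)); first by rewrite eitJ mul1r.
  rewrite /X conjcM.
  transitivity (conjc (eit t) ^+ 2 * (conjc (k t) * conjc (y t) * (eit t * (s (B t) * om t)))); first by ring.
  rewrite E5; transitivity ((eit t * conjc (eit t)) ^+ 2 * (sigma t * rho t)); first by ring.
  by rewrite eitJ expr1n mul1r.
have [ls _ rs _] := boundary_comp BD mB bpsi psi0 bg.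
have [lo _ ro _] := bo.
have mX m : cmean (fun t => X t * eit t ^+ m.+1) = 0.
  have aO : analytic_disc (fun z => g (psi z) * uo z).
    apply: analyticM; last exact: (boundary_hardy2 bo).1.
    by have := (boundary_hardy2 (boundary_comp BD mB bpsi psi0 bg)).1.
  have qO := quasi_invertibleM (quasi_invertible_comp bpsi psi0 g_qi) uo_qi.
  apply: (quasi_invertible_moment aO qO (radialM rs ro) lX) => e w bde be.
  have [lm mm _ _] := boundary_mul_bounded bde be bq.
  rewrite -(moment_mul m lm mm br); apply: cmean_ae; apply: aeDS XE => t _ E1.
  by rewrite mulrCA E1; ring.
apply/(kerTP lh bx); exists (cauchy X), X; split; first exact: boundary_cauchy.
apply: aeDS hk' => t _ ->; rewrite /X mulrA eitJ mul1r.
by rewrite conjcK.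
Qed.

End WeightedComposition.

Theorem theorem3p13 (R : realType) (F psi u uo : R[i] -> R[i])
  (F_Linfty : Linfty F)
  (F_neq0 : ~ ae_circle (fun w => F w = 0))
  (psi_inner : inner_function psi)
  (psi_nonconstant : nonconstant_disc psi)
  (u_hardy2 : hardy2 u)
  (u_neq0 : nonzero_disc u)
  (kerF_neq0 : exists2 f, kerT F f & nonzero_disc f)
  (image_hardy2 : weighted_comp u psi @` kerT F `<=` hardy2 (R := R))
  (uo_outer : outer_factor u uo) :
  [/\ Linfty (symbol_G F psi u uo),
      minimal_toeplitz_kernel (weighted_comp u psi @` kerT F)
        (kerT (symbol_G F psi u uo)) &
      forall phi, maximal_vector phi (kerT F) ->
        maximal_vector (weighted_comp u psi phi)
          (kerT (symbol_G F psi u uo))].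
Proof.
have [B [BD mB bpsi psi0]] := inner_angle psi_inner psi_nonconstant.
have [uo_hardy2 uo_out [theta theta_inner uE]] := uo_outer.
have uo_qi := outer_quasi_invertible uo_out.
have [v bu] := hardy2_boundary u_hardy2; have [om bo] := hardy2_boundary uo_hardy2.
have v0 := boundary_neq0 bu u_neq0.
(* u and uo differ by an inner factor, unimodular on the circle. *)
have vo : aeD (fun t => nc (v t) = nc (om t)).
  have [b [bth b1 _]] := inner_boundary theta_inner.
  have [_ _ ru _] := bu; have [_ _ ro _] := bo; have [_ _ rth _] := bth.
  have ru' : radial u (fun t => b t * om t).
    by apply: radial_eq (radialM rth ro) => z dz; rewrite uE.
  by apply: aeDS2 (radial_uniq ru ru') b1 => t _ -> b1t; rewrite ncM b1t mul1r.
have lG := Linfty_symbol_G F_Linfty BD mB bpsi psi0 bu bo v0 vo.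
have sub := image_sub_kerT F_Linfty BD mB bpsi psi0 bu bo v0 vo image_hardy2.
have KG : toeplitz_kernel (kerT (symbol_G F psi u uo)) by exists (symbol_G F psi u uo).
have minG := kerT_G_sub F_Linfty BD mB bpsi psi0 bu bo uo_qi v0 vo image_hardy2.
split=> //.
- split=> // h lh hsub; have [f Kf f0] := kerF_neq0.
  (* Any nonzero element of ker T_F can be traded for one with an outer cofactor; its image alone
     forces ker T_G into ker T_h. *)
  have [f1 [p [g [s [Kf1 bf1 bg qg Fp]]]]] := exists_quasi_invertible F_Linfty F_neq0 Kf f0.
  by apply: (minG _ _ _ _ _ Kf1 bf1 bg qg Fp lh); apply: hsub; exists f1.
- move=> phi maxphi; have [hphi phi0 [_ phiK _]] := maxphi.
  have Kphi : kerT F phi by exact: phiK.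
  have [p bphi] := hardy2_boundary hphi.
  have [g [s [bg Fp]]] := (kerTP F_Linfty bphi).1 Kphi.
  have p0 := boundary_neq0 bphi phi0.
  have bk := boundary_image BD mB bpsi psi0 bu image_hardy2 Kphi bphi.
  split; first exact: boundary_hardy2 bk.
    apply: (nonzero_boundary bk); apply: aeDS2 v0 (aeD_comp BD mB bpsi psi0 p0) => t _ h1 h2.
    by rewrite mulf_neq0.
  split=> // [_ ->|h lh hsub]; first by apply: sub; exists phi.
  have g0 := cofactor_nonzero F_neq0 p0 bg Fp.
  (* For a maximal vector no trade is necessary: its own cofactor is outer. *)
  have qg := maximal_quasi_invertible F_Linfty maxphi bphi bg g0 Fp.
  apply: (minG _ _ _ _ _ Kphi bphi bg qg Fp lh); exact: hsub.
Qed.
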